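(* Let $S:[0,\infty)\to\mathbb{R}$ be a non-decreasing function, and suppose that the Laplace transform $$G(s) := \int_0^\infty S(e^u)\, e^{-su}\,du$$ exists for all $s\in\mathbb{C}$ with $\operatorname{Re} s>1$. For a bounded interval $I\subset\mathbb{R}$ that is symmetric with respect to the origin and for $\epsilon>0$, let $W_{S,I,\epsilon}$ be the operator on $L^2(I)$ given by $$W_{S,I,\epsilon}f(t) = \frac{1}{\pi}\int_I f(\tau)\,\operatorname{Re} G\big(1+\epsilon+\mathrm{i}(t-\tau)\big)\,d\tau ,\qquad t\in I.$$ Then, for every constant $A$, the following two statements are equivalent: (i) For every sufficiently large $I$ (that is, there is $L_0>0$ such that for every bounded interval $I$ symmetric with respect to the origin of length $|I|\ge L_0$), the operators $W_{S,I,\epsilon}$ converge, as $\epsilon\to0^+$, in the weak operator topology on $L^2(I)$ to an operator $W_{S,I}$ satisfying $$W_{S,I} = A\,\mathrm{Id} + \Psi_{S,I}$$ for some compact operator $\Psi_{S,I}$ on $L^2(I)$. (ii) $$\lim_{u\to\infty}\frac{S(e^u)}{e^u} = A.$$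
   Context: $L^2(I)$ is the complex Hilbert space of square-integrable functions on $I$ with respect to Lebesgue measure, and $\mathrm{Id}$ is the identity operator on $L^2(I)$. Convergence in the weak operator topology means that $\langle W_{S,I,\epsilon}f,g\rangle\to\langle W_{S,I}f,g\rangle$ as $\epsilon\to0^+$ for all $f,g\in L^2(I)$, where $W_{S,I}$ is a bounded operator on $L^2(I)$. *)

(* Defs.v *)
From HB Require Import structures.
From mathcomp Require Import all_boot all_order all_algebra.
From mathcomp Require Import complex.
From mathcomp Require Import all_classical all_reals all_analysis.

Set Implicit Arguments.
Unset Strict Implicit.
Unset Printing Implicit Defensive.
Import Order.TTheory GRing.Theory Num.Theory.
Import numFieldNormedType.Exports.

Local Open Scope classical_set_scope.
Local Open Scope ring_scope.
Local Open Scope complex_scope.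

Local Notation Re := (@complex.Re _).
Local Notation Im := (@complex.Im _).

Section ComplexIntegration.
Context {R : realType}.
Notation mu := (@lebesgue_measure R).

Definition cmeasurable_fun (D : set R) (f : R -> R[i]) : Prop :=
  measurable_fun D (Re \o f) /\ measurable_fun D (Im \o f).

Definition cintegrable (D : set R) (f : R -> R[i]) : Prop :=
  mu.-integrable D (EFin \o Re \o f) /\ mu.-integrable D (EFin \o Im \o f).

(* Meaningful when [cintegrable D f]. *)
Definition cintegral (D : set R) (f : R -> R[i]) : R[i] :=
  Rintegral mu D (Re \o f) +i* Rintegral mu D (Im \o f).

Definition cexp (z : R[i]) : R[i] :=
  (expR (Re z))%:C * (cos (Im z) +i* sin (Im z)).

End ComplexIntegration.

(* L^2(I) is handled through representatives R -> R[i]: only the values on I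
   matter, and two representatives are identified when they agree a.e. on I. *)
Section L2.
Context {R : realType}.
Notation mu := (@lebesgue_measure R).
Implicit Types (I : set R) (f g : R -> R[i]).

Definition L2norm I f : \bar R :=
  'N[mu]_(2%:E)[(fun x => (Re `|f x|)%:E) \_ I].

Definition inL2 I f : Prop := cmeasurable_fun I f /\ (L2norm I f < +oo)%E.

Definition L2eq I f g : Prop := {ae mu, forall x, I x -> f x = g x}.

Definition L2inner I f g : R[i] := cintegral I (fun x => f x * (g x)^*).

(* Bounded linear operators on L^2(I); linearity and boundedness make T
   compatible with a.e. equality on I. *)
Definition bounded_operator I (T : (R -> R[i]) -> (R -> R[i])) : Prop :=
  [/\ forall f, inL2 I f -> inL2 I (T f),
      forall (a : R[i]) f g, inL2 I f -> inL2 I g ->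
        L2eq I (T (fun x => a * f x + g x)) (fun x => a * T f x + T g x)
    & exists M : R, forall f, inL2 I f ->
        (L2norm I (T f) <= M%:E * L2norm I f)%E].

(* The image of every bounded sequence has a norm-convergent subsequence. *)
Definition compact_operator I (T : (R -> R[i]) -> (R -> R[i])) : Prop :=
  bounded_operator I T /\
  forall (f : nat -> R -> R[i]) (M : R),
    (forall n, inL2 I (f n) /\ (L2norm I (f n) <= M%:E)%E) ->
    exists (k : nat -> nat) (g : R -> R[i]),
      [/\ {homo k : m n / (m < n)%N}, inL2 I g
        & L2norm I (fun x => T (f (k n)) x - g x) @[n --> \oo] --> 0%E].

End L2.

Section Laplace.
Context {R : realType}.
Implicit Types (S : R -> R) (I : set R).

Definition laplace_integrand S (s : R[i]) (u : R) : R[i] :=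
  (S (expR u))%:C * cexp (- (s * u%:C)).

Definition laplace S (s : R[i]) : R[i] :=
  cintegral `[0, +oo[ (laplace_integrand S s).

Definition W_eps S I (eps : R) (f : R -> R[i]) (t : R) : R[i] :=
  (pi^-1)%:C * cintegral I (fun tau =>
     f tau * (Re (laplace S ((1 + eps) +i* (t - tau))))%:C).

Definition weak_limit_W S I (W : (R -> R[i]) -> (R -> R[i])) : Prop :=
  forall f g, inL2 I f -> inL2 I g ->
    L2inner I (W_eps S I eps f) g @[eps --> (0 : R)^'+]
      --> (L2inner I (W f) g : R[i]^o).

Definition bounded_symmetric_interval I : Prop :=
  [/\ is_interval I, bounded_set I & forall x, I x -> I (- x)].

End Laplace.

(* Main.v *)
(* For real f, g on a bounded I, exchanging integrals turns <W_{S,I,eps} f, g> into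
   pi^-1 int_0^oo exp(-eps u) a(u) spec(u) du, where a(u) = S(e^u) / e^u and spec is
   the real part of the product of the Fourier transform of f by the conjugate of
   that of g; by Plancherel, a = 1 gives <f, g> as eps -> 0.

   (ii) => (i): a = A + b with b bounded and vanishing at infinity, so the forms
   converge to A <f, g> plus the form of the Fourier multiplier b.  That multiplier is
   compact: bounded sequences in L^2(I) have equi-Lipschitz transforms, so along a
   subsequence these converge pointwise, boundedly on compact sets, while the decay of
   b makes the high frequencies uniformly small.

   (i) => (ii): test the form on cos(l t) and sin(l t) over I = [-L, L], l -> oo.
   Compactness of Psi and the Riemann-Lebesgue lemma give <Psi f_l, f_l> -> 0, so
   the averages of a against a Fejer-like kernel centred at l tend to A.  This kernel
   has all but O(1 / (L d)) of its mass within distance d of l, and e^u a(u) is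
   non-decreasing; letting L -> oo and then d -> 0 forces a -> A. *)
Require Import Defs.
From HB Require Import structures.
From mathcomp Require Import all_boot all_order all_algebra.
From mathcomp Require Import complex.
From mathcomp Require Import all_classical all_reals all_analysis.
From mathcomp Require Import measurable_realfun.
From mathcomp Require Import ring lra.
Set Implicit Arguments.
Unset Strict Implicit.
Unset Printing Implicit Defensive.
Import Order.TTheory GRing.Theory Num.Theory.
Import numFieldNormedType.Exports.
Local Open Scope classical_set_scope.
Local Open Scope ring_scope.

(** Everything is reduced to real functions: the kernel [Re G] is real, so the operators act on real
    and imaginary parts separately. [A] is still complex, and its imaginary part is eliminated in
    each direction. The obstacle in (i) => (ii) is that nothing bounds [a] beforehand and that the
    hypothesis speaks only of limits of Abel means. Replacing [S(e^u)] by [S(e^u) - S(1)] makes the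
    weight nonnegative, so that Fatou's lemma removes the factor [exp(-eps u)]; the term
    [S(1) exp(-u)] contributes nothing as l -> oo. Boundedness of [a] then comes from the lower
    averaging estimate alone, whose error is relative; only after that can the tails of the upper
    one be bounded. Cosine and sine waves are paired because their spectra add up to a kernel
    without cross terms, whose mass is independent of l. The obstacle in (ii) => (i) is that [Psi]
    must be an actual operator on L^2(I): the transform, multiplied by [b], is followed by the
    adjoint of the transform, an L^2 limit of truncated inversion integrals. Bessel's inequality
    suffices to build it, and rests on a Schur test for the Poisson kernel. *)

(* Sealed so that [done] does not try to evaluate the boolean [integrable]. *)
HB.lock Definition L1 (R : realType) (D : set R) (f : R -> R) : Prop :=
  (@lebesgue_measure R).-integrable D (EFin \o f).

(** * Lebesgue integrals of real functions, Fatou and Fubini *)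

Section RealIntegrals.
Context {R : realType}.
Notation mu := (@lebesgue_measure R).
Implicit Types (D : set R) (f g h : R -> R) (M r : R).

Lemma L1E D f : L1 D f = mu.-integrable D (EFin \o f) :> Prop.
Proof. by rewrite unlock. Qed.

Lemma L1_meas D f : L1 D f -> measurable_fun D f.
Proof. by rewrite L1E => /integrableP[/measurable_EFinP]. Qed.

Lemma L1_bounded_by D f g : measurable D -> measurable_fun D f ->
  (forall x, D x -> `|f x| <= g x) -> L1 D g -> L1 D f.
Proof.
rewrite !L1E => mD mf fg ig; apply: le_integrable ig => //; first exact/measurable_EFinP.
move=> x Dx; rewrite /= lee_fin (le_trans (fg x Dx))//; exact: ler_norm.
Qed.

Lemma L1D D f g : measurable D -> L1 D f -> L1 D g -> L1 D (fun x => f x + g x).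
Proof. by rewrite !L1E => mD iF ig; exact: (@integrableD _ _ _ mu D mD (EFin \o f) (EFin \o g)). Qed.

Lemma L1B D f g : measurable D -> L1 D f -> L1 D g -> L1 D (fun x => f x - g x).
Proof. by rewrite !L1E => mD iF ig; exact: (@integrableB _ _ _ mu D mD (EFin \o f) (EFin \o g)). Qed.

Lemma L1Zl D r f : measurable D -> L1 D f -> L1 D (fun x => r * f x).
Proof. by rewrite !L1E => mD iF; exact: (@integrableZl _ _ _ mu D mD r (EFin \o f)). Qed.

Lemma L1_abs D f : L1 D f -> L1 D (fun x => `|f x|).
Proof. by rewrite !L1E; exact: integrable_norm. Qed.

Lemma L1_eq D f g : measurable D -> (forall x, D x -> f x = g x) -> L1 D f -> L1 D g.
Proof.
rewrite !L1E => mD fg; apply: eq_integrable => // x /set_mem Dx /=; by rewrite fg.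
Qed.

Lemma L1_mul_bounded D f h M : measurable D -> L1 D f -> measurable_fun D h ->
  (forall x, D x -> `|h x| <= M) -> L1 D (fun x => f x * h x).
Proof.
move=> mD iF mh hM; apply: (@L1_bounded_by _ _ (fun x => M * `|f x|)) => //.
- by apply: measurable_funM => //; exact: L1_meas.
- by move=> x Dx; rewrite normrM mulrC ler_wpM2r// hM.
- exact/L1Zl/L1_abs.
Qed.

Lemma L1_bounded D h M : measurable D -> (mu D < +oo)%E -> measurable_fun D h ->
  (forall x, D x -> `|h x| <= M) -> L1 D h.
Proof.
rewrite L1E => mD muD mh hM; apply: measurable_bounded_integrable => //.
exists M; split; first exact: num_real.
by move=> y My x Dx; rewrite /= (le_trans (hM x Dx))// ltW.
Qed.

Lemma L1_S D D' f : measurable D -> measurable D' -> D' `<=` D -> L1 D f -> L1 D' f.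
Proof. by rewrite !L1E => mD mD' DD; exact: integrableS. Qed.

Lemma EFin_int D f : measurable D -> L1 D f ->
  (\int[mu]_(x in D) (f x)%:E)%E = (\int[mu]_(x in D) f x)%:E.
Proof. by rewrite L1E => mD iF; rewrite /Rintegral fineK//; exact: integrable_fin_num. Qed.

Lemma eq_int D f g : (forall x, D x -> f x = g x) ->
  \int[mu]_(x in D) f x = \int[mu]_(x in D) g x.
Proof. by move=> fg; apply: eq_Rintegral => x /set_mem /fg. Qed.

Lemma intD D f g : measurable D -> L1 D f -> L1 D g ->
  \int[mu]_(x in D) (f x + g x) = \int[mu]_(x in D) f x + \int[mu]_(x in D) g x.
Proof. by rewrite !L1E; exact: (@RintegralD _ _ _ mu). Qed.

Lemma intB D f g : measurable D -> L1 D f -> L1 D g ->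
  \int[mu]_(x in D) (f x - g x) = \int[mu]_(x in D) f x - \int[mu]_(x in D) g x.
Proof. by rewrite !L1E; exact: (@RintegralB _ _ _ mu). Qed.

Lemma intZl D f r : measurable D -> L1 D f ->
  \int[mu]_(x in D) (r * f x) = r * \int[mu]_(x in D) f x.
Proof. by rewrite L1E; exact: (@RintegralZl _ _ _ mu). Qed.

Lemma intZr D f r : measurable D -> L1 D f ->
  \int[mu]_(x in D) (f x * r) = \int[mu]_(x in D) f x * r.
Proof. by rewrite L1E; exact: (@RintegralZr _ _ _ mu). Qed.

Lemma int_cst D r : measurable D -> \int[mu]_(x in D) r = r * fine (mu D).
Proof. by move=> mD; exact: (@Rintegral_cst _ _ _ mu). Qed.

Lemma int_le D f g : measurable D -> L1 D f -> L1 D g ->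
  (forall x, D x -> f x <= g x) ->
  \int[mu]_(x in D) f x <= \int[mu]_(x in D) g x.
Proof. by rewrite !L1E; exact: (@le_Rintegral _ _ _ mu). Qed.

Lemma int_norm_le D f g : measurable D -> measurable_fun D f -> L1 D g ->
  (forall x, D x -> `|f x| <= g x) ->
  `|\int[mu]_(x in D) f x| <= \int[mu]_(x in D) g x.
Proof.
move=> mD mf ig fg; have iF := L1_bounded_by mD mf fg ig.
apply: le_trans; first by apply: le_normr_Rintegral => //; rewrite -L1E.
by apply: int_le => //; exact: L1_abs.
Qed.

Lemma ge0_L1 D f M : measurable D -> measurable_fun D f ->
  (forall x, D x -> 0 <= f x) -> (\int[mu]_(x in D) (f x)%:E <= M%:E)%E -> L1 D f.
Proof.
rewrite L1E => mD mf f0 fM; apply/integrableP; split; first exact/measurable_EFinP.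
rewrite (le_lt_trans _ (ltry M))// (le_trans _ fM)//.
rewrite le_eqVlt; apply/orP; left; apply/eqP.
by apply: eq_integral => x /set_mem Dx /=; rewrite ger0_norm ?f0.
Qed.

Lemma dominated_int D (f_ : nat -> R -> R) f g : measurable D ->
  (forall n, measurable_fun D (f_ n)) -> measurable_fun D f -> L1 D g ->
  (forall n x, D x -> `|f_ n x| <= g x) ->
  (forall x, D x -> f_ n x @[n --> \oo] --> f x) ->
  \int[mu]_(x in D) f_ n x @[n --> \oo] --> \int[mu]_(x in D) f x.
Proof.
move=> mD mf_ mf ig fg cf.
have [] := @dominated_convergence _ _ _ mu D mD (fun n => EFin \o f_ n) (EFin \o f) (EFin \o g).
- by move=> n; apply/measurable_EFinP; exact: mf_.
- by apply/measurable_EFinP.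
- by apply: aeW => x Dx; apply: cvg_EFin; [exact: nearW|exact: cf].
- by rewrite -L1E.
- by apply: aeW => x n Dx /=; rewrite lee_fin fg.
move=> iF _; rewrite EFin_int ?L1E// => /fine_cvgP[_]; exact.
Qed.

(** Integrability of the limit is a conclusion, not a hypothesis: for nonnegative terms a uniform
    bound on the integrals suffices. Spectra and weighted energies acquire their integrability this
    way. *)
Lemma fatou_int D (f_ : nat -> R -> R) f M : measurable D ->
  (forall n, L1 D (f_ n)) -> measurable_fun D f ->
  (forall n x, D x -> 0 <= f_ n x) ->
  (forall x, D x -> f_ n x @[n --> \oo] --> f x) ->
  (forall n, \int[mu]_(x in D) f_ n x <= M) ->
  L1 D f /\ \int[mu]_(x in D) f x <= M.
Proof.
move=> mD if_ mf f0 cf fM.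
have f_ge0 x : D x -> 0 <= f x.
  move=> Dx; rewrite -(cvg_lim _ (cf x Dx))//; apply: limr_ge.
    by apply/cvg_ex; exists (f x); exact: cf.
  by apply: nearW => n; exact: f0.
have le1 : (\int[mu]_(x in D) (f x)%:E <= M%:E)%E.
  have := @fatou _ _ _ mu D mD (fun n => EFin \o f_ n).
  have -> : (\int[mu]_(x in D) limn_einf ((fun n => EFin \o f_ n)^~ x) =
             \int[mu]_(x in D) (f x)%:E)%E.
    apply: eq_integral => x /set_mem Dx.
    rewrite is_cvg_limn_einfE//=.
      by apply/cvg_lim => //; apply: cvg_EFin; [exact: nearW|exact: cf].
    apply/cvg_ex; exists (f x)%:E.
    by apply: cvg_EFin; [exact: nearW|exact: cf].
  move=> H; apply: (le_trans (H _ _)).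
  - by move=> n; apply/measurable_EFinP; exact: L1_meas.
  - by move=> n x Dx; rewrite lee_fin f0.
  rewrite limn_einf_lim; apply: lime_le; first exact: is_cvg_einfs.
  apply: nearW => n; apply: (@le_trans _ _ (\int[mu]_(x in D) (f_ n x)%:E)%E).
    by apply: ereal_inf_lbound; exists n => //=.
  by rewrite EFin_int// lee_fin.
have iF : L1 D f by apply: ge0_L1 le1.
by split => //; rewrite -lee_fin -EFin_int.
Qed.

(** The integrand is dominated by [M |f(x)| |g(y)|], so Tonelli gives joint integrability and Fubini
    applies. *)
Lemma fubini_setT f g (K : R * R -> R) M :
  L1 setT f -> L1 setT g -> measurable_fun setT K -> (forall p, `|K p| <= M) ->
  L1 setT (fun x => f x * \int[mu]_y (g y * K (x, y))) /\
  \int[mu]_x (f x * \int[mu]_y (g y * K (x, y))) =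
  \int[mu]_y (g y * \int[mu]_x (f x * K (x, y))).
Proof.
move=> iF ig mK KM.
have M0 : 0 <= M by exact: le_trans (KM (0, 0)).
have mf := L1_meas iF; have mg := L1_meas ig.
have mKx x : measurable_fun setT (fun y => K (x, y)) by exact: measurableT_comp.
have mKy y : measurable_fun setT (fun x => K (x, y)) by exact: measurableT_comp.
pose H (p : R * R) := f p.1 * g p.2 * K p.
have mH : measurable_fun setT H.
  apply: measurable_funM => //; apply: measurable_funM.
    exact: measurableT_comp.
  exact: measurableT_comp.
have igK x : L1 setT (fun y => g y * K (x, y)) by apply: (@L1_mul_bounded _ _ _ M).
have ifK y : L1 setT (fun x => f x * K (x, y)) by apply: (@L1_mul_bounded _ _ _ M).
have igH x : L1 setT (fun y => H (x, y)).
  by apply: L1_eq (L1Zl (f x) measurableT (igK x)) => // y _; rewrite mulrA.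
have ifH y : L1 setT (fun x => H (x, y)).
  apply: L1_eq (L1Zl (g y) measurableT (ifK y)) => // x _.
  by rewrite /H/= mulrCA mulrA.
have mEH : measurable_fun setT (EFin \o H) by exact/measurable_EFinP.
have iH : (mu \x mu)%E.-integrable setT (EFin \o H).
  apply/integrable12ltyP; first exact: mEH.
  apply: (@le_lt_trans _ _ (\int[mu]_x (M * \int[mu]_y `|g y| * `|f x|)%:E)%E).
    apply: ge0_le_integral => //.
    - by move=> x _; apply: integral_ge0.
    - apply: (@measurable_fun_fubini_tonelli_F _ _ _ _ _ mu (abse \o (EFin \o H))) => //.
        by apply: measurableT_comp => //; exact: mEH.
      by move=> p; exact: abse_ge0.
    - by apply/measurable_EFinP; apply: measurable_funM => //; exact: measurableT_comp.
    move=> x _; rewrite (@EFin_int _ (fun y => `|H (x, y)|))//; last exact: L1_abs.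
    rewrite lee_fin mulrAC.
    have -> : M * `|f x| * \int[mu]_y `|g y| = \int[mu]_y (M * `|f x| * `|g y|).
      by rewrite intZl//; exact: L1_abs.
    apply: int_le => //; [exact: L1_abs|by apply: L1Zl => //; exact: L1_abs|].
    move=> y _; rewrite /H/= !normrM -[M * _ * _]mulrA [leRHS]mulrC.
    by rewrite ler_wpM2l// mulr_ge0.
  by rewrite EFin_int ?ltry//; apply: L1Zl => //; exact: L1_abs.
have HE x : (\int[mu]_y (EFin \o H) (x, y) = (f x * \int[mu]_y (g y * K (x, y)))%:E)%E.
  rewrite (EFin_int measurableT (igH x)).
  by congr EFin; rewrite -intZl//; apply: eq_int => y _; rewrite mulrA.
split.
  have := integrable_fubini_F iH; rewrite L1E /fubini_F.
  by apply: eq_integrable => // x _; rewrite HE.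
have := Fubini iH.
rewrite /Rintegral => E; congr fine.
transitivity (\int[mu]_x \int[mu]_y (EFin \o H) (x, y))%E.
  by apply: eq_integral => x _; rewrite HE.
rewrite E; apply: eq_integral => y _; rewrite [LHS](EFin_int measurableT (ifH y)).
congr EFin; rewrite -intZl//; apply: eq_int => x _.
by rewrite /H/= mulrCA mulrA.
Qed.

Lemma L1_restrictE D f : measurable D -> L1 D f <-> L1 setT (f \_ D).
Proof.
by rewrite !L1E => mD; have := @integrable_mkcond _ _ _ mu D (EFin \o f) mD; rewrite restrict_EFin.
Qed.

Section Fubini.
Variables (D1 D2 : set R) (f g : R -> R) (K : R * R -> R) (M : R).
Hypotheses (mD1 : measurable D1) (mD2 : measurable D2) (iF : L1 D1 f) (ig : L1 D2 g).
Hypotheses (mK : measurable_fun setT K) (KM : forall p, `|K p| <= M).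

Let restrictM (D : set R) (h k : R -> R) x :
  ((fun y => h y * k y) \_ D) x = (h \_ D) x * k x.
Proof. by rewrite /patch; case: ifP => // _; rewrite mul0r. Qed.

Let fubini_restrict := fubini_setT ((L1_restrictE f mD1).1 iF)
  ((L1_restrictE g mD2).1 ig) mK KM.

Lemma L1_fubini : L1 D1 (fun x => f x * \int[mu]_(y in D2) (g y * K (x, y))).
Proof.
apply/L1_restrictE => //; apply: L1_eq fubini_restrict.1 => // x _.
rewrite restrictM (Rintegral_mkcond mu D2); congr (_ * _).
by apply: eq_int => y _; rewrite restrictM.
Qed.

Lemma fubini_bdd :
  \int[mu]_(x in D1) (f x * \int[mu]_(y in D2) (g y * K (x, y))) =
  \int[mu]_(y in D2) (g y * \int[mu]_(x in D1) (f x * K (x, y))).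
Proof.
rewrite (Rintegral_mkcond mu D1) [RHS](Rintegral_mkcond mu D2).
under eq_int => x _ do rewrite restrictM Rintegral_mkcond.
under [RHS]eq_int => x _ do rewrite restrictM Rintegral_mkcond.
under eq_int => x _ do under eq_int => y _ do rewrite restrictM.
under [RHS]eq_int => x _ do under eq_int => y _ do rewrite restrictM.
exact: fubini_restrict.2.
Qed.

End Fubini.
End RealIntegrals.

(** * Cosine and sine transforms on a bounded set *)

Section Transforms.
Context {R : realType}.
Notation mu := (@lebesgue_measure R).
Implicit Types (D : set R) (f g h k : R -> R) (M r x u v : R).


Lemma lip_of_derive k k' : (forall x, is_derive x 1 k (k' x)) ->
  (forall x, `|k' x| <= 1) -> forall x y, `|k x - k y| <= `|x - y|.
Proof.
move=> dk k'1; suff H x y : x < y -> `|k x - k y| <= `|x - y|.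
  move=> x y; have [xy|yx|->] := ltgtP x y; [exact: H| |by rewrite !subrr].
  by rewrite distrC [leRHS]distrC; exact: H.
move=> xy; have ck : {within `[x, y], continuous k}.
  apply: continuous_subspaceT => z; apply: differentiable_continuous.
  by apply/derivable1_diffP; apply: ex_derive.
have [c _ E] := MVT xy (fun z _ => dk z) ck.
by rewrite distrC E normrM [`|x - y|]distrC ler_piMl.
Qed.

Lemma cos_lip x y : `|cos x - cos y| <= `|x - y| :> R.
Proof.
apply: (lip_of_derive (k' := fun x => - sin x)) => z.
by rewrite normrN sin_max.
Qed.

Lemma sin_lip x y : `|sin x - sin y| <= `|x - y| :> R.
Proof. by apply: (lip_of_derive (k' := cos)) => z; rewrite cos_max. Qed.

Lemma lip_measurable f M : (forall x y, `|f x - f y| <= M * `|x - y|) ->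
  measurable_fun setT f.
Proof.
move=> fM; apply: continuous_measurable_fun => x.
have M0 : 0 <= M by have := le_trans (normr_ge0 _) (fM 1 0); rewrite subr0 normr1 mulr1.
apply/cvgrPdist_le => e e0.
exists (e / (M + 1)) => /=; first by rewrite divr_gt0// ltr_wpDl.
move=> y /= xy; apply: (le_trans (fM _ _)).
move: (ltW xy); rewrite ler_pdivlMr ?ltr_wpDl// => H; apply: le_trans H.
by rewrite mulrC ler_wpM2l// lerDl.
Qed.

(* [trans cos I f - 'i trans sin I f] is the Fourier transform of [f] over [I]. *)
Definition trans k (I : set R) f u := \int[mu]_(t in I) (f t * k (u * t)).

Section OnI.
Variables (I : set R) (L : R).
Hypotheses (mI : measurable I) (IL : forall t, I t -> `|t| <= L).

Lemma mu_bounded_lty : (mu I < +oo)%E.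
Proof.
apply: (@le_lt_trans _ _ (mu `[- L, L])).
  apply: le_measure; rewrite ?inE//.
  by move=> t /IL; rewrite ler_norml /= in_itv.
rewrite lebesgue_measure_itv/=; case: ifP => // _.
by rewrite -EFinB ltry.
Qed.

Lemma L1_bounded_on f M : measurable_fun I f -> (forall x, I x -> `|f x| <= M) -> L1 I f.
Proof. by move=> mf fM; apply: L1_bounded fM => //; exact: mu_bounded_lty. Qed.

Lemma L1_cst_on r : L1 I (fun=> r).
Proof. exact: (@L1_bounded_on _ `|r|). Qed.

Section Kernel.
Variable k : R -> R.
Hypotheses (k_max : forall x, `|k x| <= 1) (k_lip : forall x y, `|k x - k y| <= `|x - y|).

Lemma measurable_k : measurable_fun setT k.
Proof. by apply: (@lip_measurable _ 1) => x y; rewrite mul1r. Qed.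

Lemma measurable_ku u : measurable_fun I (fun t => k (u * t)).
Proof.
apply: measurable_funTS; apply: measurableT_comp; first exact: measurable_k.
exact: measurable_funM.
Qed.

Lemma L1_trans f u : L1 I f -> L1 I (fun t => f t * k (u * t)).
Proof. by move=> iF; apply: (@L1_mul_bounded _ _ _ _ 1) => //; exact: measurable_ku. Qed.

Lemma transD f g u : L1 I f -> L1 I g ->
  trans k I (fun t => f t + g t) u = trans k I f u + trans k I g u.
Proof.
move=> iF ig; rewrite /trans -intD//; try exact: L1_trans.
by apply: eq_int => t _; rewrite mulrDl.
Qed.

Lemma transZ f u r : L1 I f -> trans k I (fun t => r * f t) u = r * trans k I f u.
Proof.
move=> iF; rewrite /trans -intZl//; last exact: L1_trans.
by apply: eq_int => t _; rewrite mulrA.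
Qed.

Lemma trans_max f u : L1 I f -> `|trans k I f u| <= \int[mu]_(t in I) `|f t|.
Proof.
move=> iF; apply: int_norm_le => //; [by apply: L1_meas; exact: L1_trans|exact: L1_abs|].
by move=> t _; rewrite normrM ler_piMr.
Qed.

(** The integrand moves by at most [|f(t)| |t| |u - v|], and [|t| <= L] on [I]. Bounded support thus
    gives a Lipschitz constant depending only on the L^1 norm, hence equicontinuity of the
    transforms of a bounded family. *)
Lemma trans_lip f u v : L1 I f ->
  `|trans k I f u - trans k I f v| <= L * (\int[mu]_(t in I) `|f t|) * `|u - v|.
Proof.
move=> iF; rewrite /trans -intB//; try exact: L1_trans.
rewrite mulrAC -intZl//; last exact: L1_abs.
have iB : L1 I (fun t => f t * k (u * t) - f t * k (v * t)) by apply: L1B => //; exact: L1_trans.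
apply: int_norm_le => //; [exact: L1_meas|by apply: L1Zl => //; exact: L1_abs|].
move=> t It; rewrite -mulrBr normrM mulrC ler_wpM2r//.
apply: (le_trans (k_lip _ _)); rewrite -mulrBl normrM mulrC.
by rewrite ler_wpM2r// IL.
Qed.

Lemma measurable_trans D f : L1 I f -> measurable_fun D (trans k I f).
Proof.
by move=> iF; apply: measurable_funTS; apply: lip_measurable => u v; exact: trans_lip.
Qed.

End Kernel.
End OnI.
End Transforms.

(** * Real square-integrable functions *)

Section SquareIntegrable.
Context {R : realType}.
Notation mu := (@lebesgue_measure R).
Implicit Types (D : set R) (f g h w : R -> R) (M r x u v : R).


(** Real analogue of [inL2]. Measurability of [f] is a separate conjunct because integrability of
    the square does not imply it. *)
Definition sq D f := measurable_fun D f /\ L1 D (fun x => f x ^+ 2).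

Lemma sq_bounded_by D f g : measurable D -> measurable_fun D f ->
  (forall x, D x -> f x ^+ 2 <= g x) -> L1 D g -> sq D f.
Proof.
move=> mD mf fg ig; split => //; apply: L1_bounded_by ig => //.
  exact: measurable_funX.
by move=> x Dx; rewrite ger0_norm ?sqr_ge0// fg.
Qed.

Lemma sqM D f g : measurable D -> sq D f -> sq D g -> L1 D (fun x => f x * g x).
Proof.
move=> mD [mf f2] [mg g2].
apply: (@L1_bounded_by _ _ _ (fun x => f x ^+ 2 + g x ^+ 2)) => //.
- exact: measurable_funM.
- move=> x Dx; rewrite normrM -[f x ^+ 2]real_normK ?num_real//.
  rewrite -[g x ^+ 2]real_normK ?num_real//.
  have := sqr_ge0 (`|f x| - `|g x|); have := normr_ge0 (f x); have := normr_ge0 (g x).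
  by nra.
- exact: L1D.
Qed.

Lemma sqD D f g : measurable D -> sq D f -> sq D g -> sq D (fun x => f x + g x).
Proof.
move=> mD [mf f2] [mg g2].
apply: (@sq_bounded_by _ _ (fun x => 2 * (f x ^+ 2 + g x ^+ 2))) => //.
- exact: measurable_funD.
- by move=> x Dx; have := sqr_ge0 (f x - g x); nra.
- by apply: L1Zl => //; exact: L1D.
Qed.

Lemma sqZ D f r : measurable D -> sq D f -> sq D (fun x => r * f x).
Proof.
move=> mD [mf f2].
apply: (@sq_bounded_by _ _ (fun x => r ^+ 2 * f x ^+ 2)) => //.
- exact: measurable_funM.
- by move=> x Dx; rewrite exprMn.
- exact: L1Zl.
Qed.

Lemma sq_eq D f g : measurable D -> (forall x, D x -> f x = g x) -> sq D f -> sq D g.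
Proof.
move=> mD fg [mf f2]; split.
  by apply: eq_measurable_fun mf => x /set_mem /fg.
by apply: L1_eq f2 => // x Dx; rewrite fg.
Qed.

Lemma sqB D f g : measurable D -> sq D f -> sq D g -> sq D (fun x => f x - g x).
Proof.
move=> mD sf sg; have := sqD mD sf (sqZ (-1) mD sg).
by apply: sq_eq => // x _; rewrite mulN1r.
Qed.

Lemma sq_mul_bounded D f h M : measurable D -> sq D f -> measurable_fun D h ->
  (forall x, D x -> `|h x| <= M) -> sq D (fun x => h x * f x).
Proof.
move=> mD [mf f2] mh hM.
apply: (@sq_bounded_by _ _ (fun x => M ^+ 2 * f x ^+ 2)) => //.
- exact: measurable_funM.
- move=> x Dx; rewrite exprMn ler_wpM2r ?sqr_ge0//.
  rewrite -[h x ^+ 2]real_normK ?num_real// lerXn2r ?nnegrE ?hM//.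
  exact: le_trans (hM x Dx).
- exact: L1Zl.
Qed.

Lemma sq_S D D' f : measurable D -> measurable D' -> D' `<=` D -> sq D f -> sq D' f.
Proof.
move=> mD mD' DD [mf f2]; split; first exact: measurable_funS mf.
exact: L1_S f2.
Qed.

Lemma sq_L1 D f : measurable D -> (mu D < +oo)%E -> sq D f -> L1 D f.
Proof.
move=> mD muD [mf f2].
apply: (@L1_bounded_by _ _ _ (fun x => 1 + f x ^+ 2)) => //.
- move=> x Dx; rewrite -[f x ^+ 2]real_normK ?num_real//.
  by have := sqr_ge0 (`|f x| - 1); have := normr_ge0 (f x); nra.
- apply: L1D => //; apply: (@L1_bounded _ _ _ 1) => // x _.
  by rewrite normr1.
Qed.

Definition ip D f g := \int[mu]_(x in D) (f x * g x).

Lemma ipC D f g : ip D f g = ip D g f.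
Proof. by apply: eq_int => x _; rewrite mulrC. Qed.

Lemma ipDl D f g h : measurable D -> sq D f -> sq D g -> sq D h ->
  ip D (fun x => f x + g x) h = ip D f h + ip D g h.
Proof.
move=> mD sf sg sh; rewrite /ip -intD//; try exact: sqM.
by apply: eq_int => x _; rewrite mulrDl.
Qed.

Lemma ipZl D f h r : measurable D -> sq D f -> sq D h ->
  ip D (fun x => r * f x) h = r * ip D f h.
Proof.
move=> mD sf sh; rewrite /ip -intZl//; last exact: sqM.
by apply: eq_int => x _; rewrite mulrA.
Qed.

Lemma ipBl D f g h : measurable D -> sq D f -> sq D g -> sq D h ->
  ip D (fun x => f x - g x) h = ip D f h - ip D g h.
Proof.
move=> mD sf sg sh; rewrite /ip -intB//; try exact: sqM.
by apply: eq_int => x _; rewrite mulrBl.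
Qed.

Lemma ip_ge0 D f : 0 <= ip D f f.
Proof. by apply: Rintegral_ge0 => x _; rewrite -expr2 sqr_ge0. Qed.

Lemma ip_eq D f f' g g' : (forall x, D x -> f x = f' x) -> (forall x, D x -> g x = g' x) ->
  ip D f g = ip D f' g'.
Proof. by move=> ff gg; apply: eq_int => x Dx; rewrite ff// gg. Qed.

(** Cauchy-Schwarz in weighted form, from the nonnegative square norm of [r f - s g] with the signs
    [s = 1] and [s = -1]. The free weight [r] avoids square roots of norms. *)
Lemma ip_le D f g r : measurable D -> sq D f -> sq D g -> 0 < r ->
  2 * `|ip D f g| <= r * ip D f f + r^-1 * ip D g g.
Proof.
move=> mD sf sg r0.
have r0' : 0 <= r by exact: ltW.
have H (s : R) : s ^+ 2 = 1 -> 0 <= r * ip D f f + r^-1 * ip D g g - 2 * (s * ip D f g).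
  move=> s1; have := @ip_ge0 D (fun x => r * f x - s * g x).
  have sr : sq D (fun x => r * f x) by exact: sqZ.
  have ss : sq D (fun x => s * g x) by exact: sqZ.
  have srs : sq D (fun x => r * f x - s * g x) by exact: sqB.
  rewrite ipBl// ipZl// ipZl// [ip D f _]ipC [ip D g _]ipC.
  rewrite !ipBl// !ipZl// [ip D g f]ipC => H.
  have : 0 <= r^-1 * (r * (r * ip D f f - s * ip D f g) - s * (r * ip D f g - s * ip D g g)).
    by rewrite mulr_ge0// invr_ge0.
  have -> : r^-1 * (r * (r * ip D f f - s * ip D f g) - s * (r * ip D f g - s * ip D g g))
    = r * ip D f f + r^-1 * (s ^+ 2 * ip D g g) - 2 * (s * ip D f g).
    by field; rewrite gt_eqF.
  by rewrite s1 mul1r.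
have := H 1 (expr1n _ _); have := H (-1) (etrans (sqrrN 1) (expr1n _ _)).
rewrite mul1r mulN1r => H1 H2.
by have [h|h] := ger0P (ip D f g); lra.
Qed.

End SquareIntegrable.

(** * Convolution forms on the frequency side *)

Section Spectral.
Context {R : realType}.
Notation mu := (@lebesgue_measure R).
Implicit Types (D : set R) (f g h w : R -> R) (M r e x u v : R).

Local Notation P := (`[0%R, +oo[%classic : set R).

(* Real part of the product of the transform of [f] by the conjugate of that of [g]. *)
Definition spec (I : set R) f g u :=
  trans cos I f u * trans cos I g u + trans sin I f u * trans sin I g u.

Lemma specC I f g u : spec I f g u = spec I g f u.
Proof. by rewrite /spec mulrC [_ * trans sin I g u]mulrC. Qed.

Lemma spec_ge0 I f u : 0 <= spec I f f u.
Proof. by rewrite addr_ge0// -expr2 sqr_ge0. Qed.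

(** The weighted Cauchy-Schwarz inequality for the plane vectors formed by the cosine and sine
    transforms at [u]. *)
Lemma spec_le I f g u r : 0 < r ->
  2 * `|spec I f g u| <= r * spec I f f u + r^-1 * spec I g g u.
Proof.
move=> r0; rewrite /spec.
set a := trans cos I f u; set b := trans sin I f u.
set c := trans cos I g u; set d := trans sin I g u.
have ri : r * r^-1 = 1 by rewrite mulfV// gt_eqF.
have ri0 : 0 < r^-1 by rewrite invr_gt0.
have H1 : 0 <= r^-1 * ((r * a - c) ^+ 2 + (r * b - d) ^+ 2).
  by rewrite mulr_ge0 ?addr_ge0 ?sqr_ge0 ?ltW.
have H2 : 0 <= r^-1 * ((r * a + c) ^+ 2 + (r * b + d) ^+ 2).
  by rewrite mulr_ge0 ?addr_ge0 ?sqr_ge0 ?ltW.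
have E1 : r^-1 * ((r * a - c) ^+ 2 + (r * b - d) ^+ 2) =
  r * (a * a + b * b) + r^-1 * (c * c + d * d) - 2 * (a * c + b * d).
  by field; rewrite gt_eqF.
have E2 : r^-1 * ((r * a + c) ^+ 2 + (r * b + d) ^+ 2) =
  r * (a * a + b * b) + r^-1 * (c * c + d * d) + 2 * (a * c + b * d).
  by field; rewrite gt_eqF.
rewrite E1 in H1; rewrite E2 in H2.
by have [h|h] := ger0P (a * c + b * d); lra.
Qed.

Lemma measurable_cos_prod (a b : R * R -> R) :
  measurable_fun setT a -> measurable_fun setT b ->
  measurable_fun setT (fun p => cos (a p * b p)).
Proof.
move=> ma mb; have mc : measurable_fun setT (cos : R -> R).
  by apply: continuous_measurable_fun; exact: continuous_cos.
exact: (measurableT_comp mc (measurable_funM ma mb)).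
Qed.

Lemma measurable_sin_prod (a b : R * R -> R) :
  measurable_fun setT a -> measurable_fun setT b ->
  measurable_fun setT (fun p => sin (a p * b p)).
Proof.
move=> ma mb; have ms : measurable_fun setT (sin : R -> R).
  by apply: continuous_measurable_fun; exact: continuous_sin.
exact: (measurableT_comp ms (measurable_funM ma mb)).
Qed.

Section OnI.
Variables (I : set R) (L : R).
Hypotheses (mI : measurable I) (IL : forall t, I t -> `|t| <= L).

Lemma sq_L1_bounded f : sq I f -> L1 I f.
Proof. by apply: sq_L1 => //; exact: mu_bounded_lty mI IL. Qed.

Lemma L1_mul_trans (k : R -> R) D w f : (forall x, `|k x| <= 1) ->
  (forall x y, `|k x - k y| <= `|x - y|) -> measurable D -> L1 D w -> L1 I f ->
  L1 D (fun u => w u * trans k I f u).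
Proof.
move=> k1 kl mD iw iF; apply: (@L1_mul_bounded _ _ _ _ (\int[mu]_(t in I) `|f t|)) => //.
  exact: (measurable_trans mI IL k1 kl).
by move=> x _; exact: trans_max.
Qed.

Lemma measurable_spec D f g : L1 I f -> L1 I g -> measurable_fun D (spec I f g).
Proof.
move=> iF ig.
have mc h : L1 I h -> measurable_fun D (trans cos I h).
  by move=> ih; exact: (measurable_trans mI IL (@cos_max R) cos_lip).
have ms h : L1 I h -> measurable_fun D (trans sin I h).
  exact: (measurable_trans mI IL (@sin_max R) sin_lip).
exact: (measurable_funD (measurable_funM (mc _ iF) (mc _ ig)) (measurable_funM (ms _ iF) (ms _ ig))).
Qed.

Lemma kernel_transform D w f t : measurable D -> L1 D w -> L1 I f ->
  \int[mu]_(s in I) (f s * \int[mu]_(u in D) (w u * cos (u * (t - s)))) =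
  \int[mu]_(u in D) (w u * trans cos I f u * cos (u * t)) +
  \int[mu]_(u in D) (w u * trans sin I f u * sin (u * t)).
Proof.
move=> mD iw iF.
have iwc := L1_mul_trans (@cos_max R) cos_lip mD iw iF.
have iws := L1_mul_trans (@sin_max R) sin_lip mD iw iF.
have mK : measurable_fun setT (fun p : R * R => cos (p.2 * (t - p.1))).
  apply: measurable_cos_prod; first exact: measurable_snd.
  by apply: measurable_funB => //; exact: measurable_fst.
rewrite (fubini_bdd mI mD iF iw mK (fun p => @cos_max R _)) -intD//; first last.
- apply: (@L1_mul_bounded _ _ _ _ 1) => //; last by move=> *; exact: sin_max.
  by under eq_fun => u do rewrite mulrC; exact: (measurable_ku sin_lip).
- apply: (@L1_mul_bounded _ _ _ _ 1) => //; last by move=> *; exact: cos_max.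
  by under eq_fun => u do rewrite mulrC; exact: (measurable_ku cos_lip).
apply: eq_int => u _ /=.
have -> : \int[mu]_(x in I) (f x * cos (u * (t - x))) =
    trans cos I f u * cos (u * t) + trans sin I f u * sin (u * t).
  have iC := L1_trans mI (@cos_max R) cos_lip u iF.
  have iS := L1_trans mI (@sin_max R) sin_lip u iF.
  rewrite /trans -(intZr _ mI iS) -(intZr _ mI iC) -intD//; first last.
  + by apply: L1_eq (L1Zl (sin (u * t)) mI iS) => // x _; rewrite mulrC.
  + by apply: L1_eq (L1Zl (cos (u * t)) mI iC) => // x _; rewrite mulrC.
  by apply: eq_int => s _; rewrite mulrBr cosB; ring.
by ring.
Qed.

(** Convolution by the cosine transform of [w] is diagonal on the frequency side: the addition
    formula for [cos (u * (t - s))] separates [s] from [t], and Fubini is applied once for each of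
    the two variables. The weights of interest are pure exponential decay, which yields the Poisson
    kernel, and [abel_weight]. *)
Lemma kernel_spec D w f g : measurable D -> L1 D w -> L1 I f -> L1 I g ->
  \int[mu]_(t in I) (g t *
    \int[mu]_(s in I) (f s * \int[mu]_(u in D) (w u * cos (u * (t - s))))) =
  \int[mu]_(u in D) (w u * spec I f g u).
Proof.
move=> mD iw iF ig.
have m1 : measurable_fun setT (fun p : R * R => p.1) by exact: measurable_fst.
have m2 : measurable_fun setT (fun p : R * R => p.2) by exact: measurable_snd.
have iwc := L1_mul_trans (@cos_max R) cos_lip mD iw iF.
have iws := L1_mul_trans (@sin_max R) sin_lip mD iw iF.
have mC := measurable_cos_prod m2 m1; have mS := measurable_sin_prod m2 m1.
under eq_int => t _ do rewrite (kernel_transform _ mD iw iF) mulrDr.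
rewrite (intD mI (L1_fubini mI mD ig iwc mC (fun p => @cos_max R _))
  (L1_fubini mI mD ig iws mS (fun p => @sin_max R _))).
rewrite (fubini_bdd mI mD ig iwc mC (fun p => @cos_max R _)).
rewrite (fubini_bdd mI mD ig iws mS (fun p => @sin_max R _)).
rewrite -(intD mD (L1_mul_trans (@cos_max R) cos_lip mD iwc ig)
  (L1_mul_trans (@sin_max R) sin_lip mD iws ig)).
by apply: eq_int => u _; rewrite -/(trans cos I g u) -/(trans sin I g u) /spec; ring.
Qed.

End OnI.
End Spectral.

(** * Derivatives and the fundamental theorem of calculus *)

Section Calculus.
Context {R : realType}.
Notation mu := (@lebesgue_measure R).
Implicit Types (D : set R) (f g h w F : R -> R) (M r e x u v : R).

Local Notation P := (`[0%R, +oo[%classic : set R).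

Lemma derD f g (df dg : R) x : is_derive x 1 f df -> is_derive x 1 g dg ->
  is_derive x 1 (fun x => f x + g x) (df + dg).
Proof. by move=> dF dG; exact: is_deriveD. Qed.

Lemma derM f g (df dg : R) x : is_derive x 1 f df -> is_derive x 1 g dg ->
  is_derive x 1 (fun x => f x * g x) (f x * dg + g x * df).
Proof. by move=> dF dG; exact: is_deriveM. Qed.

Lemma derZ f (df : R) r x : is_derive x 1 f df ->
  is_derive x 1 (fun x => r * f x) (r * df).
Proof. by move=> dF; exact: is_deriveZ. Qed.

Lemma der_comp f g (df dg : R) x : is_derive x 1 g dg -> is_derive (g x) 1 f df ->
  is_derive x 1 (fun x => f (g x)) (df * dg).
Proof. by move=> dG dF; exact: is_derive1_comp. Qed.

Lemma der_eq f (df df' : R) x : is_derive x 1 f df -> df = df' -> is_derive x 1 f df'.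
Proof. by move=> ? <-. Qed.

Lemma der_cont f (df : R) x : is_derive x 1 f df -> {for x, continuous f}.
Proof.
by move=> dF; apply: differentiable_continuous; apply/derivable1_diffP; exact: ex_derive.
Qed.

Lemma FTC2_seg f F a b : a <= b ->
  (forall x, a <= x <= b -> is_derive x 1 F (f x)) ->
  (forall x, a <= x <= b -> {for x, continuous f}) ->
  L1 `[a, b] f /\ \int[mu]_(x in `[a, b]) f x = F b - F a.
Proof.
move=> ab dF cf.
have cfi : {within `[a, b], continuous f}.
  by apply: continuous_in_subspaceT => x /set_mem/= /[!in_itv]/= xab; exact: cf.
have iF : L1 `[a, b] f.
  by rewrite L1E; apply: continuous_compact_integrable => //; exact: segment_compact.
split => //.
have [ab'|/eqP ->] : a < b \/ a == b by move: ab; rewrite le_eqVlt orbC => /orP.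
  rewrite /Rintegral (@continuous_FTC2 _ f F)//.
    split => [x /[!in_itv]/= /andP[ax xb]||].
    - by have := dF x; rewrite !ltW// => /(_ erefl) [].
    - by apply: cvg_at_right_filter; apply: (@der_cont _ (f a)); apply: dF; rewrite lexx.
    - by apply: cvg_at_left_filter; apply: (@der_cont _ (f b)); apply: dF; rewrite lexx andbT.
  move=> x /[!in_itv]/= /andP[ax xb].
  by rewrite derive1E; apply: derive_val; apply: dF; rewrite !ltW.
by rewrite set_itv1 Rintegral_set1 subrr.
Qed.

Lemma FTC2_ray f F a l : 
  (forall x, a <= x -> is_derive x 1 F (f x)) ->
  (forall x, a <= x -> {for x, continuous f}) ->
  (forall x, a <= x -> 0 <= f x) -> F x @[x --> +oo] --> l ->
  L1 `[a, +oo[ f /\ \int[mu]_(x in `[a, +oo[) f x = l - F a.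
Proof.
move=> dF cf f0 Fl.
have cfi : {within `[a, +oo[, continuous f}.
  by apply: continuous_in_subspaceT => x /set_mem/= /[!in_itv]/= /[!andbT] xab; exact: cf.
have E := @ge0_continuous_FTC2y _ f F a l f0 cfi Fl.
have {}E : (\int[mu]_(x in `[a, +oo[) (f x)%:E = l%:E - (F a)%:E)%E.
  apply: E.
  - by move=> x /ltW ax; have [] := dF x ax.
  - by apply: cvg_at_right_filter; apply: (@der_cont _ (f a)); exact: dF.
  move=> x /[!in_itv]/= /[!andbT] /ltW ax.
  by rewrite derive1E; apply: derive_val; apply: dF.
split; last by rewrite /Rintegral E.
apply: (@ge0_L1 _ _ _ (l - F a)) => //.
- exact: subspace_continuous_measurable_fun.
- by move=> x /= /[!in_itv]/= /[!andbT]; exact: f0.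
- by rewrite E.
Qed.

Lemma int_itvoo_cc f a b : L1 `[a, b] f ->
  \int[mu]_(x in `]a, b[) f x = \int[mu]_(x in `[a, b]) f x.
Proof.
move=> iF; rewrite -[RHS]Rintegral_itv_bndo_bndc; last first.
  rewrite -L1E; apply: L1_S iF => //; apply: subset_itv; by rewrite bnd_simp.
rewrite [LHS]Rintegral_itv_obnd_cbnd// -L1E; apply: L1_S iF => //.
by apply: subset_itv; rewrite bnd_simp.
Qed.

End Calculus.

(** * The Poisson kernel and the Plancherel identity *)

Section Poisson.
Context {R : realType}.
Notation mu := (@lebesgue_measure R).
Implicit Types (D : set R) (f g h w F : R -> R) (M r e x u v t s : R).

Local Notation P := (`[0%R, +oo[%classic : set R).

Lemma derivable_linear r x : is_derive x 1 (fun u => u * r) r.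
Proof.
by apply: (der_eq (derM (is_derive_id x 1) (is_derive_cst r x 1))); rewrite mulr0 add0r mulr1.
Qed.

Lemma cvg_expR_decay e : 0 < e -> expR (- (u * e)) @[u --> +oo] --> (0 : R).
Proof.
move=> e0; apply: (@cvg_comp _ _ _ (fun u => u * e) (fun u => expR (- u)) _ (pinfty_nbhs R)).
  by apply/cvgryPge => M; near=> u; rewrite -ler_pdivrMr//; near: u; exact: nbhs_pinfty_ge.
exact: cvgr_expR.
Unshelve. all: by end_near. Qed.

Lemma is_derive_decay e x : is_derive x 1 (fun u => expR (- (u * e))) (- e * expR (- (x * e))).
Proof.
have d1 : is_derive x 1 (fun u => - (u * e)) (- e).
  by under eq_fun => u do rewrite -mulrN; exact: derivable_linear.
apply: (der_eq (der_comp d1 (is_derive_expR _))).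
by rewrite mulrC.
Qed.

Lemma is_derive_cosM r x : is_derive x 1 (fun u => cos (u * r)) (- (r * sin (x * r))).
Proof.
apply: (der_eq (der_comp (derivable_linear r x) (is_derive_cos _))).
by rewrite mulNr mulrC.
Qed.

Lemma is_derive_sinM r x : is_derive x 1 (fun u => sin (u * r)) (r * cos (x * r)).
Proof.
apply: (der_eq (der_comp (derivable_linear r x) (is_derive_sin _))).
by rewrite mulrC.
Qed.

(** The usual factor 1/pi is left out: this is exactly the half-line cosine transform of
    [expR (- (u * e))], and its mass over the line is pi. The constant [pi] of the Plancherel
    identity below comes from this mass. *)
Definition poisson e x := e / (e ^+ 2 + x ^+ 2).

Lemma poissonN e x : poisson e (- x) = poisson e x.
Proof. by rewrite /poisson sqrrN. Qed.

(** Adding 1 to the cosine makes the integrand nonnegative, as [FTC2_ray] requires; the integral of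
    the cosine term alone is recovered afterwards by subtracting what the case [x = 0] gives. *)
Lemma decay_integral e x : 0 < e ->
  L1 P (fun u => expR (- (u * e)) * (1 + cos (u * x))) /\
  \int[mu]_(u in P) (expR (- (u * e)) * (1 + cos (u * x))) = e^-1 + poisson e x.
Proof.
move=> e0; have ex0 : 0 < e ^+ 2 + x ^+ 2 by rewrite ltr_wpDr ?sqr_ge0// exprn_gt0.
pose E u := expR (- (u * e)).
pose c := (e ^+ 2 + x ^+ 2)^-1.
(* [E u * q u] is the primitive of the integrand that vanishes at infinity. *)
pose q u := - e^-1 + c * (x * sin (u * x) + (- e) * cos (u * x)).
pose F u := E u * q u.
have dq u : is_derive u 1 q (c * (x * (x * cos (u * x)) + (- e) * - (x * sin (u * x)))).
  apply: (der_eq (derD (is_derive_cst (- e^-1) u 1) (derZ c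
     (derD (derZ x (is_derive_sinM x u)) (derZ (- e) (is_derive_cosM x u)))))).
  by rewrite add0r.
pose f u := E u * (1 + cos (u * x)).
have dF u : is_derive u 1 F (f u).
  apply: (der_eq (derM (is_derive_decay e u) (dq u))).
  rewrite /f /q /E /c; field.
  by rewrite !gt_eqF.
have df u : {for u, continuous f}.
  have d1 : is_derive u 1 (fun u => 1 + cos (u * x)) (0 + - (x * sin (u * x))).
    by apply: (der_eq (derD (is_derive_cst (1 : R) u 1) (is_derive_cosM x u))).
  exact: (der_cont (derM (is_derive_decay e u) d1)).
have f0 u : 0 <= f u.
  rewrite /f mulr_ge0 ?expR_ge0//.
pose K := e^-1 + `|c| * (`|x| + e).
have qK u : `|q u| <= K.
  rewrite /q /K; apply: (le_trans (ler_normD _ _)); rewrite normrN gtr0_norm ?invr_gt0//.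
  rewrite lerD2l normrM ler_wpM2l//; apply: (le_trans (ler_normD _ _)).
  rewrite !normrM normrN (gtr0_norm e0); apply: lerD.
    by rewrite ler_piMr// sin_max.
  by rewrite ler_piMr ?(ltW e0)// cos_max.
have F0 : F u @[u --> +oo] --> 0.
  have KE : K * E u @[u --> +oo] --> 0.
    by rewrite -(mulr0 K); apply: cvgM; [exact: cvg_cst|exact: cvg_expR_decay].
  have NKE : - (K * E u) @[u --> +oo] --> 0 by rewrite -oppr0; apply: cvgN.
  apply: (squeeze_cvgr _ NKE KE); near=> u.
  by rewrite -ler_norml normrM mulrC (gtr0_norm (expR_gt0 _)) ler_wpM2r// ?expR_ge0.
have [iF ->] := @FTC2_ray R f F 0 0 (fun x _ => dF x) (fun x _ => df x) (fun x _ => f0 x) F0.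
split => //; rewrite /F /E /q /c !mul0r sin0 cos0 oppr0 expR0 /poisson.
by field; rewrite !gt_eqF.
Unshelve. all: by end_near. Qed.

Lemma L1_decay e : 0 < e -> L1 P (fun u => expR (- (u * e))).
Proof.
move=> e0; have [iF _] := decay_integral 0 e0.
apply: L1_eq (L1Zl 2^-1 _ iF) => // u _.
by rewrite mulr0 cos0; field.
Qed.

Lemma poisson_integral e x : 0 < e ->
  \int[mu]_(u in P) (expR (- (u * e)) * cos (u * x)) = poisson e x.
Proof.
move=> e0; have [iF E] := decay_integral x e0; have iD := L1_decay e0.
have [_ E0] := decay_integral 0 e0.
have {}E0 : \int[mu]_(u in P) expR (- (u * e)) = e^-1.
  have : 2 * \int[mu]_(u in P) expR (- (u * e)) = e^-1 + poisson e 0.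
    rewrite -E0 -intZl//; apply: eq_int => u _.
    by rewrite mulr0 cos0 mulrC.
  rewrite /poisson expr0n/= addr0 -[e / _]/(e * _) expr2 invfM mulrA mulfV ?gt_eqF// mul1r.
  by lra.
have -> : poisson e x = (e^-1 + poisson e x) - e^-1 by ring.
rewrite -E -E0 -intB//; apply: eq_int => u _; ring.
Qed.

Lemma poisson_ge0 e x : 0 < e -> 0 <= poisson e x.
Proof. by move=> e0; rewrite /poisson divr_ge0 ?addr_ge0 ?sqr_ge0// ltW. Qed.

Lemma poisson_max e x : 0 < e -> `|poisson e x| <= e^-1.
Proof.
move=> e0; rewrite ger0_norm ?poisson_ge0// /poisson ler_pdivrMr; last first.
  by rewrite ltr_wpDr ?sqr_ge0// exprn_gt0.
by rewrite mulrDr expr2 mulrA mulVf ?gt_eqF// mul1r lerDl mulr_ge0 ?sqr_ge0// invr_ge0 ltW.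
Qed.

Lemma poisson_tail e x r : 0 < e -> 0 < r -> r <= `|x| -> poisson e x <= e / r ^+ 2.
Proof.
move=> e0 r0 rx; have H : 0 < e ^+ 2 + x ^+ 2 by rewrite ltr_wpDr ?sqr_ge0// exprn_gt0.
rewrite /poisson ler_wpM2l ?(ltW e0)// lef_pV2 ?posrE ?exprn_gt0//.
rewrite -[x ^+ 2]real_normK ?num_real//.
apply: (@le_trans _ _ (`|x| ^+ 2)); first by rewrite lerXn2r// nnegrE (ltW r0).
by rewrite lerDr sqr_ge0.
Qed.

Lemma is_derive_poisson e t s : 0 < e ->
  is_derive s 1 (fun s => atan ((s - t) * e^-1)) (poisson e (t - s)).
Proof.
move=> e0.
have d1 : is_derive s 1 (fun s => (s - t) * e^-1) e^-1.
  have := derD (derivable_linear e^-1 s) (is_derive_cst (- (t * e^-1)) s 1).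
  by rewrite addr0; under eq_fun => u do rewrite -mulrBl.
apply: (der_eq (der_comp d1 (is_derive1_atan _))).
rewrite /poisson -[t - s]opprB sqrrN exprMn.
have -> : 1 + (s - t) ^+ 2 * e^-1 ^+ 2 = e ^- 2 * (e ^+ 2 + (s - t) ^+ 2).
  by field; rewrite gt_eqF.
by rewrite invfM invrK; field; rewrite !gt_eqF//= ltr_wpDr ?sqr_ge0// exprn_gt0.
Qed.

Lemma continuous_poisson e x : 0 < e -> {for x, continuous (poisson e)}.
Proof.
move=> e0; apply: cvgM; first exact: cvg_cst.
apply: cvgV; first by rewrite gt_eqF// ltr_wpDr ?sqr_ge0// exprn_gt0.
by apply: cvgD; [exact: cvg_cst|apply: exprn_continuous].
Qed.

Lemma measurable_poisson e : 0 < e -> measurable_fun setT (poisson e).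
Proof. by move=> e0; apply: continuous_measurable_fun => x; exact: continuous_poisson. Qed.

Lemma poisson_seg e t a b : 0 < e -> a <= b ->
  L1 `[a, b] (fun s => poisson e (t - s)) /\
  \int[mu]_(s in `[a, b]) poisson e (t - s) = atan ((b - t) / e) - atan ((a - t) / e).
Proof.
move=> e0 ab; apply: (@FTC2_seg R (fun s => poisson e (t - s)) (fun s => atan ((s - t) * e^-1))) => //.
  by move=> s _; exact: is_derive_poisson.
move=> s _; apply: continuous_comp; last exact: continuous_poisson.
by apply: cvgB; [exact: cvg_cst|exact: cvg_id].
Qed.

End Poisson.

(** * Abel means and Bessel's inequality *)

Section Plancherel.
Context {R : realType}.
Notation mu := (@lebesgue_measure R).
Implicit Types (D : set R) (f g h w F : R -> R) (M r e x u v t s : R).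

Local Notation P := (`[0%R, +oo[%classic : set R).

Lemma measurable_poisson_sub e : 0 < e ->
  measurable_fun setT (fun p : R * R => poisson e (p.1 - p.2)).
Proof.
move=> e0; apply: (measurableT_comp (measurable_poisson e0)).
by apply: measurable_funB; [exact: measurable_fst|exact: measurable_snd].
Qed.

Lemma cvg_decay1 u (e_ : nat -> R) : e_ n @[n --> \oo] --> (0 : R) ->
  expR (- (u * e_ n)) @[n --> \oo] --> (1 : R).
Proof.
move=> e0; suff : expR (- (u * e_ n)) @[n --> \oo] --> expR (- (u * 0)).
  by rewrite mulr0 oppr0 expR0.
apply: continuous_cvg; first exact: continuous_expR.
by apply: cvgN; apply: cvgM => //; exact: cvg_cst.
Qed.

Lemma cvg_abel h : L1 P h ->
  \int[mu]_(u in P) (expR (- (u * e)) * h u) @[e --> (0 : R)^'+] --> \int[mu]_(u in P) h u.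
Proof.
move=> ih; apply/cvg_at_rightP => e_ [e_gt0 e_cvg].
apply: (dominated_int (g := fun u => `|h u|)) => //.
- move=> n; apply: measurable_funM; last exact: L1_meas.
  apply: measurable_funTS; apply: (measurableT_comp (@measurable_expR R)).
  by apply: measurableT_comp => //; exact: measurable_funM.
- exact: L1_meas.
- exact: L1_abs.
- move=> n u /= /[!in_itv]/= /[!andbT] u0; rewrite normrM ler_piMl// ger0_norm ?expR_ge0//.
  by rewrite -[leRHS](@expR0 R) ler_expR oppr_le0 mulr_ge0// ltW.
- move=> u _; rewrite -[X in _ --> X]mul1r; apply: cvgM; last exact: cvg_cst.
  exact: cvg_decay1.
Qed.

Section OnI.
Variables (I : set R) (L : R).
Hypotheses (mI : measurable I) (IL : forall t, I t -> `|t| <= L) (L0 : 0 <= L).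

Lemma L1_poisson e t : 0 < e -> L1 I (fun s => poisson e (t - s)).
Proof.
move=> e0; apply: (L1_bounded_on mI IL (M := e^-1)); last by move=> *; exact: poisson_max.
apply: measurable_funTS; apply: (measurableT_comp (measurable_poisson e0)).
exact: measurable_funB.
Qed.

Lemma sub_seg : I `<=` `[- L, L].
Proof. by move=> t /IL; rewrite ler_norml /= in_itv. Qed.

Lemma poisson_mass_le e t : 0 < e -> \int[mu]_(s in I) poisson e (t - s) <= pi.
Proof.
move=> e0; have LL : - L <= L by rewrite ge0_cp.
have [iJ E] := poisson_seg t e0 LL.
apply: (@le_trans _ _ (\int[mu]_(s in `[- L, L]) poisson e (t - s))); last first.
  rewrite E; have := atan_ltpi2 ((L - t) / e); have := atan_gtNpi2 ((- L - t) / e).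
  by rewrite [X in _ <= X](_ : pi = pi / 2 + pi / 2) 1?[in RHS]splitr//; lra.
rewrite (Rintegral_mkcond mu I) (Rintegral_mkcond mu `[- L, L]).
apply: int_le => //.
- exact: ((L1_restrictE _ mI).1 (L1_poisson t e0)).
- by apply: ((L1_restrictE _ _).1 iJ).
move=> s _; rewrite /patch; case: ifPn => [/set_mem Is|_].
  by rewrite mem_set//; exact: sub_seg.
by case: ifP => // _; exact: poisson_ge0.
Qed.

Lemma decay_spec e f : 0 < e -> L1 I f ->
  \int[mu]_(u in P) (expR (- (u * e)) * spec I f f u) =
  \int[mu]_(t in I) (f t * \int[mu]_(s in I) (f s * poisson e (t - s))).
Proof.
move=> e0 iF; rewrite -(kernel_spec mI IL _ (L1_decay e0) iF iF); last exact: measurable_itv.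
apply: eq_int => t _; congr (_ * _); apply: eq_int => s _; congr (_ * _).
exact: poisson_integral.
Qed.

(** Schur test: [2 f(t) f(s) <= f(t)^2 + f(s)^2], and the kernel has mass at most pi in either
    variable. *)
Lemma poisson_form_le e f : 0 < e -> sq I f ->
  \int[mu]_(t in I) (f t * \int[mu]_(s in I) (f s * poisson e (t - s))) <= pi * ip I f f.
Proof.
have half x y z : 2 * x <= y + z -> z <= y -> x <= y by move=> *; lra.
move=> e0 sf; have [mf f2] := sf; have iF := sq_L1_bounded mI IL sf.
have pm := measurable_poisson_sub e0.
have pM (p : R * R) : `|poisson e (p.1 - p.2)| <= e^-1 by exact: poisson_max.
have i1 : L1 I (fun=> 1).
  exact: L1_cst_on mI IL 1.
have iA := L1_fubini mI mI iF iF pm pM.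
have iB := L1_fubini mI mI i1 f2 pm pM.
have i_fp g t : L1 I g -> L1 I (fun s => g s * poisson e (t - s)).
  move=> ig; apply: (@L1_mul_bounded _ _ _ _ e^-1) => //.
    exact: L1_meas (L1_poisson t e0).
  by move=> s _; exact: poisson_max.
have le_t t : 2 * (f t * \int[mu]_(s in I) (f s * poisson e (t - s))) <=
    pi * f t ^+ 2 + 1 * \int[mu]_(s in I) (f s ^+ 2 * poisson e (t - s)).
  have ifP := i_fp _ t iF; have if2P := i_fp _ t f2; have iP := L1_poisson t e0.
  rewrite mul1r.
  apply: (@le_trans _ _ (f t ^+ 2 * \int[mu]_(s in I) poisson e (t - s) +
      \int[mu]_(s in I) (f s ^+ 2 * poisson e (t - s)))); last first.
    by rewrite lerD2r mulrC ler_wpM2r ?sqr_ge0//; exact: poisson_mass_le.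
  rewrite mulrA -(intZl _ mI ifP) -(intZl _ mI iP) -(intD mI (L1Zl _ mI iP) if2P).
  apply: int_le; [exact: mI|exact: L1Zl|by apply: L1D => //; exact: L1Zl|].
  move=> s _; rewrite mulrA -mulrDl ler_wpM2r ?poisson_ge0//.
  by have := sqr_ge0 (f t - f s); nra.
have iff : L1 I (fun x => f x * f x) by exact: sqM.
have i2 : L1 I (fun x => pi * (f x * f x)) by exact: L1Zl.
have H : 2 * \int[mu]_(t in I) (f t * \int[mu]_(s in I) (f s * poisson e (t - s))) <=
    pi * ip I f f + \int[mu]_(s in I) (f s ^+ 2 * \int[mu]_(t in I) (1 * poisson e (t - s))).
  rewrite -(fubini_bdd mI mI i1 f2 pm pM).
  rewrite -(intZl 2 mI iA) /ip -(intZl pi mI iff) -(intD mI i2 iB).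
  apply: int_le; [exact: mI|exact: L1Zl|exact: L1D|].
  by move=> t _; rewrite -expr2; exact: le_t.
have H2 : \int[mu]_(s in I) (f s ^+ 2 * \int[mu]_(t in I) (1 * poisson e (t - s))) <=
    pi * ip I f f.
  have -> : pi * ip I f f = \int[mu]_(s in I) (pi * f s ^+ 2).
    by rewrite (intZl _ mI f2).
  apply: int_le; [exact: mI| | |].
  - have pm' : measurable_fun setT (fun p : R * R => poisson e (p.2 - p.1)).
      apply: (measurableT_comp (measurable_poisson e0)).
      by apply: measurable_funB; [exact: measurable_snd|exact: measurable_fst].
    exact: (L1_fubini mI mI f2 i1 pm' (fun p => poisson_max _ e0)).
  - exact: L1Zl.
  - move=> s _; rewrite mulrC ler_wpM2r ?sqr_ge0//.
    apply: le_trans (poisson_mass_le s e0); rewrite le_eqVlt; apply/orP; left; apply/eqP.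
    by apply: eq_int => t _; rewrite mul1r -poissonN opprB.
exact: half H H2.
Qed.

Lemma spec_max f g u : L1 I f -> L1 I g ->
  `|spec I f g u| <= 2 * ((\int[mu]_(t in I) `|f t|) * (\int[mu]_(t in I) `|g t|)).
Proof.
move=> iF ig; rewrite /spec; apply: (le_trans (ler_normD _ _)).
have cf := trans_max mI (@cos_max R) cos_lip u iF.
have cg := trans_max mI (@cos_max R) cos_lip u ig.
have sf := trans_max mI (@sin_max R) sin_lip u iF.
have sg := trans_max mI (@sin_max R) sin_lip u ig.
rewrite !normrM (_ : forall x, 2 * x = x + x); last by move=> x; ring.
by apply: lerD; apply: ler_pM.
Qed.

Lemma L1_mul_spec D w f g : measurable D -> L1 D w -> L1 I f -> L1 I g ->
  L1 D (fun u => w u * spec I f g u).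
Proof.
move=> mD iw iF ig; apply: L1_mul_bounded => //; first exact: (measurable_spec mI IL).
by move=> u _; exact: spec_max.
Qed.

(** By [decay_spec] and [poisson_form_le], the Abel means of [spec I f f] are bounded uniformly in
    the decay rate; Fatou's lemma lets the rate tend to 0. *)
Lemma bessel f : sq I f ->
  L1 P (spec I f f) /\ \int[mu]_(u in P) spec I f f u <= pi * ip I f f.
Proof.
move=> sf; have iF := sq_L1_bounded mI IL sf.
apply: (@fatou_int _ _ (fun n u => expR (- (u * n.+1%:R^-1)) * spec I f f u)) => //.
- by move=> n; apply: L1_mul_spec => //; exact: L1_decay.
- exact: (measurable_spec mI IL).
- by move=> n x _; rewrite mulr_ge0 ?expR_ge0// spec_ge0.
- by move=> u _; rewrite -[X in _ --> X]mul1r; apply: cvgM; [exact/cvg_decay1/cvg_harmonic|exact: cvg_cst].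
- by move=> n; rewrite decay_spec//; exact: poisson_form_le.
Qed.

End OnI.
End Plancherel.

(** * Plancherel's identity for bounded continuous functions *)

Section PlancherelEquality.
Context {R : realType}.
Notation mu := (@lebesgue_measure R).
Implicit Types (D : set R) (f g h w F : R -> R) (M r e x u v t s : R).

Local Notation P := (`[0%R, +oo[%classic : set R).

Section OpenInterval.
Variable L : R.
Hypothesis L_gt0 : 0 < L.
(** Open, so that every point is interior: at an endpoint the Poisson masses would tend to pi / 2
    only. *)
Let J := `]- L, L[%classic : set R.
Let mJ : measurable J. Proof. exact: measurable_itv. Qed.
Let JL t : J t -> `|t| <= L.
Proof. by rewrite /J/= in_itv/= ler_norml => /andP[/ltW-> /ltW]. Qed.

Lemma cvg_atan_divn r : 0 < r -> atan (r / n.+1%:R^-1) @[n --> \oo] --> pi / 2.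
Proof.
move=> r0; apply: (@cvg_comp _ _ _ (fun n : nat => r / n.+1%:R^-1) _ _ (pinfty_nbhs R)); last exact: cvgy_atan.
apply/cvgryPge => M; near=> n.
rewrite invrK -ler_pdivrMl// (@le_trans _ _ n%:R)//; last by rewrite ler_nat.
near: n; exact: nbhs_infty_ger.
Unshelve. all: by end_near. Qed.

Lemma poisson_mass_cvg t : - L < t < L ->
  \int[mu]_(s in J) poisson n.+1%:R^-1 (t - s) @[n --> \oo] --> (pi : R).
Proof.
move=> /andP[Lt tL].
have E n : \int[mu]_(s in J) poisson n.+1%:R^-1 (t - s) =
    atan ((L - t) / n.+1%:R^-1) + atan ((t + L) / n.+1%:R^-1).
  have e0 : 0 < n.+1%:R^-1 :> R by [].
  have LL : - L <= L by rewrite ge0_cp ?(ltW L_gt0).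
  have [iJ] := poisson_seg t e0 LL.
  rewrite (int_itvoo_cc iJ) => ->.
  by rewrite (_ : - L - t = - (t + L)) ?mulNr ?atanN ?opprK// opprD addrC.
under eq_cvg do rewrite E.
have -> : pi = pi / 2 + pi / 2 :> R by exact: splitr.
by apply: cvgD; apply: cvg_atan_divn; lra.
Qed.

Lemma poisson_cvg f M t : measurable_fun setT f -> (forall x, `|f x| <= M) ->
  {for t, continuous f} -> - L < t < L ->
  \int[mu]_(s in J) (f s * poisson n.+1%:R^-1 (t - s)) @[n --> \oo] --> pi * f t.
Proof.
move=> mf fM cf tL; apply/cvgrPdist_le => e e0.
have M0 : 0 <= M by exact: le_trans (fM 0).
have pi0 := @pi_gt0 R.
have eta0 : 0 < e / (2 * pi) by rewrite divr_gt0// mulr_gt0.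
have /cvgrPdist_le/(_ _ eta0)[d /= d0 dP] := cf.
(* The part of the error not controlled by continuity at [t]: the missing mass, plus the region
   [|t - s| >= d], where [f] varies by at most [2 * M] and the kernel is at most its width over
   [d ^+ 2]. *)
have c1 : `|f t| * `|pi - \int[mu]_(s in J) poisson n.+1%:R^-1 (t - s)| +
   2 * M * n.+1%:R^-1 / d ^+ 2 * fine (mu J) @[n --> \oo] --> 0.
  have -> : 0 = `|f t| * `|pi - pi| + 2 * M * 0 / d ^+ 2 * fine (mu J).
    by rewrite subrr normr0 !(mulr0, mul0r) addr0.
  apply: cvgD.
    apply: cvgM; first exact: cvg_cst.
    by apply: cvg_norm; apply: cvgB; [exact: cvg_cst|exact: poisson_mass_cvg].
  apply: cvgM; last exact: cvg_cst.
  apply: cvgM; last exact: cvg_cst.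
  by apply: cvgM; [exact: cvg_cst|exact: cvg_harmonic].
have /cvgrPdist_le/(_ (e / 2)) := c1 => /(_ _)[|N _ NP]; first by rewrite divr_gt0.
exists N => // n /NP/=; set en := n.+1%:R^-1.
have en0 : 0 < en by rewrite /en.
have ip' := L1_poisson mJ JL t en0.
have ifp : L1 J (fun s => f s * poisson en (t - s)).
  apply: L1_eq (L1_mul_bounded mJ ip' (measurable_funTS mf) (fun x _ => fM x)) => // x _.
  exact: mulrC.
rewrite sub0r normrN ger0_norm; last first.
  by rewrite addr_ge0 ?mulr_ge0 ?invr_ge0 ?exprn_ge0 ?fine_ge0 ?measure_ge0 ?(ltW en0) ?(ltW d0).
set m := \int[mu]_(s in J) poisson en (t - s) => H.
have -> : pi * f t - \int[mu]_(s in J) (f s * poisson en (t - s)) =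
   f t * (pi - m) + \int[mu]_(s in J) ((f t - f s) * poisson en (t - s)).
  under [X in _ = _ + X]eq_int => s _ do rewrite mulrBl.
  rewrite intB//; last exact: L1Zl.
  by rewrite intZl// -/m; ring.
apply: (le_trans (ler_normD _ _)); rewrite normrM.
suff : `|\int[mu]_(s in J) ((f t - f s) * poisson en (t - s))| <=
    e / 2 + 2 * M * en / d ^+ 2 * fine (mu J) by lra.
have i2 : L1 J (fun=> 2 * M * en / d ^+ 2).
  exact: L1_cst_on mJ JL _.
apply: (@le_trans _ _ (\int[mu]_(s in J) (e / (2 * pi) * poisson en (t - s) + 2 * M * en / d ^+ 2))).
  apply: int_norm_le => //.
  - apply: measurable_funM; last exact: L1_meas ip'.
    by apply: measurable_funB => //; exact: measurable_funTS.
  - by apply: L1D => //; exact: L1Zl.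
  move=> s _; rewrite normrM (ger0_norm (poisson_ge0 _ en0)).
  have [ts|ts] := ltP `|t - s| d.
    rewrite (@le_trans _ _ (e / (2 * pi) * poisson en (t - s)))//.
      by rewrite ler_wpM2r ?poisson_ge0//; exact: dP.
    by rewrite lerDl ?mulr_ge0 ?invr_ge0 ?exprn_ge0 ?(ltW en0) ?(ltW d0).
  rewrite (@le_trans _ _ (2 * M * (en / d ^+ 2)))//.
    apply: ler_pM => //; [exact: poisson_ge0| |exact: poisson_tail].
    by apply: (le_trans (ler_normB _ _)); have := fM t; have := fM s; lra.
  by rewrite mulrA lerDr mulr_ge0 ?poisson_ge0 ?(ltW eta0).
rewrite (intD mJ (L1Zl _ mJ ip') i2).
rewrite (intZl _ mJ ip') int_cst// lerD2r.
apply: (@le_trans _ _ (e / (2 * pi) * pi)).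
  by rewrite ler_wpM2l ?(ltW eta0)//; exact: (poisson_mass_le mJ JL (ltW L_gt0)).
by rewrite invfM mulrA mulfVK ?gt_eqF.
Qed.

(** The same Abel means converge in two ways: on the frequency side because [bessel] makes the
    spectrum integrable, and on [J] because the Poisson kernel is an approximate identity at each
    point of continuity. *)
Lemma plancherel_continuous f M : continuous f -> (forall x, `|f x| <= M) ->
  \int[mu]_(u in P) spec J f f u = pi * ip J f f.
Proof.
move=> cf fM; have mf := continuous_measurable_fun cf.
have M0 : 0 <= M by exact: le_trans (fM 0).
have iF : L1 J f by apply: (L1_bounded_on mJ JL (M := M)) => //; exact: measurable_funTS.
have sf : sq J f.
  split; first exact: measurable_funTS.
  by apply: L1_mul_bounded (fun x _ => fM x) => //; exact: measurable_funTS.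
have [iS _] := bessel mJ JL (ltW L_gt0) sf.
have c1 : \int[mu]_(u in P) (expR (- (u * n.+1%:R^-1)) * spec J f f u) @[n --> \oo] -->
    \int[mu]_(u in P) spec J f f u.
  by have /cvg_at_rightP := cvg_abel iS; apply; split=> //; exact: cvg_harmonic.
suff c2 : \int[mu]_(u in P) (expR (- (u * n.+1%:R^-1)) * spec J f f u) @[n --> \oo] -->
    pi * ip J f f by exact: (cvg_unique _ c1 c2).
have -> : pi * ip J f f = \int[mu]_(t in J) (f t * (pi * f t)).
  by rewrite -intZl//; [apply: eq_int => t _; ring|exact: sqM].
under eq_cvg do rewrite (decay_spec mJ JL)//.
apply: (dominated_int (g := fun=> M * (pi * M))) => //.
- by move=> n; apply: L1_meas; apply: (L1_fubini mJ mJ iF iF (measurable_poisson_sub _) (fun p => poisson_max _ _)).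
- by apply: measurable_funTS; do 2 apply: measurable_funM => //.
- exact: L1_cst_on mJ JL _.
- move=> n t _; rewrite normrM; apply: ler_pM => //.
  have en0 : 0 < n.+1%:R^-1 :> R by [].
  have ip' := L1_poisson mJ JL t en0.
  have i2 : L1 J (fun s => M * poisson n.+1%:R^-1 (t - s)) by exact: L1Zl.
  apply: (@le_trans _ _ (\int[mu]_(s in J) (M * poisson n.+1%:R^-1 (t - s)))).
    apply: int_norm_le => //.
      by apply: measurable_funM; [exact: measurable_funTS|exact: L1_meas ip'].
    by move=> s _; rewrite normrM (ger0_norm (poisson_ge0 _ en0)) ler_wpM2r// poisson_ge0.
  by rewrite intZl// mulrC ler_wpM2r//; exact: (poisson_mass_le mJ JL (ltW L_gt0)).
- move=> t; rewrite /J/= in_itv/= => tL; apply: cvgM; first exact: cvg_cst.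
  by apply: (poisson_cvg mf fM) => //; exact: cf.
Qed.

End OpenInterval.
End PlancherelEquality.

(** * Density of bounded continuous functions *)

Section Density.
Context {R : realType}.
Notation mu := (@lebesgue_measure R).
Implicit Types (D : set R) (f g h w F : R -> R) (M r e x u v t s : R).

Definition clip M x := Num.max (- M) (Num.min M x).

Lemma clip_cases M x : 0 <= M -> [\/ x <= - M /\ clip M x = - M,
  - M <= x <= M /\ clip M x = x | M <= x /\ clip M x = M].
Proof.
move=> M0; have MM : - M <= M by rewrite ge0_cp.
rewrite /clip; have [xM|/ltW xM] := leP x M; last first.
  by apply: Or33; split=> //; rewrite max_r.
have [Mx|/ltW Mx] := leP (- M) x; last first.
  by apply: Or31; split=> //; rewrite max_l.
by apply: Or32; split=> //; rewrite Mx.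
Qed.

Lemma clip_lip M x y : 0 <= M -> `|clip M x - clip M y| <= `|x - y|.
Proof.
move=> M0; have := ler_norm (x - y); have := ler_norm (y - x).
rewrite [`|y - x|]distrC ler_norml.
by case: (clip_cases x M0) => -[] h ->; case: (clip_cases y M0) => -[] h' ->; lra.
Qed.

Lemma continuous_clip M : 0 <= M -> continuous (clip M).
Proof.
move=> M0 x; apply/cvgrPdist_le => e e0; exists e => // y /= xy.
by apply: (le_trans (clip_lip _ _ M0)); exact: ltW.
Qed.

Lemma clip_max M x : 0 <= M -> `|clip M x| <= M.
Proof.
move=> M0; rewrite /clip ler_norml le_max lexx/= ge_max ge_min lexx/= andbT.
by rewrite ge0_cp.
Qed.

Lemma clip_id M x : `|x| <= M -> clip M x = x.
Proof.
rewrite ler_norml => /andP[Mx xM]; rewrite /clip.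
by rewrite min_r// max_r.
Qed.

Lemma ip_triangle D f g : measurable D -> sq D f -> sq D g ->
  ip D (fun x => f x + g x) (fun x => f x + g x) <= 2 * ip D f f + 2 * ip D g g.
Proof.
move=> mD sf sg; have sfg := sqD mD sf sg.
rewrite /ip -(intZl _ mD (sqM mD sf sf)) -(intZl _ mD (sqM mD sg sg)).
have i1 := L1Zl 2 mD (sqM mD sf sf); have i2 := L1Zl 2 mD (sqM mD sg sg).
rewrite -(intD mD i1 i2); apply: int_le; [exact: mD|exact: sqM|exact: L1D|].
by move=> x _; have := sqr_ge0 (f x - g x); nra.
Qed.

Section OnI.
Variables (I : set R) (L : R).
Hypotheses (mI : measurable I) (IL : forall t, I t -> `|t| <= L).

(** Truncation of [f] at height [N] is close in L^2 by dominated convergence. The truncation is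
    approximated by continuous functions in L^1 and these are clipped at [N] again; for values
    bounded by [N], [|x - y|^2 <= 2 N |x - y|] turns L^1 closeness into L^2 closeness. *)
Lemma density f e : sq I f -> 0 < e -> exists g M,
  [/\ continuous g, forall x, `|g x| <= M & ip I (fun x => f x - g x) (fun x => f x - g x) <= e].
Proof.
move=> sf e0; have [mf f2] := sf.
pose fn (n : nat) x := clip n.+1%:R (f x).
have mfn n : measurable_fun I (fn n).
  apply: measurableT_comp => //.
  by apply: continuous_measurable_fun; exact: continuous_clip.
have c1 : \int[mu]_(x in I) (f x - fn n x) ^+ 2 @[n --> \oo] --> \int[mu]_(x in I) 0.
  apply: (dominated_int (g := fun x => 4 * f x ^+ 2)) => //.
  - by move=> n; apply: measurable_funX; exact: measurable_funB.
  - exact: L1Zl.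
  - move=> n x _; rewrite ger0_norm ?sqr_ge0//.
    have : `|fn n x| <= `|f x|.
      have := @clip_lip n.+1%:R (f x) 0 (ler0n _ _); rewrite [clip _ 0]clip_id ?normr0// !subr0.
      exact.
    have : `|f x - fn n x| <= `|f x| + `|fn n x| by exact: ler_normB.
    rewrite -[(f x - fn n x) ^+ 2]real_normK ?num_real// -[f x ^+ 2]real_normK ?num_real//.
    by have := normr_ge0 (f x - fn n x); have := normr_ge0 (f x); nra.
  - move=> x _; apply: cvg_near_cst; near=> n.
    rewrite /fn clip_id ?subrr ?expr0n//=.
    rewrite (@le_trans _ _ n%:R)//; last by rewrite ler_nat.
    by near: n; exact: nbhs_infty_ger.
have /cvgrPdist_le/(_ (e / 4)) := c1 => /(_ _)[|n _ /(_ n (leqnn n))/=].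
  by rewrite divr_gt0.
rewrite int_cst// mul0r sub0r normrN ger0_norm; last first.
  by apply: Rintegral_ge0 => x _; rewrite sqr_ge0.
set N : R := n.+1%:R => H1.
have N0 : 0 < N by rewrite ltr0n.
have sfn : sq I (fn n).
  apply: (@sq_bounded_by _ _ _ (fun=> N ^+ 2)) => //; last exact: L1_cst_on mI IL _.
  move=> x _; rewrite -[_ ^+ 2]real_normK ?num_real// lerXn2r ?nnegrE ?(ltW N0)//.
  by apply: clip_max; exact: ltW.
have ifn := sq_L1_bounded mI IL sfn.
have [g_ [cg ig c2]] : exists g_ : (R -> R)^nat,
    [/\ forall n, continuous (g_ n),
        forall n, L1 I (g_ n) &
        (\int[mu]_(z in I) `|(fn n z - g_ n0 z)%:E|)%E @[n0 --> \oo] --> 0%E].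
  have := ifn; rewrite L1E => /(approximation_continuous_integrable mI (mu_bounded_lty mI IL)).
  by move=> [g_ [? ? ?]]; exists g_; split => // k; rewrite L1E.
have iabs k : L1 I (fun z => `|fn n z - g_ k z|) by apply: L1_abs; exact: L1B.
have {}c2 : \int[mu]_(z in I) `|fn n z - g_ k z| @[k --> \oo] --> 0.
  have := c2; under eq_cvg => k do rewrite (EFin_int mI (iabs k)).
  by move/fine_cvgP => [].
(* Multiplied by [2 * N] this gives [e / 4]; [ip_triangle] doubles two errors of [e / 4] each. *)
have /cvgrPdist_le/(_ (e / 8 / N)) := c2 => /(_ _)[|k _ /(_ k (leqnn k))/=].
  by rewrite !divr_gt0.
rewrite sub0r normrN ger0_norm; last by apply: Rintegral_ge0.
move=> H2; exists (fun x => clip N (g_ k x)), N; split.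
- by move=> x; apply: continuous_comp; [exact: cg|exact/continuous_clip/ltW].
- by move=> x; apply: clip_max; exact: ltW.
set h := fun x => clip N (g_ k x).
have mh : measurable_fun I h.
  apply: measurableT_comp; last exact: L1_meas.
  by apply: continuous_measurable_fun; exact/continuous_clip/ltW.
have sh : sq I h.
  apply: (@sq_bounded_by _ _ _ (fun=> N ^+ 2)) => //; last exact: L1_cst_on mI IL _.
  move=> x _; rewrite -[_ ^+ 2]real_normK ?num_real// lerXn2r ?nnegrE ?(ltW N0)//.
  by apply: clip_max; exact: ltW.
have s1 := sqB mI sf sfn; have s2 := sqB mI sfn sh.
have := ip_triangle mI s1 s2.
rewrite (@ip_eq _ I _ (fun x => f x - h x) _ (fun x => f x - h x)); first last.
- by move=> x _; ring.
- by move=> x _; ring.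
move=> H3; apply: (le_trans H3).
have H4 : ip I (fun x => fn n x - h x) (fun x => fn n x - h x) <= e / 4.
  apply: (@le_trans _ _ (\int[mu]_(x in I) (2 * N * `|fn n x - g_ k x|))).
    apply: int_le; [exact: mI|exact: sqM|exact: L1Zl|].
    move=> x _; rewrite -expr2 -real_normK ?num_real// expr2; apply: ler_pM => //.
      apply: (le_trans (ler_normB _ _)); rewrite (_ : 2 * N = N + N); last by ring.
      by apply: lerD; apply: clip_max; exact: ltW.
    have E : fn n x = clip N (fn n x) by rewrite clip_id// clip_max// ltW.
    by rewrite /h [in leLHS]E clip_lip// ltW.
  rewrite intZl//; apply: (@le_trans _ _ (2 * N * (e / 8 / N))).
    by rewrite ler_wpM2l// mulr_ge0// ltW.
  by rewrite le_eqVlt; apply/orP; left; apply/eqP; field; rewrite gt_eqF.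
rewrite /ip in H4 *; under [in leLHS]eq_int => x _ do rewrite -expr2.
have Hlra (a b : R) : a <= e / 4 -> b <= e / 4 -> 2 * a + 2 * b <= e by move=> *; lra.
exact: Hlra.
Unshelve. all: by end_near. Qed.

End OnI.
End Density.

(** * Plancherel's identity on bounded sets and the Riemann-Lebesgue lemma *)

Section FourierInversion.
Context {R : realType}.
Notation mu := (@lebesgue_measure R).
Implicit Types (D : set R) (f g h w F : R -> R) (M r e x u v t s : R).
Local Notation P := (`[0%R, +oo[%classic : set R).

Section OnI.
Variables (I : set R) (L : R).
Hypotheses (mI : measurable I) (IL : forall t, I t -> `|t| <= L) (L0 : 0 <= L).

Lemma specDZl f g h r u : L1 I f -> L1 I g ->
  spec I (fun t => f t + r * g t) h u = spec I f h u + r * spec I g h u.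
Proof.
move=> iF ig; have irg := L1Zl r mI ig; rewrite /spec.
rewrite (transD mI (@cos_max R) cos_lip u iF irg) (transD mI (@sin_max R) sin_lip u iF irg).
rewrite (transZ mI (@cos_max R) cos_lip u r ig) (transZ mI (@sin_max R) sin_lip u r ig).
ring.
Qed.

Lemma specDZr f g h r u : L1 I f -> L1 I g ->
  spec I h (fun t => f t + r * g t) u = spec I h f u + r * spec I h g u.
Proof. by move=> iF ig; rewrite specC specDZl// ![spec I h _ u]specC. Qed.

Lemma L1_spec f g : sq I f -> sq I g -> L1 P (spec I f g).
Proof.
move=> sf sg; have [i1 _] := bessel mI IL L0 sf; have [i2 _] := bessel mI IL L0 sg.
have iF := sq_L1_bounded mI IL sf; have ig := sq_L1_bounded mI IL sg.
apply: (@L1_bounded_by _ _ _ (fun u => spec I f f u + spec I g g u)) => //.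
- exact: (measurable_spec mI IL).
- move=> u _; have := @spec_le _ I f g u 1 ltr01; rewrite invr1 !mul1r.
  have := spec_ge0 I f u; have := spec_ge0 I g u.
  have H (a b c : R) : 0 <= a -> 0 <= b -> 2 * c <= b + a -> c <= b + a by move=> *; lra.
  exact: H.
- exact: L1D.
Qed.

(** The gap in Bessel's inequality, as a symmetric bilinear form: positive semidefinite by [bessel],
    and Plancherel's identity says that it vanishes. *)
Definition defect f g := pi * ip I f g - \int[mu]_(u in P) spec I f g u.

Lemma defect_ge0 f : sq I f -> 0 <= defect f f.
Proof. by move=> sf; rewrite subr_ge0; have [] := bessel mI IL L0 sf. Qed.

Lemma defectDZ f g r : sq I f -> sq I g ->
  defect (fun t => f t + r * g t) (fun t => f t + r * g t) =
  defect f f + 2 * r * defect f g + r ^+ 2 * defect g g.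
Proof.
move=> sf sg; have iF := sq_L1_bounded mI IL sf; have ig := sq_L1_bounded mI IL sg.
have srg := sqZ r mI sg; have s1 := sqD mI sf srg.
have mP : measurable P by exact: measurable_itv.
have i1 := L1_spec sf sf; have i2 := L1_spec sf sg; have i3 := L1_spec sg sg.
have E1 : \int[mu]_(u in P) spec I (fun t => f t + r * g t) (fun t => f t + r * g t) u =
    \int[mu]_(u in P) spec I f f u + 2 * r * \int[mu]_(u in P) spec I f g u +
    r ^+ 2 * \int[mu]_(u in P) spec I g g u.
  rewrite -(intZl _ mP i2) -(intZl _ mP i3) -(intD mP i1 (L1Zl _ mP i2)).
  rewrite -(intD mP (L1D mP i1 (L1Zl _ mP i2)) (L1Zl _ mP i3)).
  apply: eq_int => u _; rewrite (specDZl _ _ _ iF ig) !(specDZr _ _ _ iF ig).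
  by rewrite [spec I g f u]specC; ring.
rewrite /defect E1 (ipDl mI sf srg s1) (ipZl _ mI sg s1) [ip I f _]ipC [ip I g _]ipC.
rewrite (ipDl mI sf srg sf) (ipDl mI sf srg sg) (ipZl _ mI sg sf) (ipZl _ mI sg sg).
rewrite [ip I g f]ipC; move: (ip I f f) (ip I f g) (ip I g g) => a b c.
by move: (Rintegral _ _ _) (Rintegral _ _ _) (Rintegral _ _ _); clear => x y z; ring.
Qed.

(* A positive semidefinite form vanishing on a dense set vanishes identically. *)
Lemma defect_approx f g : sq I f -> sq I g -> defect g g = 0 ->
  defect f f <= 2 * (pi * ip I (fun t => f t - g t) (fun t => f t - g t)).
Proof.
move=> sf sg g0.
(* Writing D for the quadratic form, [D(g) = 0] gives [D(f) = 2 D(f - g) - D(f - 2 g)]: the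
   coefficients -1 and -2 eliminate the cross term. The last term is at most 0, and [D(f - g)] is
   bounded by dropping the integral of its spectrum. *)
have H1 := defectDZ (-1) sf sg; have H2 := defectDZ (-2) sf sg.
have s2 : sq I (fun t => f t + -2 * g t) by apply: sqD => //; exact: sqZ.
have s1 : sq I (fun t => f t - g t) by exact: sqB.
have p2 := defect_ge0 s2.
have [iS _] := bessel mI IL L0 s1.
have p3 : 0 <= \int[mu]_(u in P) spec I (fun t => f t - g t) (fun t => f t - g t) u.
  by apply: Rintegral_ge0 => u _; exact: spec_ge0.
rewrite (_ : (fun t => f t + -1 * g t) = (fun t => f t - g t)) in H1; last first.
  by apply/funext => t; rewrite mulN1r.
have alg (a b c d : R) : 0 <= a + 2 * -2 * b + (-2) ^+ 2 * 0 ->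
    c - d = a + 2 * -1 * b + (-1) ^+ 2 * 0 -> 0 <= d -> a <= 2 * c.
  by clear; rewrite !mulr0 !addr0 => *; lra.
by rewrite g0 in H1 H2; rewrite H2 in p2; exact: alg p2 H1 p3.
Qed.

End OnI.

Section Extension.
Variables (I : set R) (L : R).
Hypotheses (mI : measurable I) (IL : forall t, I t -> `|t| <= L) (L0 : 0 <= L).
(** An open interval containing [I]. Extension by zero changes neither transforms nor inner
    products, which reduces an arbitrary bounded measurable [I] to the open case. *)
Let J := `]- (L + 1), (L + 1)[%classic : set R.

Let JI : J `&` I = I.
Proof.
apply/seteqP; split => [t []//|t It]; split => //.
by have := IL It; rewrite /J/= in_itv/= ler_norml => /andP[? ?]; apply/andP; split; lra.
Qed.

Lemma int_extension (f : R -> R) : \int[mu]_(t in J) (f \_ I) t = \int[mu]_(t in I) f t.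
Proof. by rewrite -(Rintegral_mkcondr mu) JI. Qed.

Let restrictM (f g : R -> R) t : (f \_ I) t * g t = ((fun t => f t * g t) \_ I) t.
Proof. by rewrite /patch; case: ifP => //; rewrite mul0r. Qed.

Lemma trans_extension k f u : trans k J (f \_ I) u = trans k I f u.
Proof.
rewrite /trans -int_extension; apply: eq_int => t _.
exact: (restrictM f (fun t => k (u * t))).
Qed.

Lemma ip_extension f g : ip J (f \_ I) (g \_ I) = ip I f g.
Proof.
rewrite /ip -int_extension; apply: eq_int => t _; rewrite /patch; case: ifP => //.
by rewrite mul0r.
Qed.

Lemma sq_extension f : sq I f -> sq J (f \_ I).
Proof.
have mJ : measurable J by exact: measurable_itv.
move=> [mf f2]; split.
  by apply: (measurable_restrict f mI mJ).1; rewrite JI.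
have i2 := (L1_restrictE _ mI).1 f2.
apply: L1_eq (L1_S measurableT mJ _ i2) => // t _.
by rewrite /patch; case: ifP => //; rewrite expr0n.
Qed.

(** On the diagonal the defect is below every [e > 0], by density and [defect_approx]; polarization
    of [f + g] then gives [2 * defect I f g = 0]. *)
Lemma plancherel f g : sq I f -> sq I g ->
  L1 P (spec I f g) /\ \int[mu]_(u in P) spec I f g u = pi * ip I f g.
Proof.
move=> sf sg; split; first exact: (L1_spec mI IL L0).
have L1_gt0 : 0 < L + 1 by rewrite ltr_wpDl.
have mJ : measurable J by exact: measurable_itv.
have JL t : J t -> `|t| <= L + 1.
  by rewrite /J/= in_itv/= ler_norml => /andP[/ltW-> /ltW].
have d0 h : sq I h -> defect J (h \_ I) (h \_ I) = 0.
  move=> /sq_extension sh; apply/eqP; rewrite eq_le (defect_ge0 mJ JL (ltW L1_gt0))// andbT.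
  apply/ler_addgt0Pr => e e0; rewrite add0r.
  have e1 : 0 < e / (2 * pi) by rewrite divr_gt0// mulr_gt0// pi_gt0.
  have [k [M [ck kM kl]]] := density mJ JL sh e1.
  have mk := continuous_measurable_fun ck.
  have sk : sq J k.
    have iF : L1 J k by apply: (L1_bounded_on mJ JL (M := M)) => //; exact: measurable_funTS.
    split; first exact: measurable_funTS.
    by apply: L1_mul_bounded (fun x _ => kM x) => //; exact: measurable_funTS.
  have k0 : defect J k k = 0 by rewrite /defect (plancherel_continuous L1_gt0 ck kM) subrr.
  apply: (le_trans (defect_approx mJ JL (ltW L1_gt0) sh sk k0)).
  by rewrite mulrA mulrC -ler_pdivlMr ?mulr_gt0 ?pi_gt0.
have d1 h : sq I h -> defect I h h = 0.
  move=> sh; rewrite -(d0 h sh) /defect ip_extension; congr (_ - _).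
  by apply: eq_int => u _; rewrite /spec !trans_extension.
have := defectDZ mI IL L0 1 sf sg; rewrite d1; last by apply: sqD => //; exact: sqZ.
rewrite !d1// mulr0 addr0 add0r mulr1 => /esym/eqP; rewrite mulf_eq0 pnatr_eq0/=.
by rewrite subr_eq0 => /eqP.
Qed.

End Extension.

Section RiemannLebesgue.
Variables (I : set R) (L : R).
Hypotheses (mI : measurable I) (IL : forall t, I t -> `|t| <= L) (L0 : 0 <= L).

Lemma spec_lip f : L1 I f -> exists2 K, 0 <= K &
  forall u v, `|spec I f f u - spec I f f v| <= K * `|u - v|.
Proof.
move=> iF; pose N := \int[mu]_(t in I) `|f t|.
have N0 : 0 <= N by exact: Rintegral_ge0.
exists (4 * L * N * N) => [|u v]; first by rewrite !mulr_ge0.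
have H (k : R -> R) : (forall x, `|k x| <= 1) -> (forall x y, `|k x - k y| <= `|x - y|) ->
    `|trans k I f u * trans k I f u - trans k I f v * trans k I f v| <= 2 * L * N * N * `|u - v|.
  move=> k1 kl; rewrite -!expr2 subr_sqr mulrC normrM.
  have -> : 2 * L * N * N * `|u - v| = (N + N) * (L * N * `|u - v|) by ring.
  apply: ler_pM => //; last exact: (trans_lip mI IL).
  by apply: (le_trans (ler_normD _ _)); apply: lerD; exact: (trans_max mI).
rewrite /spec opprD addrACA; apply: (le_trans (ler_normD _ _)).
have -> : 4 * L * N * N * `|u - v| = 2 * L * N * N * `|u - v| + 2 * L * N * N * `|u - v| by ring.
by apply: lerD; apply: H; [exact: cos_max|exact: cos_lip|exact: sin_max|exact: sin_lip].
Qed.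

(* [spec I f f] is Lipschitz and integrable, hence vanishes at infinity. *)
Lemma riemann_lebesgue f (l : nat -> R) : sq I f -> l n @[n --> \oo] --> +oo ->
  spec I f f (l n) @[n --> \oo] --> 0.
Proof.
move=> sf loo; have [iS _] := bessel mI IL L0 sf.
have iF := sq_L1_bounded mI IL sf.
have [K K0 KP] := spec_lip iF.
have mP : measurable P by exact: measurable_itv.
pose F := spec I f f.
have F0 u : 0 <= F u by exact: spec_ge0.
have mF D : measurable_fun D F by exact: (measurable_spec mI IL).
have c0 : \int[mu]_(u in P) (F \_ `[l n, +oo[) u @[n --> \oo] --> \int[mu]_(u in P) 0.
  apply: (dominated_int (g := F)) => //.
  - move=> n; apply/measurable_restrict => //; exact: mF.
  - by move=> n u _; rewrite /patch; case: ifP => _; rewrite ?normr0// ger0_norm.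
  - move=> u _; apply: cvg_near_cst; near=> n; rewrite patchE ifF//.
    apply/negP; rewrite inE/= in_itv/= andbT; apply/negP; rewrite -ltNge.
    by near: n; move/cvgryPgt : loo; apply.
rewrite int_cst// mul0r in c0.
apply/cvgrPdist_le => e e0.
(* On [[l n, l n + d]] the spectrum stays above its value at [l n] minus [K * d], and
   [K * d <= e / 2]. A tail integral at most [d * (e / 2)] therefore forces that value below [e]. *)
pose d := e / (2 * (K + 1)).
have K1 : 0 < K + 1 by lra.
have d0 : 0 < d by rewrite divr_gt0// mulr_gt0.
have /cvgrPdist_le/(_ (d * (e / 2))) := c0 => /(_ _)[|N _ NP]; first by rewrite mulr_gt0// divr_gt0.
near=> n; have /NP/= : (N <= n)%N by near: n; exact: nbhs_infty_ge.
have l0 : 0 <= l n by near: n; move/cvgryPge : loo; apply.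
rewrite !sub0r !normrN ger0_norm; last first.
  by apply: Rintegral_ge0 => u _; rewrite /patch; case: ifP.
rewrite [`|spec _ _ _ _|]ger0_norm// => H.
have sub1 : `[l n, l n + d] `<=` P.
  by move=> u /=; rewrite !in_itv/= andbT => /andP[lu _]; exact: le_trans lu.
have H2 : \int[mu]_(u in `[l n, l n + d]) F u <= d * (e / 2).
  apply: le_trans H; rewrite -(Rintegral_mkcondr mu).
  rewrite (Rintegral_mkcond mu) [leRHS](Rintegral_mkcond mu).
  have iF1 : L1 `[l n, l n + d] F by exact: L1_S iS.
  have iF2 : L1 (P `&` `[l n, +oo[) F.
    by apply: (L1_S mP _ _ iS) => //; exact: measurableI.
  apply: int_le; [by []|exact: (L1_restrictE _ _).1 iF1| |].
    by apply: (L1_restrictE _ _).1 iF2; exact: measurableI.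
  move=> u _; rewrite /patch; case: ifPn => [|_]; last by case: ifP.
  rewrite inE/= in_itv/= => /andP[lu ud]; rewrite mem_set//; split.
    by rewrite /= in_itv/= andbT (le_trans l0).
  by rewrite /= in_itv/= andbT.
have H3 : d * (F (l n) - K * d) <= \int[mu]_(u in `[l n, l n + d]) F u.
  have -> : d * (F (l n) - K * d) = \int[mu]_(u in `[l n, l n + d]) (F (l n) - K * d).
    rewrite int_cst// lebesgue_measure_itv/= lte_fin ltrDl d0/= mulrC.
    by congr (_ * _); ring.
  apply: int_le; [by []| |exact: L1_S iS|].
    apply: (@L1_bounded _ _ _ `|F (l n) - K * d|) => //.
    by rewrite lebesgue_measure_itv/= lte_fin ltrDl d0/= -EFinB ltry.
  move=> u; rewrite /= in_itv/= => /andP[lu ud].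
  have := KP (l n) u; rewrite -/(F _) -/(F u) => H4.
  have : F (l n) - F u <= K * `|l n - u| by apply: le_trans H4; exact: ler_norm.
  have : K * `|l n - u| <= K * d.
    by rewrite ler_wpM2l// distrC ger0_norm ?subr_ge0// lerBlDl.
  by move=> *; lra.
have : F (l n) - K * d <= e / 2.
  by rewrite -(ler_pM2l d0); exact: le_trans H2.
have : K * d <= e / 2.
  rewrite /d (_ : K * _ = e / 2 * (K / (K + 1))); last by field; rewrite gt_eqF.
  by rewrite ler_piMr ?divr_ge0 ?(ltW e0)// ler_pdivrMr// mul1r lerDl.
rewrite /F; move: (spec _ _ _ _) (K * d); clear => a b *; lra.
Unshelve. all: by end_near. Qed.

End RiemannLebesgue.
End FourierInversion.

(** * Completeness and weak compactness *)

Section Completeness.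
Context {R : realType}.
Notation mu := (@lebesgue_measure R).
Implicit Types (D : set R) (f g h w F : R -> R) (M C r e x u v t s : R).

Lemma int_ae D f g : measurable D -> measurable_fun D f -> measurable_fun D g ->
  {ae mu, forall x, D x -> f x = g x} ->
  \int[mu]_(x in D) f x = \int[mu]_(x in D) g x.
Proof.
move=> mD mf mg fg; congr fine; apply: ae_eq_integral => //.
- exact/measurable_EFinP.
- exact/measurable_EFinP.
- have [N [mN N0 NP]] := fg; exists N; split => //.
  by apply: subset_trans NP => x /= H1 H2; apply: H1 => Dx; rewrite H2.
Qed.

Lemma sum_half C k : \sum_(0 <= i < k) (C * 2^-1 ^+ i) = 2 * C * (1 - 2^-1 ^+ k) :> R.
Proof.
elim: k => [|k IH]; first by rewrite big_geq// expr0 subrr mulr0.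
by rewrite big_nat_recr//= IH exprS; field.
Qed.

(** The integrals sum to at most [2 * C], so by monotone convergence the sum of the [d n] is
    integrable and hence finite outside a null set; [E] is the complement of that set in [D]. *)
Lemma ae_summable D (d : nat -> R -> R) C : measurable D -> 0 <= C ->
  (forall n, L1 D (d n)) -> (forall n x, D x -> 0 <= d n x) ->
  (forall n, \int[mu]_(x in D) d n x <= C * 2^-1 ^+ n) ->
  exists E : set R, [/\ measurable E, E `<=` D, mu (D `\` E) = 0 &
    forall x, E x -> cvgn (series (fun n => d n x))].
Proof.
move=> mD C0 id d0 dC.
have md n : measurable_fun D (EFin \o d n) by apply/measurable_EFinP; exact: L1_meas.
pose G x := (\sum_(0 <= n <oo) (d n x)%:E)%E.
have mG : measurable_fun D G.
  have := @ge0_emeasurable_sum _ _ _ D (fun n => EFin \o d n) xpredT; apply => // k x Dx _ /=.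
  by rewrite lee_fin d0.
have G0 x : D x -> (0 <= G x)%E.
  by move=> Dx; apply: nneseries_ge0 => n _ _; rewrite lee_fin d0.
have iG : mu.-integrable D G.
  apply/integrableP; split => //.
  apply: (@le_lt_trans _ _ (2 * C)%:E); last exact: ltry.
  under eq_integral => x /set_mem Dx do rewrite gee0_abs ?G0//.
  rewrite (integral_nneseries mu mD md); last by move=> n x Dx /=; rewrite lee_fin d0.
  apply: lime_le.
    apply: is_cvg_nneseries => n _ _; apply: integral_ge0 => x Dx.
    by rewrite lee_fin d0.
  apply: nearW => k; under eq_bigr => n _ do rewrite (EFin_int mD (id n)).
  rewrite sumEFin lee_fin; apply: (@le_trans _ _ (\sum_(0 <= i < k) (C * 2^-1 ^+ i))).
    by apply: ler_sum => n _; exact: dC.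
  by rewrite sum_half ler_piMr ?mulr_ge0// gerBl exprn_ge0.
have [N [mN N0 NP]] := @integrable_ae _ _ _ mu D mD G iG.
exists (D `\` N); split => //.
- exact: measurableD.
- apply/eqP; rewrite -measure_le0; apply: (@le_trans _ _ (mu N)); last by rewrite N0.
  apply: le_measure; rewrite ?inE//; first by apply: measurableD => //; exact: measurableD.
  by move=> x [Dx] /not_andP[|/contrapT].
move=> x [Dx Nx].
have Gfin : G x \is a fin_num by apply: contrapT => H; apply: Nx; apply: NP => /(_ Dx).
apply: nondecreasing_is_cvgn.
  by apply/nondecreasing_seqP => n; rewrite /series/= big_nat_recr//= lerDl d0.
exists (fine (G x)) => _ [n _ <-].
rewrite -lee_fin fineK// /series/= -sumEFin.
by apply: nneseries_lim_ge => k _ _; rewrite lee_fin d0.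
Qed.

Section OnI.
Variables (I : set R) (L : R).
Hypotheses (mI : measurable I) (IL : forall t, I t -> `|t| <= L).

Lemma ip_self D f : ip D f f = \int[mu]_(x in D) (f x ^+ 2).
Proof. by apply: eq_int => x _; rewrite expr2. Qed.

(** Riesz-Fischer for a sequence with a prescribed geometric rate. The rate makes the increments
    summable almost everywhere, which gives a pointwise limit, and the same rate is inherited by the
    limit. *)
Lemma L2_complete (h_ : nat -> R -> R) : (forall n, sq I (h_ n)) ->
  (forall n m, (n <= m)%N ->
    ip I (fun t => h_ m t - h_ n t) (fun t => h_ m t - h_ n t) <= (2^-1 ^+ n) ^+ 2) ->
  exists2 h, sq I h & forall n,
    ip I (fun t => h t - h_ n t) (fun t => h t - h_ n t) <= (2^-1 ^+ n) ^+ 2.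
Proof.
move=> sh hc.
have mh n : measurable_fun I (h_ n) by case: (sh n).
pose d n t := `|h_ n.+1 t - h_ n t|.
have sd n m := sqB mI (sh m) (sh n).
have id n : L1 I (d n) by apply: L1_abs; exact: (sq_L1_bounded mI IL (sd n n.+1)).
pose C := fine (mu I) + 1.
have C0 : 0 <= C by rewrite addr_ge0 ?fine_ge0.
have dC n : \int[mu]_(t in I) d n t <= C * 2^-1 ^+ n.
  set r := 2^-1 ^+ n; have r0 : 0 < r by rewrite exprn_gt0.
  have i2 := (sd n n.+1).2.
  have i3 := L1Zl r^-1 mI i2; have i4 := L1_cst_on mI IL r.
  (* [|x| <= r + r^-1 * x^2] converts the L^2 rate [r ^+ 2] into the L^1 rate [C * r], with [C] the
     measure of [I] plus 1. *)
  apply: (@le_trans _ _ (\int[mu]_(t in I) (r + r^-1 * (h_ n.+1 t - h_ n t) ^+ 2))).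
    apply: int_le; [exact: mI|exact: id|exact: L1D|].
    move=> t _; rewrite /d -[X in r^-1 * X]real_normK ?num_real//.
    move: `|_| (normr_ge0 (h_ n.+1 t - h_ n t)) => y y0.
    rewrite -(ler_pM2l r0) mulrDr mulrA mulfV ?gt_eqF// mul1r.
    by have := sqr_ge0 (r - y); have : 0 <= r * y; [rewrite mulr_ge0// ltW|nra].
  rewrite (intD mI i4 i3) (intZl _ mI i2) int_cst// -ip_self.
  have := hc n n.+1 (leqnSn n); rewrite -/r => H.
  have : r^-1 * ip I (fun t => h_ n.+1 t - h_ n t) (fun t => h_ n.+1 t - h_ n t) <= r.
    by rewrite mulrC ler_pdivrMr// -expr2.
  by rewrite /C mulrDl mul1r [r * _]mulrC lerD2l.
have d0 n t : I t -> 0 <= d n t by rewrite /d.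
have [E [mE EI E0 Ecvg]] := ae_summable mI C0 id d0 dC.
have hcvg t : E t -> cvgn (h_ ^~ t).
  move=> Et; have : cvgn (series (telescope (h_ ^~ t))) by apply: normed_cvg; exact: Ecvg.
  move=> /cvg_ex[l cl]; apply/cvg_ex; exists (h_ 0%N t + l).
  rewrite (_ : h_ ^~ t = fun n => h_ 0%N t + series (telescope (h_ ^~ t)) n).
    by apply: cvgD => //; exact: cvg_cst.
  by apply/funext => n; exact: eq_sum_telescope.
(* Setting the functions to 0 off [E] makes the limit exist everywhere, which yields its
   measurability. *)
pose h' n := h_ n \_ E; pose h t := limn (h' ^~ t).
have ch' t : h' n t @[n --> \oo] --> h t.
  rewrite /h; suff : cvgn (h' ^~ t) by [].
  have [Et|Et] := pselect (E t).
    by rewrite (_ : h' ^~ t = h_ ^~ t); [exact: hcvg|apply/funext => n; rewrite /h' patchT// inE].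
  rewrite (_ : h' ^~ t = fun=> 0); first exact: is_cvg_cst.
  by apply/funext => n; rewrite /h' patchN// notin_setE.
have sh' n : sq I (h' n).
  apply: (@sq_bounded_by _ _ _ (fun t => h_ n t ^+ 2)) => //; last exact: (sh n).2.
    apply: (measurable_restrict _ mE mI).1; exact: measurable_funS mI (@subIsetl _ _ _) (mh n).
  by move=> t _; rewrite /h' /patch; case: ifP => // _; rewrite expr0n/= sqr_ge0.
have mhh : measurable_fun I h.
  by apply: (measurable_fun_cvg (h := h')) => [n|t _]; [case: (sh' n)|exact: ch'].
(* Fatou's lemma in the larger index of the Cauchy condition. *)
have key n : L1 I (fun t => (h t - h' n t) ^+ 2) /\
    \int[mu]_(t in I) (h t - h' n t) ^+ 2 <= (2^-1 ^+ n) ^+ 2.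
  apply: (@fatou_int _ _ (fun m t => (h' (m + n)%N t - h' n t) ^+ 2)) => //.
  - by move=> m; exact: (sqB mI (sh' (m + n)%N) (sh' n)).2.
  - by apply: measurable_funX; apply: measurable_funB => //; case: (sh' n).
  - by move=> m t _; rewrite sqr_ge0.
  - move=> t _; rewrite expr2; under eq_cvg => m do rewrite expr2.
    have c1 : h' (m + n)%N t - h' n t @[m --> \oo] --> h t - h' n t.
      apply: cvgB; last exact: cvg_cst.
      have := ch' t; rewrite -(cvg_shiftn n); exact.
    exact: cvgM.
  move=> m; apply: le_trans (hc n (m + n)%N (leq_addl _ _)).
  rewrite ip_self; apply: int_le; [exact: mI| | |].
  - exact: (sqB mI (sh' (m + n)%N) (sh' n)).2.
  - exact: (sd n (m + n)%N).2.
  move=> t _; rewrite /h' /patch; case: ifP => // _.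
  by rewrite subrr expr0n/= sqr_ge0.
have s0 : sq I (fun t => h t - h' 0%N t).
  by split; [apply: measurable_funB => //; case: (sh' 0%N)|exact: (key 0%N).1].
have sqh : sq I h.
  by apply: sq_eq (sqD mI s0 (sh' 0%N)) => // t _; rewrite subrK.
exists h => // n.
rewrite ip_self; apply: le_trans (key n).2; rewrite le_eqVlt; apply/orP; left; apply/eqP.
apply: int_ae => //.
- by apply: measurable_funX; exact: measurable_funB.
- by apply: measurable_funX; apply: measurable_funB => //; case: (sh' n).
exists (I `\` E); split => //; first exact: measurableD.
move=> t /= /not_implyP[It H]; split => // Et; apply: H.
by rewrite /h' patchT// inE.
Qed.

End OnI.
End Completeness.

(** * The adjoint of the Fourier transform *)

Section Synthesis.
Context {R : realType}.
Notation mu := (@lebesgue_measure R).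
Implicit Types (D : set R) (f g h w F c s : R -> R) (M C r e x u v t : R).
Local Notation P := (`[0%R, +oo[%classic : set R).

Let mP : measurable P. Proof. exact: measurable_itv. Qed.

Lemma cvg_tail F (l : nat -> R) : L1 P F -> l n @[n --> \oo] --> +oo ->
  \int[mu]_(u in P) (F \_ `[l n, +oo[) u @[n --> \oo] --> 0.
Proof.
move=> iF loo; suff : \int[mu]_(u in P) (F \_ `[l n, +oo[) u @[n --> \oo] -->
  \int[mu]_(u in P) 0 by rewrite int_cst// mul0r.
apply: (dominated_int (g := fun u => `|F u|)) => //.
- move=> n; apply/measurable_restrict => //; apply: measurable_funS mP _ (L1_meas iF).
  exact: subIsetl.
- exact: L1_abs.
- by move=> n u _; rewrite /patch; case: ifP => _; rewrite ?normr0.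
- move=> u _; apply: cvg_near_cst; near=> n; rewrite patchE ifF//.
  apply/negP; rewrite inE/= in_itv/= andbT; apply/negP; rewrite -ltNge.
  by near: n; move/cvgryPgt : loo; apply.
Unshelve. all: by end_near. Qed.

Lemma L1_patch D E f : measurable D -> measurable E -> L1 D f -> L1 D (f \_ E).
Proof.
move=> mD mE iF; apply: (L1_bounded_by _ _ _ (L1_abs iF)) => //.
  apply/measurable_restrict => //; apply: measurable_funS mD _ (L1_meas iF).
  exact: subIsetl.
by move=> x _; rewrite /patch; case: ifP => _; rewrite ?normr0.
Qed.

Lemma patch_ray f r u : (f \_ `[r, +oo[) u = if r <= u then f u else 0.
Proof.
rewrite /patch; case: ifPn; rewrite ?notin_setE ?inE/= in_itv/= andbT; first by move=> ->.
by move=> /negP/negPf ->.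
Qed.

Section OnI.
Variables (I : set R) (L : R).
Hypotheses (mI : measurable I) (IL : forall t, I t -> `|t| <= L) (L0 : 0 <= L).

Let DN (N : R) : set R := `[0, N].

Let mDN N : measurable (DN N). Proof. exact: measurable_itv. Qed.

Let DNL N t : DN N t -> `|t| <= N.
Proof. by rewrite /DN/= in_itv/= => /andP[t0 tN]; rewrite ger0_norm. Qed.

Let DNP N : DN N `<=` P.
Proof. by move=> t; rewrite /DN/= !in_itv/= andbT => /andP[]. Qed.

Let L1_DN N c : sq P c -> L1 (DN N) c.
Proof. by move=> sc; apply: (sq_L1_bounded (mDN N) (@DNL N)); exact: sq_S sc. Qed.

Let patchDN N f u : 0 <= u -> (f \_ (DN N)) u = if u <= N then f u else 0.
Proof.
move=> u0; rewrite /patch /DN; case: ifPn; rewrite ?notin_setE ?inE/= in_itv/= u0/=.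
  by move=> ->.
by move=> /negP/negPf ->.
Qed.

(** The Fourier inversion integral cut off at frequency [N]; the factor [pi^-1] matches the constant
    in [plancherel]. *)
Definition partial_synthesis c s N t :=
  pi^-1 * (trans cos (DN N) c t + trans sin (DN N) s t).

Definition pairing c s g u := c u * trans cos I g u + s u * trans sin I g u.

Lemma L1_pairing c s g : sq P c -> sq P s -> sq I g -> L1 P (pairing c s g).
Proof.
move=> sc ss sg; have ig := sq_L1_bounded mI IL sg.
have [iS _] := bessel mI IL L0 sg.
have sC : sq P (trans cos I g).
  apply: sq_bounded_by iS => //; first exact: (measurable_trans mI IL (@cos_max R) cos_lip).
  by move=> u _; rewrite /spec -!expr2 lerDl sqr_ge0.
have sS : sq P (trans sin I g).
  apply: sq_bounded_by iS => //; first exact: (measurable_trans mI IL (@sin_max R) sin_lip).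
  by move=> u _; rewrite /spec -!expr2 lerDr sqr_ge0.
by apply: L1D => //; exact: sqM.
Qed.

Lemma sq_partial_synthesis c s N : sq P c -> sq P s -> sq I (partial_synthesis c s N).
Proof.
move=> sc ss; have ic := L1_DN N sc; have is_ := L1_DN N ss.
have mc : measurable_fun I (trans cos (DN N) c).
  exact: (measurable_trans (mDN N) (@DNL N) (@cos_max R) cos_lip).
have ms : measurable_fun I (trans sin (DN N) s).
  exact: (measurable_trans (mDN N) (@DNL N) (@sin_max R) sin_lip).
apply: sqZ => //; apply: sqD => //; split => //.
- apply: (L1_bounded_on mI IL (M := (\int[mu]_(t in DN N) `|c t|) ^+ 2)).
    exact: measurable_funX.
  move=> t _; rewrite normrX lerXn2r ?nnegrE// ?Rintegral_ge0//.
  exact: (trans_max (mDN N) (@cos_max R) cos_lip).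
- apply: (L1_bounded_on mI IL (M := (\int[mu]_(t in DN N) `|s t|) ^+ 2)).
    exact: measurable_funX.
  move=> t _; rewrite normrX lerXn2r ?nnegrE// ?Rintegral_ge0//.
  exact: (trans_max (mDN N) (@sin_max R) sin_lip).
Qed.

Lemma ip_partial_synthesis c s g N : sq P c -> sq P s -> sq I g ->
  pi * ip I (partial_synthesis c s N) g = \int[mu]_(u in P) (pairing c s g \_ (DN N)) u.
Proof.
move=> sc ss sg; have ic := L1_DN N sc; have is_ := L1_DN N ss.
have ig := sq_L1_bounded mI IL sg; have iH := sqM mI (sq_partial_synthesis N sc ss) sg.
have iP := L1_S mP (mDN N) (@DNP N) (L1_pairing sc ss sg).
have m1 : measurable_fun setT (fun p : R * R => p.1) by exact: measurable_fst.
have m2 : measurable_fun setT (fun p : R * R => p.2) by exact: measurable_snd.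
have mC := measurable_cos_prod m1 m2; have mS := measurable_sin_prod m1 m2.
rewrite -(Rintegral_mkcondr mu) (setIidr (@DNP N)) /ip -(intZl _ mI iH).
have iC := L1_fubini mI (mDN N) ig ic mC (fun p => @cos_max R _).
have iS := L1_fubini mI (mDN N) ig is_ mS (fun p => @sin_max R _).
have iC' := L1_mul_trans mI IL (@cos_max R) cos_lip (mDN N) ic ig.
have iS' := L1_mul_trans mI IL (@sin_max R) sin_lip (mDN N) is_ ig.
transitivity (\int[mu]_(t in I) (g t * \int[mu]_(u in DN N) (c u * cos (t * u)) +
    g t * \int[mu]_(u in DN N) (s u * sin (t * u)))).
  apply: eq_int => t _; rewrite /partial_synthesis 2!mulrA mulfV ?gt_eqF ?pi_gt0//.
  by rewrite mul1r mulrC mulrDr.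
rewrite (intD mI iC iS) (fubini_bdd mI (mDN N) ig ic mC (fun p => @cos_max R _)).
rewrite (fubini_bdd mI (mDN N) ig is_ mS (fun p => @sin_max R _)).
rewrite -(intD (mDN N) (L1_fubini (mDN N) mI ic ig (measurable_cos_prod m2 m1) (fun p => @cos_max R _))
  (L1_fubini (mDN N) mI is_ ig (measurable_sin_prod m2 m1) (fun p => @sin_max R _))).
apply: eq_int => u _; rewrite /pairing; congr (_ * _ + _ * _).
  by apply: eq_int => t _; rewrite [u * t]mulrC.
by apply: eq_int => t _; rewrite [u * t]mulrC.
Qed.

Lemma pairing_le c s g u :
  2 * pairing c s g u <= (c u ^+ 2 + s u ^+ 2) + spec I g g u.
Proof.
rewrite /pairing /spec.
have := sqr_ge0 (c u - trans cos I g u); have := sqr_ge0 (s u - trans sin I g u).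
by move: (c u) (s u) (trans cos I g u) (trans sin I g u) => a b x y; nra.
Qed.

(** The truncated inversion integrals are Cauchy. Testing the difference [d] of two of them against
    itself, [2 pi |d|^2] is at most the tail of [c^2 + s^2] plus the integral of [spec I d d];
    Bessel bounds the latter by [pi |d|^2], which is absorbed on the left. *)
Theorem synthesis_exists c s : sq P c -> sq P s -> exists2 h, sq I h &
  forall g, sq I g -> pi * ip I h g = \int[mu]_(u in P) pairing c s g u.
Proof.
have alg (a a' b x y : R) : b <= y -> x <= a -> a = a' -> 2 * a' <= b + x -> a <= y.
  by move=> *; lra.
have alg2 (y z q w : R) : z <= q -> 0 <= y -> 0 <= w -> 2 * y <= z + w -> y <= q + w.
  by move=> *; lra.
move=> sc ss; pose F u := c u ^+ 2 + s u ^+ 2.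
have iF : L1 P F by apply: L1D => //; [exact: sc.2|exact: ss.2].
have F0 u : 0 <= F u by rewrite addr_ge0 ?sqr_ge0.
have noo : n%:R @[n --> \oo] --> (+oo : set_system R) by exact: cvgr_idn.
have cT := cvg_tail iF noo.
have Tk n : {k : nat | forall m, (k <= m)%N ->
    \int[mu]_(u in P) (F \_ `[m%:R, +oo[) u <= pi * (2^-1 ^+ n) ^+ 2}.
  apply: cid; have e0 : 0 < pi * (2^-1 ^+ n) ^+ 2 :> R by rewrite mulr_gt0 ?pi_gt0// !exprn_gt0.
  have /cvgrPdist_le/(_ _ e0)[k _ kP] := cT; exists k => m /kP/=.
  by rewrite sub0r normrN; apply: le_trans; exact: ler_norm.
(* The cutoffs [k n] achieve the rate that [L2_complete] asks for but need not be monotone; the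
   partial sums plus [n] dominate them, are monotone and tend to infinity. *)
pose k n := sval (Tk n); pose N n := (\sum_(0 <= i < n.+1) k i + n)%N.
have kN n : (k n <= N n)%N by rewrite /N big_nat_recr//= -addnA addnCA leq_addr.
have N_nd n m : (n <= m)%N -> (N n <= N m)%N.
  by move=> nm; rewrite /N leq_add// [leqRHS](big_cat_nat (n := n.+1))//= leq_addr.
pose h_ n := partial_synthesis c s (N n)%:R.
have sh n : sq I (h_ n) by exact: sq_partial_synthesis.
have hc n m : (n <= m)%N ->
    ip I (fun t => h_ m t - h_ n t) (fun t => h_ m t - h_ n t) <= (2^-1 ^+ n) ^+ 2.
  move=> nm; have sd := sqB mI (sh m) (sh n); set d := fun t => _ in sd *.
  have [iS bS] := bessel mI IL L0 sd.
  have iP := L1_pairing sc ss sd.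
  have iPm := L1_patch mP (mDN (N m)%:R) iP; have iPn := L1_patch mP (mDN (N n)%:R) iP.
  have Tn := svalP (Tk n) _ (kN n).
  rewrite -(ler_pM2l (pi_gt0 R)); apply: (alg _ (\int[mu]_(u in P) (pairing c s d \_ (DN (N m)%:R)) u -
    \int[mu]_(u in P) (pairing c s d \_ (DN (N n)%:R)) u) _ _ _ Tn bS).
    transitivity (pi * ip I (h_ m) d - pi * ip I (h_ n) d).
      by rewrite -mulrBr -(ipBl mI (sh m) (sh n) sd).
    congr (_ - _); exact: (ip_partial_synthesis _ sc ss sd).
  rewrite -(intB mP iPm iPn) -(intZl _ mP (L1B mP iPm iPn)).
  have iT := L1_patch mP (measurable_itv `[(N n)%:R, +oo[) iF.
  rewrite -(intD mP iT iS); apply: int_le; [exact: mP|by apply: L1Zl => //; exact: L1B|exact: L1D|].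
  move=> u; rewrite /= in_itv/= andbT => u0.
  have := pairing_le c s d u; have := spec_ge0 I d u; rewrite -/(F u) => p0 p1.
  have := N_nd _ _ nm; rewrite -(ler_nat R) => NN.
  rewrite !patchDN// patch_ray.
  have [um|mu_] := leP u (N m)%:R; have [un|nu] := leP u (N n)%:R.
  - by rewrite subrr mulr0 addr_ge0//; case: ifP.
  - by rewrite (ltW nu) subr0.
  - by have := lt_le_trans mu_ (le_trans un NN); rewrite ltxx.
  - by rewrite subrr mulr0 addr_ge0//; case: ifP.
have [h hsq hP] := L2_complete mI IL sh hc.
exists h => // g sg.
have c1 : pi * ip I (h_ n) g @[n --> \oo] --> \int[mu]_(u in P) pairing c s g u.
  under eq_cvg => n do rewrite /h_ (ip_partial_synthesis _ sc ss sg).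
  have iP := L1_pairing sc ss sg.
  apply: (dominated_int (g := fun u => `|pairing c s g u|)) => //.
  - by move=> n; apply: L1_meas; exact: L1_patch.
  - exact: L1_meas.
  - exact: L1_abs.
  - by move=> n u _; rewrite /patch; case: ifP => _; rewrite ?normr0.
  move=> u; rewrite /= in_itv/= andbT => u0; apply: cvg_near_cst; near=> n.
  rewrite patchT// inE /DN/= in_itv/= u0/=.
  apply: (@le_trans _ _ n%:R); first by near: n; exact: nbhs_infty_ger.
  by rewrite ler_nat leq_addl.
have c2 : pi * ip I (h_ n) g @[n --> \oo] --> pi * ip I h g.
  apply: cvgM; first exact: cvg_cst.
  have r0 : 2^-1 ^+ n * (1 + ip I g g) @[n --> \oo] --> (0 : R).
    rewrite -(mul0r (1 + ip I g g)); apply: cvgM; last exact: cvg_cst.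
    by apply: cvg_expr; rewrite ger0_norm// invf_lt1// ltr1n.
  apply/cvgrPdist_le => e e0; have /cvgrPdist_le/(_ e e0)[m _ mP'] := r0.
  exists m => // n /mP'/=; rewrite sub0r normrN; apply: le_trans.
  rewrite -(ipBl mI hsq (sh n) sg).
  apply: (@le_trans _ _ (2^-1 ^+ n * (1 + ip I g g))); last exact: ler_norm.
  set q := 2^-1 ^+ n; have q0 : 0 < q by rewrite exprn_gt0.
  have sd := sqB mI hsq (sh n).
  have qi0 : 0 < q^-1 by rewrite invr_gt0.
  have := ip_le mI sd sg qi0; have := hP n; rewrite -/q invrK.
  have q1 : q^-1 * (q ^+ 2) = q by rewrite expr2 mulrA mulVf ?gt_eqF// mul1r.
  rewrite mulrDr mulr1 => Ha; apply: alg2 => //; last by rewrite mulr_ge0 ?ip_ge0 ?(ltW q0).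
  by rewrite -[leRHS]q1 ler_wpM2l ?(ltW qi0).
by rewrite (cvg_unique _ c2 c1).
Unshelve. all: by end_near. Qed.

(** Again the pairing is tested on [h] itself, and Bessel's inequality absorbs the spectrum of
    [h]. *)
Lemma synthesis_le c s h : sq P c -> sq P s -> sq I h ->
  pi * ip I h h = \int[mu]_(u in P) pairing c s h u ->
  pi * ip I h h <= \int[mu]_(u in P) (c u ^+ 2 + s u ^+ 2).
Proof.
have alg (a b x : R) : x <= a -> 2 * a <= b + x -> a <= b by move=> *; lra.
move=> sc ss sh E; have [iS bS] := bessel mI IL L0 sh; apply: alg bS _.
have iF : L1 P (fun u => c u ^+ 2 + s u ^+ 2) by apply: L1D => //; [exact: sc.2|exact: ss.2].
have iP := L1_pairing sc ss sh.
rewrite E -(intZl _ mP iP) -(intD mP iF iS).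
apply: int_le; [exact: mP|exact: L1Zl|exact: L1D|].
by move=> u _; exact: pairing_le.
Qed.

End OnI.
End Synthesis.

(** * Subsequences with convergent transforms *)

Section WeakCompactness.
Context {R : realType}.
Notation mu := (@lebesgue_measure R).
Implicit Types (D : set R) (f g h w F c s : R -> R) (M C K B r e x u v t : R).
Local Notation P := (`[0%R, +oo[%classic : set R).

Lemma ultra_bounded_cvg (U : set_system nat) (x : nat -> R) B : UltraFilter U ->
  (forall n, `|x n| <= B) -> exists l : R, x n @[n --> U] --> l.
Proof.
move=> UU xB; have FU : ProperFilter (x @ U) by exact: fmap_proper_filter.
have [] := @segment_compact R (- B) B (x @ U) FU.
  by apply: nearW => n /=; rewrite in_itv/= -ler_norml.
move=> l [_ lcl]; exists l => A Al.
have [//|UA] := in_ultra_setVsetC (x @^-1` A) UU.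
by have [y [nAy Ay]] := lcl (~` A) A UA Al.
Qed.

(** Convergence holds simultaneously on a finite grid of [[0, N]], since a filter is closed under
    finite intersections. The mesh [1 / q] is fine enough that the common Lipschitz bound, which
    passes to the limit [c], costs at most [e / 4] for [F_ n] and again for [c]. *)
Lemma equilipschitz_cvg (U : set_system nat) (F_ : nat -> R -> R) c K (N : nat) e :
  ProperFilter U -> 0 <= K -> (forall n u v, `|F_ n u - F_ n v| <= K * `|u - v|) ->
  (forall u, F_ n u @[n --> U] --> c u) -> 0 < e ->
  U [set n | forall u, 0 <= u <= N%:R -> `|F_ n u - c u| <= e].
Proof.
move=> UU K0 Flip Fc e0.
have clip u v : `|c u - c v| <= K * `|u - v|.
  by apply: (cvgr_to_le (cvg_norm (cvgB (Fc u) (Fc v)))); apply: nearW => n; exact: Flip.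
have K1 : 0 < 4 * (K + 1) / e by rewrite divr_gt0// mulr_gt0// ltr_wpDl.
pose q := (Num.truncn (4 * (K + 1) / e)).+1.
have q0 : 0 < q%:R :> R by rewrite ltr0n.
have qK : K / q%:R <= e / 4.
  have : 4 * (K + 1) / e <= q%:R by exact/ltW/truncnS_gt.
  rewrite ler_pdivrMr// => H; rewrite ler_pdivrMr//; lra.
have near_grid : U [set n | forall i : 'I_(N * q).+1,
    `|F_ n (i%:R / q%:R) - c (i%:R / q%:R)| <= e / 4].
  apply: filter_forall => i; have e4 : 0 < e / 4 by rewrite divr_gt0.
  have /cvgrPdist_le/(_ _ e4) H := Fc (i%:R / q%:R).
  by apply: filterS H => n /=; rewrite distrC.
apply: filterS near_grid => n grid u /andP[u0 uN].
have tl : (Num.truncn (u * q%:R))%:R <= u * q%:R by rewrite truncn_le mulr_ge0 ?(ltW q0).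
have i_lt : (Num.truncn (u * q%:R) < (N * q).+1)%N.
  rewrite ltnS -(ler_nat R) natrM (le_trans tl)//.
  by rewrite ler_wpM2r// ltW.
have := grid (Ordinal i_lt); set v := _ / _ => /= gv.
have uv : `|u - v| <= q%:R^-1.
  have := truncn_itv (mulr_ge0 u0 (ltW q0)) => /andP[l1 l2].
  rewrite ger0_norm; last by rewrite subr_ge0 ler_pdivrMr.
  rewrite lerBlDr /v -[X in X + _]mul1r -mulrDl ler_pdivlMr//.
  by rewrite addrC natr1 ltW.
have Kuv : K * `|u - v| <= e / 4.
  by apply: le_trans qK; rewrite ler_wpM2l.
have -> : F_ n u - c u = (F_ n u - F_ n v) + (F_ n v - c v) - (c u - c v) by ring.
apply: (le_trans (ler_normB _ _)); have := ler_normD (F_ n u - F_ n v) (F_ n v - c v).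
have := Flip n u v; have := clip u v; rewrite -/v in gv.
by move: gv; move: `|_ - c v| `|c u - _| `|F_ n u - F_ n v| `|_ + _| => *; lra.
Qed.

Section OnI.
Variables (I : set R) (L : R).
Hypotheses (mI : measurable I) (IL : forall t, I t -> `|t| <= L) (L0 : 0 <= L).

Lemma int_abs_le f M : sq I f -> ip I f f <= M -> \int[mu]_(t in I) `|f t| <= fine (mu I) + M.
Proof.
move=> sf fM; have i1 := L1_cst_on mI IL 1; have i2 := sf.2.
have iF := L1_abs (sq_L1_bounded mI IL sf).
apply: (@le_trans _ _ (\int[mu]_(t in I) (1 + f t ^+ 2))).
  apply: int_le; [exact: mI|exact: iF|exact: L1D|].
  move=> t _; rewrite -[f t ^+ 2]real_normK ?num_real//.
  by have := sqr_ge0 (`|f t| - 1); have := normr_ge0 (f t); nra.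
by rewrite (intD mI i1 i2) int_cst// mul1r lerD2l -ip_self.
Qed.

(* Along an ultrafilter all the pointwise limits exist at once; equicontinuity makes them
   uniform on compact sets, so that a subsequence achieves them. *)
Lemma transforms_subsequence (f_ : nat -> R -> R) M : (forall n, sq I (f_ n)) ->
  (forall n, ip I (f_ n) (f_ n) <= M) ->
  exists (k : nat -> nat) (c s : R -> R), [/\ {homo k : m n / (m < n)%N}, sq P c, sq P s,
    forall u, P u -> trans cos I (f_ (k n)) u @[n --> \oo] --> c u &
    forall u, P u -> trans sin I (f_ (k n)) u @[n --> \oo] --> s u].
Proof.
move=> sf fM; have iF n := sq_L1_bounded mI IL (sf n).
pose B := fine (mu I) + M.
have fB n : \int[mu]_(t in I) `|f_ n t| <= B by exact: int_abs_le.
have B0 : 0 <= B by apply: le_trans (fB 0%N); exact: Rintegral_ge0.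
have [U [UU ooU]] := ultraFilterLemma (@eventually_filter).
have tr (tk : R -> R) : (forall x, `|tk x| <= 1) -> (forall x y, `|tk x - tk y| <= `|x - y|) ->
  exists c : R -> R, measurable_fun setT c /\ forall (N : nat) e, 0 < e ->
    U [set n | forall u, 0 <= u <= N%:R -> `|trans tk I (f_ n) u - c u| <= e].
  move=> tk1 tkl.
  have cex u : exists l : R, trans tk I (f_ n) u @[n --> U] --> l.
    apply: (ultra_bounded_cvg (B := B)) => n.
    exact: le_trans (trans_max mI tk1 tkl u (iF n)) (fB n).
  pose c u := sval (cid (cex u)); have cP u := svalP (cid (cex u)).
  have lip n u v : `|trans tk I (f_ n) u - trans tk I (f_ n) v| <= L * B * `|u - v|.
    apply: (le_trans (trans_lip mI IL tk1 tkl u v (iF n))).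
    by rewrite ler_wpM2r// ler_wpM2l.
  exists c; split; last first.
    by move=> N e; apply: equilipschitz_cvg lip cP => //; rewrite mulr_ge0.
  apply: (@lip_measurable _ _ (L * B)) => u v.
  by apply: (cvgr_to_le (cvg_norm (cvgB (cP u) (cP v)))); apply: nearW => n; exact: lip.
have [c [mc cP]] := tr cos (@cos_max R) cos_lip.
have [s [ms sP]] := tr sin (@sin_max R) sin_lip.
(* For each [j] the good indices form a set of the ultrafilter, which also contains every tail of
   the integers; so they can be picked in increasing order. *)
pose good j n := (forall u, 0 <= u <= j%:R -> `|trans cos I (f_ n) u - c u| <= j.+1%:R^-1) /\
  (forall u, 0 <= u <= j%:R -> `|trans sin I (f_ n) u - s u| <= j.+1%:R^-1).
have pick_ex j m : exists n, (m < n)%N /\ good j n.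
  have j0 : 0 < j.+1%:R^-1 :> R by [].
  have Um : U [set n | (m < n)%N] by apply: ooU; exists m.+1.
  have [n [[? ?] ?]] := filter_ex (filterI (filterI (cP j _ j0) (sP j _ j0)) Um).
  by exists n.
pose pick j m := sval (cid (pick_ex j m)).
pose k := fix k j := if j is j'.+1 then pick j (k j') else pick 0%N 0%N.
have kgood j : good j (k j).
  by case: j => [|j] /=; exact: (svalP (cid (pick_ex _ _))).2.
have kS j : (k j < k j.+1)%N by exact: (svalP (cid (pick_ex _ _))).1.
have kcvg (F_ : nat -> R -> R) (b : R -> R) :
    (forall j u, 0 <= u <= j%:R -> `|F_ (k j) u - b u| <= j.+1%:R^-1) ->
    forall u, P u -> F_ (k n) u @[n --> \oo] --> b u.
  move=> H u; rewrite /= in_itv/= andbT => u0; apply/cvgrPdist_le => e e0.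
  have /cvgrPdist_le/(_ e e0)[N _ NP] := @cvg_harmonic R.
  near=> n; rewrite distrC; apply: (@le_trans _ _ n.+1%:R^-1).
    by apply: H; rewrite u0/=; near: n; exact: nbhs_infty_ger.
  have /NP/= : (N <= n)%N by near: n; exact: nbhs_infty_ge.
  by rewrite sub0r normrN ger0_norm.
have cc := kcvg (fun n => trans cos I (f_ n)) c (fun j => (kgood j).1).
have cs := kcvg (fun n => trans sin I (f_ n)) s (fun j => (kgood j).2).
have mP : measurable P by exact: measurable_itv.
(* The spectra converge pointwise to [c^2 + s^2] with integrals bounded by Bessel, so Fatou makes
   both limits square-integrable. *)
have [iF2 _] : L1 P (fun u => c u ^+ 2 + s u ^+ 2) /\
    \int[mu]_(u in P) (c u ^+ 2 + s u ^+ 2) <= pi * M.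
  apply: (@fatou_int _ _ (fun n => spec I (f_ (k n)) (f_ (k n)))) => //.
  - by move=> n; have [] := bessel mI IL L0 (sf (k n)).
  - by apply: measurable_funTS; apply: measurable_funD; exact: measurable_funX.
  - by move=> n u _; exact: spec_ge0.
  - move=> u Pu; rewrite /spec !expr2; apply: cvgD; apply: cvgM; by [exact: cc|exact: cs].
  move=> n; have [_ H] := bessel mI IL L0 (sf (k n)); apply: (le_trans H).
  by rewrite ler_wpM2l// ltW// pi_gt0.
exists k, c, s; split => //.
- by apply: homo_ltn => //; exact: ltn_trans.
- apply: sq_bounded_by iF2 => //; first exact: measurable_funTS.
  by move=> u _; rewrite lerDl sqr_ge0.
- apply: sq_bounded_by iF2 => //; first exact: measurable_funTS.
  by move=> u _; rewrite lerDr sqr_ge0.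
Unshelve. all: by end_near. Qed.

End OnI.
End WeakCompactness.

(** * Complex-valued functions *)

Section ComplexBridge.
Context {R : realType}.
Notation mu := (@lebesgue_measure R).
Local Open Scope complex_scope.
Implicit Types (I D : set R) (M r e x u v t : R) (f g : R -> R[i]) (z w : R[i]).

Definition ref f t := complex.Re (f t).
Definition imf f t := complex.Im (f t).

Definition sqC I f := sq I (ref f) /\ sq I (imf f).
Definition nsqC I f := ip I (ref f) (ref f) + ip I (imf f) (imf f).

Lemma nsqC_ge0 I f : 0 <= nsqC I f.
Proof. by rewrite addr_ge0// ip_ge0. Qed.

Lemma L2normE I f :
  L2norm I f = ((\int[mu]_(x in I) (ref f x ^+ 2 + imf f x ^+ 2)%:E) `^ 2^-1)%E.
Proof.
rewrite /L2norm unlock; congr (_ `^ _)%E; rewrite [RHS]integral_mkcond.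
apply: eq_integral => x _; rewrite /patch; case: ifPn => _.
  rewrite normc_def /= ger0_norm ?sqrtr_ge0//.
  rewrite powR_mulrn ?sqrtr_ge0// sqr_sqrtr// addr_ge0 ?sqr_ge0//.
by rewrite /= normr0 powR0.
Qed.

Lemma sqC_inL2 I f : measurable I -> sqC I f ->
  inL2 I f /\ L2norm I f = (Num.sqrt (nsqC I f))%:E.
Proof.
move=> mI [sr si].
have iS : L1 I (fun x => ref f x ^+ 2 + imf f x ^+ 2).
  by apply: L1D => //; [exact: sr.2|exact: si.2].
have E : L2norm I f = (Num.sqrt (nsqC I f))%:E.
  rewrite L2normE (EFin_int mI iS) poweR_EFin (intD mI sr.2 si.2) -!ip_self.
  by rewrite powR12_sqrt// -/(nsqC I f) nsqC_ge0.
split => //; split; last by rewrite E ltry.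
by split; [exact: sr.1|exact: si.1].
Qed.

Lemma inL2_sqC I f : measurable I -> inL2 I f -> sqC I f.
Proof.
move=> mI [[mr mi]]; rewrite L2normE => fin.
have {}fin : (\int[mu]_(x in I) (ref f x ^+ 2 + imf f x ^+ 2)%:E < +oo)%E.
  rewrite ltey; apply/eqP => E; move: fin; rewrite E poweRyr ?invr_eq0//.
have mr2 : measurable_fun I (fun x => ref f x ^+ 2) by exact: measurable_funX.
have mi2 : measurable_fun I (fun x => imf f x ^+ 2) by exact: measurable_funX.
have iS : L1 I (fun x => ref f x ^+ 2 + imf f x ^+ 2).
  have f0 x : I x -> 0 <= ref f x ^+ 2 + imf f x ^+ 2 by rewrite addr_ge0 ?sqr_ge0.
  apply: (ge0_L1 mI (measurable_funD mr2 mi2) f0 (M := fine (\int[mu]_(x in I) (ref f x ^+ 2 + imf f x ^+ 2)%:E)%E)).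
  rewrite fineK// ge0_fin_numE//; apply: integral_ge0 => x Ix.
  by rewrite lee_fin f0.
split; apply: sq_bounded_by iS => //.
  by move=> x _; rewrite lerDl sqr_ge0.
by move=> x _; rewrite lerDr sqr_ge0.
Qed.

Lemma L2norm_le I f M : measurable I -> sqC I f -> 0 <= M ->
  (L2norm I f <= M%:E)%E = (nsqC I f <= M ^+ 2).
Proof.
move=> mI sf M0; have [_ ->] := sqC_inL2 mI sf.
by rewrite lee_fin -[in RHS](sqr_sqrtr (nsqC_ge0 I f)) ler_sqr// nnegrE sqrtr_ge0.
Qed.

Lemma L2norm_cvg0 I (f_ : nat -> R -> R[i]) : measurable I -> (forall n, sqC I (f_ n)) ->
  nsqC I (f_ n) @[n --> \oo] --> 0 <-> L2norm I (f_ n) @[n --> \oo] --> 0%E.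
Proof.
move=> mI sf; split => H.
  under eq_cvg => n do rewrite (sqC_inL2 mI (sf n)).2.
  apply: cvg_EFin; first exact: nearW.
  have c0 : Num.sqrt x @[x --> (0 : R)] --> (0 : R).
    by rewrite -[X in _ --> X](@sqrtr0 R); exact: sqrt_continuous.
  exact: (cvg_comp _ _ H c0).
have : (Num.sqrt (nsqC I (f_ n)))%:E @[n --> \oo] --> 0%E.
  by under eq_cvg => n do rewrite -(sqC_inL2 mI (sf n)).2.
move=> /fine_cvgP[_] /= c1.
rewrite (_ : (fun n => nsqC I (f_ n)) =
  fun n => Num.sqrt (nsqC I (f_ n)) * Num.sqrt (nsqC I (f_ n))).
  by rewrite -[X in _ --> X](mulr0 (0 : R)); exact: (cvgM c1 c1).
by apply/funext => n; rewrite -expr2 sqr_sqrtr// nsqC_ge0.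
Qed.

Lemma L2innerE I f g : measurable I -> sqC I f -> sqC I g ->
  L2inner I f g = (ip I (ref f) (ref g) + ip I (imf f) (imf g)) +i*
                  (ip I (imf f) (ref g) - ip I (ref f) (imf g)).
Proof.
move=> mI [sfr sfi] [sgr sgi]; rewrite /L2inner /cintegral.
rewrite /ip -(intD mI (sqM mI sfr sgr) (sqM mI sfi sgi)).
rewrite -(intB mI (sqM mI sfi sgr) (sqM mI sfr sgi)).
congr (_ +i* _); apply: eq_int => x _; rewrite /ref /imf /=;
  case: (f x) (g x) => a b [c d] /=; ring.
Qed.

Lemma cvg_complex (T : Type) (F : set_system T) (FF : Filter F) (f : T -> R[i]) (a b : R) :
  complex.Re (f x) @[x --> F] --> a -> complex.Im (f x) @[x --> F] --> b ->
  f x @[x --> F] --> (a +i* b : R[i]^o).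
Proof.
move=> ca cb; apply/(@cvgrPdist_le _ (R[i]^o)) => -[e e'] /[dup] e0.
rewrite ltcE/= => /andP[/eqP -> {}e0]; have e2 : 0 < e / 2 by rewrite divr_gt0.
move/cvgrPdist_le : ca => /(_ _ e2) ca; move/cvgrPdist_le : cb => /(_ _ e2) cb.
apply: filterS2 ca cb => x; case: (f x) => p q /= ap bq.
rewrite normc_def lecR/= -[e]ger0_norm ?(ltW e0)// -sqrtr_sqr ler_sqrt ?sqr_ge0//.
rewrite -[(a - p) ^+ 2]real_normK ?num_real// -[(b - q) ^+ 2]real_normK ?num_real//.
by have := normr_ge0 (a - p); have := normr_ge0 (b - q); nra.
Qed.

Lemma normc_ge_Re_Im z r : `|z| <= r%:C -> `|complex.Re z| <= r /\ `|complex.Im z| <= r.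
Proof.
rewrite normc_def lecR => H; split; apply: le_trans H; rewrite -sqrtr_sqr; apply: ler_wsqrtr.
  by rewrite lerDl sqr_ge0.
by rewrite lerDr sqr_ge0.
Qed.

Lemma cvg_Re_Im (T : Type) (F : set_system T) (FF : Filter F) (f : T -> R[i]) (z : R[i]) :
  f x @[x --> F] --> (z : R[i]^o) ->
  complex.Re (f x) @[x --> F] --> complex.Re z /\ complex.Im (f x) @[x --> F] --> complex.Im z.
Proof.
move=> /(@cvgrPdist_le _ (R[i]^o)) cf; split; apply/cvgrPdist_le => e e0.
  have /cf : 0 < e%:C :> R[i] by rewrite ltcR.
  apply: filterS => x /normc_ge_Re_Im[+ _].
  by case: (f x) z {cf} => a b [c d].
have /cf : 0 < e%:C :> R[i] by rewrite ltcR.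
apply: filterS => x /normc_ge_Re_Im[_].
by case: (f x) z {cf} => a b [c d].
Qed.

End ComplexBridge.

(** * Fourier multipliers *)

Section Multiplier.
Context {R : realType}.
Notation mu := (@lebesgue_measure R).
Implicit Types (D : set R) (f g h w F c s : R -> R) (M C K r e x u v t : R).
Local Notation P := (`[0%R, +oo[%classic : set R).

Let mP : measurable P. Proof. exact: measurable_itv. Qed.

Lemma ip0_ae D f : measurable D -> sq D f -> ip D f f <= 0 ->
  {ae mu, forall x, D x -> f x = 0}.
Proof.
move=> mD [mf f2] f0.
have m2 : measurable_fun D (fun x => f x ^+ 2) by exact: measurable_funX.
have /(@ae_eq_integral_abs _ _ _ mu D mD (EFin \o (fun x => f x ^+ 2))) :
    (\int[mu]_(x in D) `|(f x ^+ 2)%:E| = 0)%E.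
  under eq_integral => x _ do rewrite abse_EFin ger0_norm ?sqr_ge0//.
  rewrite (EFin_int mD f2) -ip_self; congr EFin; apply/eqP.
  by rewrite eq_le f0 ip_ge0.
move=> /(_ _)[|N [mN N0 NP]]; first exact/measurable_EFinP.
exists N; split => //; apply: subset_trans NP => x /= H1 H2; apply: H1 => Dx.
by have := H2 Dx; case => /eqP; rewrite sqrf_eq0 => /eqP.
Qed.

Section OnI.
Variables (I : set R) (L : R).
Hypotheses (mI : measurable I) (IL : forall t, I t -> `|t| <= L) (L0 : 0 <= L).
Variables (b : R -> R) (B : R).
Hypotheses (mb : measurable_fun P b) (bB : forall u, P u -> `|b u| <= B).

Lemma sq_trans f : sq I f -> sq P (trans cos I f) /\ sq P (trans sin I f).
Proof.
move=> sf; have iF := sq_L1_bounded mI IL sf; have [iS _] := bessel mI IL L0 sf.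
split; apply: sq_bounded_by iS => //.
- exact: (measurable_trans mI IL (@cos_max R) cos_lip).
- by move=> u _; rewrite /spec -!expr2 lerDl sqr_ge0.
- exact: (measurable_trans mI IL (@sin_max R) sin_lip).
- by move=> u _; rewrite /spec -!expr2 lerDr sqr_ge0.
Qed.

(* Adjoint of the Fourier transform, characterized weakly; [synthP] shows that the junk
   value [0] does not occur for square-integrable [c] and [s]. *)
Definition synth c s : R -> R :=
  xget 0 [set h | sq I h /\
    forall g, sq I g -> pi * ip I h g = \int[mu]_(u in P) pairing I c s g u].

Lemma synthP c s : sq P c -> sq P s -> sq I (synth c s) /\
  forall g, sq I g -> pi * ip I (synth c s) g = \int[mu]_(u in P) pairing I c s g u.
Proof.
move=> sc ss; have [h sh hP] := synthesis_exists mI IL L0 sc ss.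
by apply: (@xgetPex _ 0 [set h | sq I h /\ forall g, sq I g ->
  pi * ip I h g = \int[mu]_(u in P) pairing I c s g u]); exists h.
Qed.

Lemma sq_mul_b c : sq P c -> sq P (fun u => b u * c u).
Proof. by move=> sc; exact: sq_mul_bounded bB. Qed.

(** The Fourier multiplier with symbol [b], compressed to [I]: transform, multiply by [b], apply the
    adjoint. *)
Definition multiplier f := synth (fun u => b u * trans cos I f u) (fun u => b u * trans sin I f u).

Lemma multiplierP f : sq I f -> sq I (multiplier f) /\
  forall g, sq I g -> pi * ip I (multiplier f) g = \int[mu]_(u in P) (b u * spec I f g u).
Proof.
move=> sf; have [sc ss] := sq_trans sf.
have [sh hP] := synthP (sq_mul_b sc) (sq_mul_b ss).
split => // g sg; rewrite hP//; apply: eq_int => u _.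
by rewrite /pairing /spec mulrDr !mulrA.
Qed.

Lemma L1_mul_b_spec f g : sq I f -> sq I g -> L1 P (fun u => b u * spec I f g u).
Proof.
move=> sf sg; have iS := L1_spec mI IL L0 sf sg.
by apply: L1_eq (L1_mul_bounded mP iS mb bB) => // u _; rewrite mulrC.
Qed.

Lemma B_ge0 : 0 <= B.
Proof. by apply: le_trans (bB (u := 0) _) => //; rewrite /= in_itv/= lexx. Qed.

Lemma multiplier_le f : sq I f -> ip I (multiplier f) (multiplier f) <= B ^+ 2 * ip I f f.
Proof.
move=> sf; have [sc ss] := sq_trans sf.
have [sh hP] := synthP (sq_mul_b sc) (sq_mul_b ss).
have [iS bS] := bessel mI IL L0 sf.
have := synthesis_le mI IL L0 (sq_mul_b sc) (sq_mul_b ss) sh (hP _ sh).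
rewrite -/(multiplier f) => H.
rewrite -(ler_pM2l (pi_gt0 R)) mulrCA; apply: (le_trans H).
apply: (@le_trans _ _ (B ^+ 2 * \int[mu]_(u in P) spec I f f u)); last first.
  by rewrite ler_wpM2l ?sqr_ge0.
rewrite -(intZl _ mP iS); apply: int_le; [exact: mP| |exact: L1Zl|].
  by apply: L1D => //; [exact: (sq_mul_b sc).2|exact: (sq_mul_b ss).2].
move=> u Pu; rewrite !exprMn -mulrDr /spec -!expr2 ler_wpM2r ?addr_ge0 ?sqr_ge0//.
rewrite -[b u ^+ 2]real_normK ?num_real// lerXn2r ?nnegrE ?bB//; exact: B_ge0.
Qed.

(** [synth] chooses a representative, so linearity can hold only almost everywhere. The two sides
    have equal inner products with every square-integrable function, hence their difference is
    orthogonal to itself. *)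
Lemma multiplier_linear f g r v :  sq I f -> sq I g ->
  {ae mu, forall x, I x -> multiplier (fun t => r * f t + v * g t) x =
    r * multiplier f x + v * multiplier g x}.
Proof.
have alg (x y z : R) : pi * (x - (r * y + v * z)) = pi * x - (r * (pi * y) + v * (pi * z)) by ring.
move=> sf sg; have srf := sqZ r mI sf; have svg := sqZ v mI sg.
have iF := sq_L1_bounded mI IL sf; have ig := sq_L1_bounded mI IL sg.
have sfg := sqD mI srf svg.
have [s1 H1] := multiplierP sfg; have [s2 H2] := multiplierP sf; have [s3 H3] := multiplierP sg.
move: (multiplier _) (multiplier f) (multiplier g) s1 H1 s2 H2 s3 H3.
move=> m1 m2 m3 s1 H1 s2 H2 s3 H3.
have s4 := sqD mI (sqZ r mI s2) (sqZ v mI s3).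
have s5 := sqB mI s1 s4.
have key k : sq I k -> ip I (fun x => m1 x - (r * m2 x + v * m3 x)) k = 0.
  move=> sk; have i2 := L1_mul_b_spec sf sk; have i3 := L1_mul_b_spec sg sk.
  have p0 : pi != 0 :> R by rewrite gt_eqF ?pi_gt0.
  apply: (mulfI p0); rewrite mulr0 (ipBl mI s1 s4 sk) (ipDl mI (sqZ r mI s2) (sqZ v mI s3) sk).
  rewrite (ipZl r mI s2 sk) (ipZl v mI s3 sk) alg.
  rewrite (H1 _ sk) (H2 _ sk) (H3 _ sk) -(intZl r mP i2) -(intZl v mP i3).
  rewrite -(intD mP (L1Zl r mP i2) (L1Zl v mP i3)); apply/eqP; rewrite subr_eq0; apply/eqP.
  apply: eq_int => u _; rewrite (specDZl mI _ _ _ (L1Zl r mI iF) ig).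
  have -> : spec I (fun t => r * f t) k u = r * spec I f k u.
    have i0 := L1_cst_on mI IL 0.
    have := specDZl mI k r u i0 iF.
    have -> : (fun t => 0 + r * f t) = (fun t => r * f t) by apply/funext => t; rewrite add0r.
    have -> : spec I (fun=> 0) k u = 0.
      rewrite /spec /trans; under eq_int => t _ do rewrite mul0r.
      under [X in _ + X * _]eq_int => t _ do rewrite mul0r.
      by rewrite int_cst// !mul0r addr0.
    by rewrite add0r.
  by ring.
have := ip0_ae mI s5; rewrite key// => /(_ (lexx _)).
move=> [N [mN N0 NP]]; exists N; split => //.
apply: subset_trans NP => x /= H Hx; apply: H => Ix.
by apply/eqP; rewrite -subr_eq0; apply/eqP; exact: Hx.
Qed.

Hypothesis b0 : b u @[u --> +oo] --> 0.

(** The difference is itself synthesized, from [b] times the differences of the transforms, so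
    [synthesis_le] bounds pi times its square norm by the integral of [b^2] times [E n]. Up to
    frequency [N] dominated convergence applies; beyond it [b^2] is small while [E n] has integral
    at most [K2]. *)
Lemma multiplier_cvg (f_ : nat -> R -> R) M c s : (forall n, sq I (f_ n)) ->
  (forall n, ip I (f_ n) (f_ n) <= M) -> sq P c -> sq P s ->
  (forall u, P u -> trans cos I (f_ n) u @[n --> \oo] --> c u) ->
  (forall u, P u -> trans sin I (f_ n) u @[n --> \oo] --> s u) ->
  let h := synth (fun u => b u * c u) (fun u => b u * s u) in
  ip I (fun t => multiplier (f_ n) t - h t) (fun t => multiplier (f_ n) t - h t)
    @[n --> \oo] --> 0.
Proof.
move=> sf fM sc ss cc cs h.
have [sh hP] : sq I h /\ forall g, sq I g -> pi * ip I h g =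
    \int[mu]_(u in P) pairing I (fun u => b u * c u) (fun u => b u * s u) g u.
  exact: synthP (sq_mul_b sc) (sq_mul_b ss).
clearbody h; have bound n := int_abs_le mI IL (sf n) (fM n); pose K := fine (mu I) + M.
have iF n := sq_L1_bounded mI IL (sf n).
pose E n u := (trans cos I (f_ n) u - c u) ^+ 2 + (trans sin I (f_ n) u - s u) ^+ 2.
have E_ge0 n u : 0 <= E n u by rewrite addr_ge0 ?sqr_ge0.
have sdc n : sq P (fun u => trans cos I (f_ n) u - c u) by apply: sqB => //; exact: (sq_trans (sf n)).1.
have sds n : sq P (fun u => trans sin I (f_ n) u - s u) by apply: sqB => //; exact: (sq_trans (sf n)).2.
have iE n : L1 P (E n) by apply: L1D => //; [exact: (sdc n).2|exact: (sds n).2].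
have i2 : L1 P (fun u => c u ^+ 2 + s u ^+ 2) by apply: L1D => //; [exact: sc.2|exact: ss.2].
pose K2 := 2 * (pi * M) + 2 * \int[mu]_(u in P) (c u ^+ 2 + s u ^+ 2).
have EK n : \int[mu]_(u in P) E n u <= K2.
  have [iS bS] := bessel mI IL L0 (sf n).
  apply: (@le_trans _ _ (2 * \int[mu]_(u in P) spec I (f_ n) (f_ n) u +
      2 * \int[mu]_(u in P) (c u ^+ 2 + s u ^+ 2))); last first.
    by rewrite lerD2r ler_wpM2l// (le_trans bS)// ler_wpM2l ?fM// ltW// pi_gt0.
  rewrite -(intZl 2 mP iS) -(intZl 2 mP i2) -(intD mP (L1Zl 2 mP iS) (L1Zl 2 mP i2)).
  apply: int_le; [exact: mP|exact: iE|by apply: L1D => //; exact: L1Zl|].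
  move=> u _; rewrite /E /spec.
  move: (trans cos _ _ _) (trans sin _ _ _) (c u) (s u) => p q x y.
  by have := sqr_ge0 (p + x); have := sqr_ge0 (q + y); nra.
have ip_le_E n : pi * ip I (fun t => multiplier (f_ n) t - h t) (fun t => multiplier (f_ n) t - h t) <=
    \int[mu]_(u in P) (b u ^+ 2 * E n u).
  have [sm mP'] := multiplierP (sf n); move: (multiplier (f_ n)) sm mP' => m sm mP'.
  have sd := sqB mI sm sh.
  have sbc := sq_mul_b (sdc n); have sbs := sq_mul_b (sds n).
  have := synthesis_le mI IL L0 sbc sbs sd.
  have -> : \int[mu]_(u in P) ((b u * (trans cos I (f_ n) u - c u)) ^+ 2 +
      (b u * (trans sin I (f_ n) u - s u)) ^+ 2) = \int[mu]_(u in P) (b u ^+ 2 * E n u).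
    by apply: eq_int => u _; rewrite !exprMn -mulrDr.
  apply; rewrite (ipBl mI sm sh sd) mulrBr (mP' _ sd) (hP _ sd).
  rewrite -(intB mP (L1_mul_b_spec (sf n) sd) (L1_pairing mI IL L0 (sq_mul_b sc) (sq_mul_b ss) sd)).
  by apply: eq_int => u _; rewrite /spec /pairing; ring.
have c1 (N : R) : \int[mu]_(u in P) (E n \_ `[0, N]) u @[n --> \oo] --> 0.
  have mN : measurable (`[0, N]%classic : set R) by exact: measurable_itv.
  have NP : (`[0, N]%classic : set R) `<=` P by move=> t /=; rewrite !in_itv/= andbT => /andP[].
  have eqN n : \int[mu]_(u in P) (E n \_ `[0, N]) u = \int[mu]_(u in `[0, N]) E n u.
    by rewrite -(Rintegral_mkcondr mu) (setIidr NP).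
  under eq_cvg => n do rewrite eqN.
  suff : \int[mu]_(u in `[0, N]) E n u @[n --> \oo] --> \int[mu]_(u in `[0, N]) 0.
    by rewrite int_cst// mul0r.
  have cK u : P u -> `|c u| <= K.
    move=> Pu; apply: (cvgr_to_le (cvg_norm (cc u Pu))); apply: nearW => n.
    exact: le_trans (trans_max mI (@cos_max R) cos_lip u (iF n)) (bound n).
  have sK u : P u -> `|s u| <= K.
    move=> Pu; apply: (cvgr_to_le (cvg_norm (cs u Pu))); apply: nearW => n.
    exact: le_trans (trans_max mI (@sin_max R) sin_lip u (iF n)) (bound n).
  have NL t : (`[0, N]%classic : set R) t -> `|t| <= N.
    by rewrite /= in_itv/= => /andP[t0 tN]; rewrite ger0_norm.
  apply: (dominated_int (g := fun=> 8 * K ^+ 2)) => //.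
  - by move=> n; apply: L1_meas; exact: (L1_S _ _ NP (iE n)).
  - exact: (L1_cst_on mN NL).
  - move=> n u /NP Pu; rewrite ger0_norm//.
    have H (p q : R) : `|p| <= K -> `|q| <= K -> (p - q) ^+ 2 <= 4 * K ^+ 2.
      move=> pK qK; rewrite -[_ ^+ 2]real_normK ?num_real//.
      have pq := le_trans (ler_normB p q) (lerD pK qK).
      have := normr_ge0 (p - q); nra.
    have -> : 8 * K ^+ 2 = 4 * K ^+ 2 + 4 * K ^+ 2 by ring.
    apply: lerD; apply: H; rewrite ?cK ?sK//.
      exact: le_trans (trans_max mI (@cos_max R) cos_lip u (iF n)) (bound n).
    exact: le_trans (trans_max mI (@sin_max R) sin_lip u (iF n)) (bound n).
  - move=> u /NP Pu; rewrite /E.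
    have -> : 0 = (c u - c u) * (c u - c u) + (s u - s u) * (s u - s u) by rewrite !subrr mul0r addr0.
    under eq_cvg => n do rewrite !expr2.
    by apply: cvgD; apply: cvgM; apply: cvgB; [exact: cc|exact: cvg_cst|exact: cc|exact: cvg_cst
      |exact: cs|exact: cvg_cst|exact: cs|exact: cvg_cst].
have K20 : 0 <= K2 by apply: le_trans (EK 0%N); exact: Rintegral_ge0.
apply/cvgrPdist_le => e e0.
(* High frequencies contribute at most [e1 * K2] and low ones at most [B ^+ 2] times the integral
   over [[0, N]]; each is kept below [pi * e / 2]. The added 1 covers a zero [K2]. *)
pose e1 := pi * e / (2 * (K2 + 1)); have e10 : 0 < e1.
  by rewrite divr_gt0 ?mulr_gt0 ?pi_gt0 ?ltr_wpDl.
have [N [N0 bN]] : exists N : R, 0 <= N /\ forall u, N < u -> b u ^+ 2 <= e1.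
  have c2 : b u ^+ 2 @[u --> +oo] --> 0.
    rewrite -(mulr0 (0 : R)); under eq_cvg => n do rewrite expr2.
    exact: (cvgM b0 b0).
  have /cvgrPdist_le/(_ _ e10)[N [_ NP]] := c2.
  exists (Num.max N 0); split; first by rewrite le_max lexx orbT.
  move=> u; rewrite gt_max => /andP[Nu _]; have := NP u Nu.
  by rewrite /= sub0r normrN; apply: le_trans; exact: ler_norm.
have e20 : 0 < pi * e / (2 * (B ^+ 2 + 1)).
  by rewrite divr_gt0 ?mulr_gt0 ?pi_gt0 ?ltr_wpDl ?sqr_ge0.
have /cvgrPdist_le/(_ _ e20)[n0 _ n0P] := c1 N.
exists n0 => // n /n0P/=; rewrite !sub0r !normrN => H.
rewrite ger0_norm ?ip_ge0// -(ler_pM2l (pi_gt0 R)); apply: (le_trans (ip_le_E n)).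
have iEN : L1 P (E n \_ `[0, N]) by apply: L1_patch.
have iBE : L1 P (fun u => b u ^+ 2 * E n u).
  have := L1D mP (sq_mul_b (sdc n)).2 (sq_mul_b (sds n)).2.
  by apply: L1_eq => // u _; rewrite !exprMn -mulrDr.
apply: (@le_trans _ _ (B ^+ 2 * \int[mu]_(u in P) (E n \_ `[0, N]) u + e1 * \int[mu]_(u in P) E n u)).
  rewrite -(intZl _ mP iEN) -(intZl _ mP (iE n)) -(intD mP (L1Zl _ mP iEN) (L1Zl _ mP (iE n))).
  apply: int_le; [exact: mP|exact: iBE|by apply: L1D => //; exact: L1Zl|].
  move=> u /[dup] Pu; rewrite /= in_itv/= andbT => u0.
  have bB2 : b u ^+ 2 <= B ^+ 2.
    by rewrite -[b u ^+ 2]real_normK ?num_real// lerXn2r ?nnegrE ?bB// B_ge0.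
  rewrite /patch; case: ifPn; rewrite ?notin_setE ?inE/= in_itv/= u0/= => uN.
    by rewrite -[leLHS]addr0 lerD ?ler_wpM2r// mulr_ge0// ltW.
  by rewrite mulr0 add0r ler_wpM2r// bN// ltNge; apply/negP.
have -> : pi * e = pi * e / 2 + pi * e / 2 by exact: splitr.
have pe0 : 0 <= pi * e by rewrite mulr_ge0 ?ltW ?pi_gt0.
apply: lerD.
  apply: (@le_trans _ _ (B ^+ 2 * (pi * e / (2 * (B ^+ 2 + 1))))).
    by rewrite ler_wpM2l ?sqr_ge0// (le_trans _ H)// ler_norm.
  rewrite (_ : B ^+ 2 * _ = pi * e / 2 * (B ^+ 2 / (B ^+ 2 + 1))); last first.
    by field; rewrite gt_eqF// ltr_wpDl ?sqr_ge0.
  by rewrite ler_piMr ?divr_ge0// ler_pdivrMr ?ltr_wpDl ?sqr_ge0// mul1r lerDl.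
apply: (@le_trans _ _ (e1 * K2)); first by rewrite ler_wpM2l ?EK// ltW.
rewrite /e1 (_ : _ * K2 = pi * e / 2 * (K2 / (K2 + 1))); last first.
  by field; rewrite gt_eqF// ltr_wpDl.
by rewrite ler_piMr ?divr_ge0// ler_pdivrMr ?ltr_wpDl// mul1r lerDl.
Qed.

End OnI.
End Multiplier.

(** * The quadratic form of the convolution operator *)

Section LaplaceKernel.
Context {R : realType}.
Notation mu := (@lebesgue_measure R).
Local Open Scope complex_scope.
Local Notation P := (`[0%R, +oo[%classic : set R).

Let mP : measurable P. Proof. exact: measurable_itv. Qed.

Variable S : R -> R.
Hypothesis S_laplace : forall s : R[i], 1 < complex.Re s ->
  cintegrable `[0, +oo[ (laplace_integrand S s).

Definition density_ratio (u : R) := S (expR u) / expR u.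
Local Notation a := density_ratio.

Definition abel_weight (e u : R) := expR (- (u * e)) * a u.

(** The abscissa 1 contributes [exp(-u)], which turns [S(e^u)] into the ratio; only the Abel factor
    and the oscillation remain. *)
Lemma Re_laplace_integrand e x u :
  complex.Re (laplace_integrand S ((1 + e) +i* x) u) = abel_weight e u * cos (u * x).
Proof.
rewrite /laplace_integrand /cexp /abel_weight /density_ratio /=.
rewrite -expRN mulrA -[_ * S _ * _]mulrA [_ * (S _ * _)]mulrCA -expRD.
have -> : - (u * e) + - u = - ((1 + e) * u - x * 0) by ring.
have -> : - ((1 + e) * 0 + x * u) = - (u * x) by ring.
by rewrite cosN; ring.
Qed.

Lemma L1_abel_weight e : 0 < e -> L1 P (abel_weight e).
Proof.
move=> e0; have /S_laplace[+ _] : 1 < complex.Re ((1 + e) +i* (0 : R)) by rewrite /= ltrDl.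
rewrite -L1E; apply: L1_eq => // u _.
by have := Re_laplace_integrand e 0 u; rewrite mulr0 cos0 mulr1.
Qed.

Lemma measurable_ratio : measurable_fun P a.
Proof.
have m1 := L1_meas (L1_abel_weight ltr01).
have m2 : measurable_fun P (expR : R -> R) by apply: measurable_funTS; exact: measurable_expR.
apply: eq_measurable_fun (measurable_funM m1 m2) => u _.
by rewrite /abel_weight /= mulr1 mulrAC -expRD addNr expR0 mul1r.
Qed.

Lemma Re_laplace e x :
  complex.Re (laplace S ((1 + e) +i* x)) = \int[mu]_(u in P) (abel_weight e u * cos (u * x)).
Proof. by apply: eq_int => u _; exact: Re_laplace_integrand. Qed.

Section OnI.
Variables (I : set R) (L : R).
Hypotheses (mI : measurable I) (IL : forall t, I t -> `|t| <= L) (L0 : 0 <= L).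

Definition W_real e (f : R -> R) (t : R) :=
  pi^-1 * \int[mu]_(s in I) (f s * \int[mu]_(u in P) (abel_weight e u * cos (u * (t - s)))).

(** The kernel is real, so the complex operator is one real operator acting on both components. *)
Lemma W_eps_Re_Im e (F : R -> R[i]) t : 0 < e -> sqC I F ->
  complex.Re (W_eps S I e F t) = W_real e (ref F) t /\
  complex.Im (W_eps S I e F t) = W_real e (imf F) t.
Proof.
move=> e0 [sr si]; rewrite /W_eps /cintegral /W_real /=; split.
  rewrite mul0r subr0; congr (_ * _); apply: eq_int => s _.
  by rewrite -Re_laplace /ref /=; case: (F s) => p q /=; rewrite mulr0 subr0.
rewrite mul0r addr0; congr (_ * _); apply: eq_int => s _.
by rewrite -Re_laplace /imf /=; case: (F s) => p q /=; rewrite mulr0 add0r.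
Qed.

Lemma sq_W_real e f : 0 < e -> sq I f -> sq I (W_real e f).
Proof.
move=> e0 sf; have iF := sq_L1_bounded mI IL sf; have iw := L1_abel_weight e0.
have mK : measurable_fun setT (fun p : R * R => cos (p.2 * p.1)).
  by apply: measurable_cos_prod; [exact: measurable_snd|exact: measurable_fst].
have mS : measurable_fun setT (fun p : R * R => sin (p.2 * p.1)).
  by apply: measurable_sin_prod; [exact: measurable_snd|exact: measurable_fst].
have iwc := L1_mul_trans mI IL (@cos_max R) cos_lip mP iw iF.
have iws := L1_mul_trans mI IL (@sin_max R) sin_lip mP iw iF.
have E t : W_real e f t = pi^-1 *
    (\int[mu]_(u in P) (abel_weight e u * trans cos I f u * cos (u * t)) +
     \int[mu]_(u in P) (abel_weight e u * trans sin I f u * sin (u * t))).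
  by rewrite /W_real (kernel_transform mI IL).
have i1 := L1_cst_on mI IL 1.
have m1 := L1_meas (L1_fubini mI mP i1 iwc mK (fun p => @cos_max R _)).
have m2 := L1_meas (L1_fubini mI mP i1 iws mS (fun p => @sin_max R _)).
have mW : measurable_fun I (W_real e f).
  have m0 : measurable_fun I (fun=> pi^-1 : R) by exact: measurable_cst.
  apply: eq_measurable_fun (measurable_funM m0 (measurable_funD m1 m2)) => t _.
  by rewrite E /= !mul1r.
pose K := pi^-1 * (\int[mu]_(u in P) `|abel_weight e u * trans cos I f u| +
  \int[mu]_(u in P) `|abel_weight e u * trans sin I f u|).
have mct t : measurable_fun P (fun u => cos (u * t)).
  rewrite (_ : (fun u => cos (u * t)) = (fun u => cos (t * u))); first exact: (measurable_ku cos_lip).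
  by apply/funext => u; rewrite mulrC.
have mst t : measurable_fun P (fun u => sin (u * t)).
  rewrite (_ : (fun u => sin (u * t)) = (fun u => sin (t * u))); first exact: (measurable_ku sin_lip).
  by apply/funext => u; rewrite mulrC.
have bK t : `|W_real e f t| <= K.
  rewrite E normrM ger0_norm ?invr_ge0 ?(ltW (pi_gt0 R))//.
  rewrite ler_wpM2l ?invr_ge0 ?(ltW (pi_gt0 R))//; apply: (le_trans (ler_normD _ _)).
  apply: lerD; apply: int_norm_le; rewrite ?mulr1//; try exact: L1_abs.
  - exact: measurable_funM (L1_meas iwc) (mct t).
  - by move=> u _; rewrite normrM ler_piMr// cos_max.
  - exact: measurable_funM (L1_meas iws) (mst t).
  - by move=> u _; rewrite normrM ler_piMr// sin_max.
apply: (@sq_bounded_by _ _ _ (fun=> K ^+ 2)) => //; last exact: (L1_cst_on mI IL).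
move=> t _; rewrite -[_ ^+ 2]real_normK ?num_real// lerXn2r ?nnegrE//.
exact: le_trans (bK t).
Qed.

Definition abel_form e f g := pi^-1 * \int[mu]_(u in P) (abel_weight e u * spec I f g u).

Lemma ip_W_real e f g : 0 < e -> sq I f -> sq I g -> ip I (W_real e f) g = abel_form e f g.
Proof.
move=> e0 sf sg; have iF := sq_L1_bounded mI IL sf; have ig := sq_L1_bounded mI IL sg.
have iw := L1_abel_weight e0.
rewrite /abel_form -(kernel_spec mI IL mP iw iF ig).
rewrite -(intZl pi^-1 mI); last first.
  have := sqM mI sg (sqZ pi mI (sq_W_real e0 sf)).
  apply: L1_eq => // t _; rewrite /W_real; congr (_ * _).
  by rewrite mulrA mulfV ?mul1r// gt_eqF ?pi_gt0.
by apply: eq_int => t _; rewrite /W_real; ring.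
Qed.

Lemma L2inner_W_eps e F G : 0 < e -> sqC I F -> sqC I G ->
  sqC I (W_eps S I e F) /\ L2inner I (W_eps S I e F) G =
  (abel_form e (ref F) (ref G) + abel_form e (imf F) (imf G)) +i*
  (abel_form e (imf F) (ref G) - abel_form e (ref F) (imf G)).
Proof.
move=> e0 sF sG; have [sr si] := sF; have [gr gi] := sG.
have ER : ref (W_eps S I e F) = W_real e (ref F).
  by apply/funext => t; have [] := W_eps_Re_Im t e0 sF.
have EI : imf (W_eps S I e F) = W_real e (imf F).
  by apply/funext => t; have [] := W_eps_Re_Im t e0 sF.
have sW : sqC I (W_eps S I e F).
  by split; rewrite ?ER ?EI; exact: sq_W_real.
split => //; rewrite L2innerE// ER EI.
by rewrite !ip_W_real.
Qed.

End OnI.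
End LaplaceKernel.

(** * Compactness of multipliers vanishing at infinity *)

Section Sufficiency.
Context {R : realType}.
Notation mu := (@lebesgue_measure R).
Local Open Scope complex_scope.
Local Notation P := (`[0%R, +oo[%classic : set R).

Let mP : measurable P. Proof. exact: measurable_itv. Qed.

Lemma ae_imply2 (P1 P2 Q : R -> Prop) : {ae mu, forall x, P1 x} -> {ae mu, forall x, P2 x} ->
  (forall x, P1 x -> P2 x -> Q x) -> {ae mu, forall x, Q x}.
Proof.
move=> [N1 [m1 N10 H1]] [N2 [m2 N20 H2]] PQ; exists (N1 `|` N2); split.
- exact: measurableU.
- exact: (etrans (@measureU0 _ _ _ mu N1 N2 m1 m2 N20) N10).
move=> x /= nQ; have [p1|/H1] := pselect (P1 x); last by left.
have [p2|/H2] := pselect (P2 x); last by right.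
by case: nQ; exact: PQ.
Qed.

Lemma homo_ltn_cvg (k : nat -> nat) : {homo k : m n / (m < n)%N} -> k n @[n --> \oo] --> \oo.
Proof.
move=> k_lt A [N _ NA]; exists N => // n /= Nn; apply: NA => /=; apply: leq_trans Nn _.
by elim: n => // n IH; apply: leq_ltn_trans IH _; exact: k_lt.
Qed.

Section Operators.
Variables (I : set R) (L : R).
Hypotheses (mI : measurable I) (IL : forall t, I t -> `|t| <= L) (L0 : 0 <= L).
Variables (b : R -> R) (B : R).
Hypotheses (mb : measurable_fun P b) (bB : forall u, P u -> `|b u| <= B).

Definition multC (F : R -> R[i]) (t : R) : R[i] :=
  multiplier I b (ref F) t +i* multiplier I b (imf F) t.

Lemma sqC_multC F : sqC I F -> sqC I (multC F).
Proof.
move=> [sr si]; split.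
  exact: (multiplierP mI IL L0 mb bB sr).1.
exact: (multiplierP mI IL L0 mb bB si).1.
Qed.

Lemma nsqC_multC F : sqC I F -> nsqC I (multC F) <= B ^+ 2 * nsqC I F.
Proof.
move=> [sr si]; rewrite /nsqC mulrDr; apply: lerD.
  exact: (multiplier_le mI IL L0 mb bB sr).
exact: (multiplier_le mI IL L0 mb bB si).
Qed.

Lemma nsqC_L2norm_le F G (M : R) : 0 <= M -> sqC I F -> sqC I G -> nsqC I F <= M ^+ 2 * nsqC I G ->
  (L2norm I F <= M%:E * L2norm I G)%E.
Proof.
move=> M0 sF sG H; rewrite (sqC_inL2 mI sF).2 (sqC_inL2 mI sG).2 -EFinM lee_fin.
apply: (le_trans (ler_wsqrtr H)); rewrite sqrtrM ?sqr_ge0// sqrtr_sqr ger0_norm//.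
Qed.

Lemma sqC_lin (z : R[i]) F G : sqC I F -> sqC I G -> sqC I (fun x => z * F x + G x).
Proof.
case: z => p q [fr fi] [gr gi]; split.
  have := sqD mI (sqB mI (sqZ p mI fr) (sqZ q mI fi)) gr.
  by apply: sq_eq => // x _; rewrite /ref /imf; case: (F x) (G x) => x1 x2 [y1 y2].
have := sqD mI (sqD mI (sqZ p mI fi) (sqZ q mI fr)) gi.
by apply: sq_eq => // x _; rewrite /ref /imf; case: (F x) (G x) => x1 x2 [y1 y2].
Qed.

Lemma multC_linear (z : R[i]) F G : sqC I F -> sqC I G ->
  L2eq I (multC (fun x => z * F x + G x)) (fun x => z * multC F x + multC G x).
Proof.
case: z => p q [fr fi] [gr gi].
have lin3 f g h r v : sq I f -> sq I g -> sq I h ->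
    {ae mu, forall x, I x -> multiplier I b (fun t => r * f t + v * g t + h t) x =
      r * multiplier I b f x + v * multiplier I b g x + multiplier I b h x}.
  move=> sf sg sh; have sfg := sqD mI (sqZ r mI sf) (sqZ v mI sg).
  have H1 := multiplier_linear mI IL L0 mb bB r v sf sg.
  have H2 := multiplier_linear mI IL L0 mb bB 1 1 sfg sh.
  apply: ae_imply2 H1 H2 _ => x H1 H2 Ix.
  rewrite (_ : (fun t => r * f t + v * g t + h t) =
    (fun t => 1 * (r * f t + v * g t) + 1 * h t)); last by apply/funext => t; rewrite !mul1r.
  by rewrite (H2 Ix) (H1 Ix) !mul1r.
have ER : ref (fun x => (p +i* q) * F x + G x) =
    (fun t => p * ref F t + - q * imf F t + ref G t).
  by apply/funext => t; rewrite /ref /imf; case: (F t) (G t) => x1 x2 [y1 y2] /=; rewrite mulNr.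
have EI : imf (fun x => (p +i* q) * F x + G x) =
    (fun t => p * imf F t + q * ref F t + imf G t).
  by apply/funext => t; rewrite /ref /imf; case: (F t) (G t) => x1 x2 [y1 y2].
have H1 := lin3 _ _ _ p (- q) fr fi gr; have H2 := lin3 _ _ _ p q fi fr gi.
apply: ae_imply2 H1 H2 _ => x H1 H2 Ix.
rewrite /multC ER EI (H1 Ix) (H2 Ix).
move: (multiplier I b (ref F) x) (multiplier I b (imf F) x) => m1 m2.
move: (multiplier I b (ref G) x) (multiplier I b (imf G) x) => m3 m4.
by congr (_ +i* _); ring.
Qed.

Lemma bounded_multC : bounded_operator I multC.
Proof.
split.
- by move=> F /(inL2_sqC mI) sF; exact: (sqC_inL2 mI (sqC_multC sF)).1.
- by move=> z F G /(inL2_sqC mI) sF /(inL2_sqC mI) sG; exact: multC_linear.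
exists B => F /(inL2_sqC mI) sF.
apply: nsqC_L2norm_le => //; [exact: B_ge0 bB|exact: sqC_multC|exact: nsqC_multC].
Qed.

Lemma bounded_scalar_plus (c : R) T : bounded_operator I T ->
  bounded_operator I (fun F t => c%:C * F t + T F t).
Proof.
move=> [T1 T2 [M TM]]; split.
- move=> F iF; have sF := inL2_sqC mI iF; have sT := inL2_sqC mI (T1 F iF).
  by have := sqC_lin c%:C sF sT => /(sqC_inL2 mI)[].
- move=> z F G iF iG; have [N [mN N0 NP]] := T2 z F G iF iG; exists N; split => //.
  apply: subset_trans NP => x /= H Hx; apply: H => Ix.
  by rewrite Hx//; ring.
(* The absolute value is taken because the bound [M] of a bounded operator carries no sign
   condition. *)
pose K := 2 * c ^+ 2 + 2 * (`|M|) ^+ 2.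
have K0 : 0 <= K by apply: addr_ge0; apply: mulr_ge0 => //; exact: sqr_ge0.
exists (Num.sqrt K) => F iF; have sF := inL2_sqC mI iF; have sT := inL2_sqC mI (T1 F iF).
apply: (nsqC_L2norm_le (sqrtr_ge0 K) (sqC_lin _ sF sT) sF).
rewrite sqr_sqrtr//.
have TF : nsqC I (T F) <= `|M| ^+ 2 * nsqC I F.
  have := TM F iF; rewrite (sqC_inL2 mI sF).2 (sqC_inL2 mI sT).2 -EFinM lee_fin => H.
  rewrite -(sqr_sqrtr (nsqC_ge0 I (T F))) -[X in _ * X](sqr_sqrtr (nsqC_ge0 I F)) -exprMn.
  rewrite lerXn2r ?nnegrE ?mulr_ge0 ?sqrtr_ge0//; apply: (le_trans H).
  by rewrite ler_wpM2r ?sqrtr_ge0// ler_norm.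
have E f g : sq I f -> sq I g -> ip I (fun t => c * f t + g t) (fun t => c * f t + g t) <=
    2 * (c ^+ 2 * ip I f f) + 2 * ip I g g.
  move=> sf sg; apply: (le_trans (ip_triangle mI (sqZ c mI sf) sg)); rewrite lerD2r.
  by rewrite (ipZl c mI sf (sqZ c mI sf)) ipC (ipZl c mI sf sf) mulrA -expr2.
have ER : ref (fun t => c%:C * F t + T F t) = (fun t => c * ref F t + ref (T F) t).
  by apply/funext => t; rewrite /ref; case: (F t) (T F t) => x1 x2 [y1 y2] /=; rewrite mul0r subr0.
have EI : imf (fun t => c%:C * F t + T F t) = (fun t => c * imf F t + imf (T F) t).
  by apply/funext => t; rewrite /imf; case: (F t) (T F t) => x1 x2 [y1 y2] /=; rewrite mul0r addr0.
have := E _ _ sF.1 sT.1; have := E _ _ sF.2 sT.2; rewrite -ER -EI.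
move: TF; rewrite /nsqC /K.
move: (ip I (ref F) _) (ip I (imf F) _) (ip I (ref (T F)) _) (ip I (imf (T F)) _).
by move: (ip _ _ _) (ip _ _ _) (`|M| ^+ 2) (c ^+ 2) => *; nra.
Qed.

Hypothesis b0 : b u @[u --> +oo] --> 0.

(** Two successive extractions: along [k1] the transforms of the real parts converge, and along
    [k1 \o k2] those of the imaginary parts as well. *)
Lemma compact_multC : compact_operator I multC.
Proof.
split; first exact: bounded_multC.
move=> F M FM.
have sF n : sqC I (F n) by apply: inL2_sqC => //; exact: (FM n).1.
have M0 : 0 <= M.
  have := (FM 0%N).2; rewrite (sqC_inL2 mI (sF 0%N)).2 lee_fin.
  by apply: le_trans; exact: sqrtr_ge0.
have nM n : nsqC I (F n) <= M ^+ 2 by rewrite -L2norm_le//; exact: (FM n).2.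
have rM n : ip I (ref (F n)) (ref (F n)) <= M ^+ 2.
  by apply: le_trans (nM n); rewrite lerDl ip_ge0.
have iM n : ip I (imf (F n)) (imf (F n)) <= M ^+ 2.
  by apply: le_trans (nM n); rewrite lerDr ip_ge0.
have [k1 [c1 [s1 [k1_lt sc1 ss1 cc1 cs1]]]] :=
  transforms_subsequence mI IL L0 (fun n => (sF n).1) rM.
have [k2 [c2 [s2 [k2_lt sc2 ss2 cc2 cs2]]]] :=
  transforms_subsequence mI IL L0 (fun n => (sF (k1 n)).2) (fun n => iM (k1 n)).
pose g1 := synth I (fun u => b u * c1 u) (fun u => b u * s1 u).
pose g2 := synth I (fun u => b u * c2 u) (fun u => b u * s2 u).
have sg1 : sq I g1 by have [] := synthP mI IL L0 (sq_mul_b mb bB sc1) (sq_mul_b mb bB ss1).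
have sg2 : sq I g2 by have [] := synthP mI IL L0 (sq_mul_b mb bB sc2) (sq_mul_b mb bB ss2).
have k2oo : k2 n @[n --> \oo] --> \oo by exact: homo_ltn_cvg.
have H1 := multiplier_cvg mI IL L0 mb bB b0 (fun n => (sF (k1 (k2 n))).1)
  (fun n => rM (k1 (k2 n))) sc1 ss1
  (fun u Pu => cvg_comp _ _ k2oo (cc1 u Pu)) (fun u Pu => cvg_comp _ _ k2oo (cs1 u Pu)).
have H2 := multiplier_cvg mI IL L0 mb bB b0 (fun n => (sF (k1 (k2 n))).2)
  (fun n => iM (k1 (k2 n))) sc2 ss2 cc2 cs2.
exists (k1 \o k2), (fun t => g1 t +i* g2 t); split.
- by move=> m n /k2_lt/k1_lt.
- by apply: (sqC_inL2 mI _).1; split.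
apply/L2norm_cvg0 => //.
  move=> n; have [sm1 sm2] := sqC_multC (sF (k1 (k2 n))).
  by split; [exact: sqB sm1 sg1|exact: sqB sm2 sg2].
by rewrite -[X in _ --> X](addr0 (0 : R)); exact: cvgD H1 H2.
Qed.

End Operators.
End Sufficiency.

(** * Weak limits from convergence of the ratio *)

Section SufficientCondition.
Context {R : realType}.
Notation mu := (@lebesgue_measure R).
Local Open Scope complex_scope.
Local Notation P := (`[0%R, +oo[%classic : set R).

Let mP : measurable P. Proof. exact: measurable_itv. Qed.

Lemma cvg_at_right_eq (h k : R -> R) (x l : R) : (forall e, x < e -> h e = k e) ->
  h e @[e --> x^'+] --> l -> k e @[e --> x^'+] --> l.
Proof.
move=> hk; apply: cvg_trans; apply: near_eq_cvg; near=> e.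
by apply: hk; near: e; exact: nbhs_right_gt.
Unshelve. all: by end_near. Qed.

Lemma bounded_set_norm_le (I : set R) : bounded_set I -> exists2 L, 0 <= L & forall t, I t -> `|t| <= L.
Proof.
move=> [M [_ MP]]; exists (Num.max 0 (M + 1)); first by rewrite le_max lexx.
move=> t It; rewrite le_max; apply/orP; right.
by apply: (MP (M + 1)) => //; rewrite ltrDl.
Qed.

Variable S : R -> R.
Hypothesis S_nd : {in `[0, +oo[ &, {homo S : x y / x <= y}}.
Hypothesis S_laplace : forall s : R[i], 1 < complex.Re s ->
  cintegrable `[0, +oo[ (laplace_integrand S s).
Local Notation a := (density_ratio S).

Lemma S_expR_le u v : u <= v -> S (expR u) <= S (expR v).
Proof. by move=> uv; apply: S_nd; rewrite ?in_itv/= ?expR_ge0// ler_expR. Qed.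

(** Monotonicity keeps [S(e^u)] between [S(1)] and [S(e^N)], and the denominator is at least 1. *)
Lemma ratio_bounded_on (N : R) : 0 <= N ->
  forall u, 0 <= u <= N -> `|a u| <= `|S (expR 0)| + `|S (expR N)|.
Proof.
move=> N0 u /andP[u0 uN]; rewrite /density_ratio normrM normfV (ger0_norm (expR_ge0 _)).
rewrite ler_pdivrMr ?expR_gt0//.
have : 1 <= expR u by rewrite -(@expR0 R) ler_expR.
have := S_expR_le u0; have := S_expR_le uN.
move: (S (expR u)) (S (expR 0)) (S (expR N)) (expR u) => y z x E yx zy E1.
apply: (@le_trans _ _ ((`|z| + `|x|) * 1)); last by rewrite ler_wpM2l// addr_ge0.
rewrite mulr1 ler_norml; have := ler_norm x; have := ler_norm (- z); rewrite normrN.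
by have := normr_ge0 x; have := normr_ge0 z; lra.
Qed.

Variable A0 : R.
Hypothesis a_cvg : a u @[u --> +oo] --> A0.

Lemma ratio_bounded : exists B, forall u, P u -> `|a u - A0| <= B.
Proof.
have /cvgrPdist_le/(_ 1 ltr01)[N [_ NP]] := a_cvg.
pose N1 := Num.max 0 (N + 1); have N10 : 0 <= N1 by rewrite le_max lexx.
exists (Num.max 1 (`|S (expR 0)| + `|S (expR N1)| + `|A0|)) => u.
rewrite /= in_itv/= andbT => u0; rewrite le_max; have [uN|Nu] := leP u N1.
  apply/orP; right; apply: (le_trans (ler_normB _ _)); rewrite lerD2r.
  by apply: ratio_bounded_on => //; rewrite u0.
apply/orP; left; rewrite distrC; apply: NP; apply: le_lt_trans Nu.
by rewrite /N1 le_max lerDl ler01 orbT.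
Qed.

Lemma weak_limit_exists (I : set R) : bounded_symmetric_interval I ->
  exists W : (R -> R[i]) -> (R -> R[i]),
    [/\ bounded_operator I W, weak_limit_W S I W
      & exists Psi : (R -> R[i]) -> (R -> R[i]),
          compact_operator I Psi /\
          forall f, inL2 I f -> L2eq I (W f) (fun t => A0%:C * f t + Psi f t)].
Proof.
move=> [I_itv I_bnd _]; have mI := is_interval_measurable I_itv.
have [L L0 IL] := bounded_set_norm_le I_bnd.
pose b u := a u - A0.
have mb : measurable_fun P b by apply: measurable_funB => //; exact: measurable_ratio.
have [B bB] := ratio_bounded.
have b0 : b u @[u --> +oo] --> 0.
  by rewrite -(subrr A0); apply: cvgB => //; exact: cvg_cst.
have cPsi := compact_multC mI IL L0 mb bB b0.
pose W F t := A0%:C * F t + multC I b F t.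
have bW : bounded_operator I W.
  by apply: (bounded_scalar_plus mI); exact: (bounded_multC mI IL L0 mb bB).
exists W; split => //; last first.
  by exists (multC I b); split => // f _; apply: aeW => t _.
(* The product of [a] and the spectrum is integrable, as a sum of its [A0] and [b] parts, so the
   Abel factor disappears by dominated convergence; Plancherel identifies the first part and the
   multiplier the second. *)
have form_cvg f g : sq I f -> sq I g ->
    abel_form S I e f g @[e --> 0^'+] --> ip I (fun t => A0 * f t + multiplier I b f t) g.
  move=> sf sg; have [iS ES] := plancherel mI IL L0 sf sg.
  have [sm mE] := multiplierP mI IL L0 mb bB sf.
  have ib := L1_mul_b_spec mI IL L0 mb bB sf sg.
  have ia : L1 P (fun u => a u * spec I f g u).
    apply: L1_eq (L1D mP (L1Zl A0 mP iS) ib) => // u _; rewrite /b; ring.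
  have -> : ip I (fun t => A0 * f t + multiplier I b f t) g =
      pi^-1 * \int[mu]_(u in P) (a u * spec I f g u).
    rewrite (ipDl mI (sqZ A0 mI sf) sm sg) (ipZl A0 mI sf sg).
    have -> : ip I (multiplier I b f) g = pi^-1 * \int[mu]_(u in P) (b u * spec I f g u).
      by rewrite -(mE _ sg) mulrA mulVf ?mul1r// gt_eqF ?pi_gt0.
    have -> : ip I f g = pi^-1 * \int[mu]_(u in P) spec I f g u.
      by rewrite ES mulrA mulVf ?mul1r// gt_eqF ?pi_gt0.
    rewrite mulrCA -(intZl A0 mP iS) -mulrDr -(intD mP (L1Zl A0 mP iS) ib); congr (_ * _).
    by apply: eq_int => u _; rewrite /b; ring.
  apply: cvgM; first exact: cvg_cst.
  have := cvg_abel ia; apply: cvg_trans; apply: near_eq_cvg; apply: nearW => e /=.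
  by apply: eq_int => u _; rewrite /abel_weight mulrA.
move=> F G /(inL2_sqC mI) sF /(inL2_sqC mI) sG.
have [fr fi] := sF; have [gr gi] := sG.
have sW : sqC I (W F) by exact: (sqC_lin mI _ sF (sqC_multC mI IL L0 mb bB sF)).
have ER : ref (W F) = (fun t => A0 * ref F t + multiplier I b (ref F) t).
  by apply/funext => t; rewrite /W /ref /multC /=; case: (F t) => x y /=; rewrite mul0r subr0.
have EI : imf (W F) = (fun t => A0 * imf F t + multiplier I b (imf F) t).
  by apply/funext => t; rewrite /W /imf /multC /=; case: (F t) => x y /=; rewrite mul0r addr0.
rewrite (L2innerE mI sW sG) ER EI.
have E e : 0 < e -> L2inner I (W_eps S I e F) G =
    (abel_form S I e (ref F) (ref G) + abel_form S I e (imf F) (imf G)) +i*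
    (abel_form S I e (imf F) (ref G) - abel_form S I e (ref F) (imf G)).
  by move=> e0; have [] := L2inner_W_eps S_laplace mI IL e0 sF sG.
apply: cvg_complex.
- apply: cvg_at_right_eq (cvgD (form_cvg _ _ fr gr) (form_cvg _ _ fi gi)) => e e0.
  by rewrite (E _ e0).
- apply: cvg_at_right_eq (cvgB (form_cvg _ _ fi gr) (form_cvg _ _ fr gi)) => e e0.
  by rewrite (E _ e0).
Qed.

End SufficientCondition.

Section SufficiencyTheorem.
Context {R : realType}.
Local Open Scope complex_scope.
Variable S : R -> R.
Hypothesis S_nd : {in `[0, +oo[ &, {homo S : x y / x <= y}}.
Hypothesis S_laplace : forall s : R[i], 1 < complex.Re s ->
  cintegrable `[0, +oo[ (laplace_integrand S s).

Lemma sufficiency (A : R[i]) (I : set R) :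
  (S (expR u) / expR u)%:C @[u --> +oo%R] --> (A : R[i]^o) ->
  bounded_symmetric_interval I ->
  exists W : (R -> R[i]) -> (R -> R[i]),
    [/\ bounded_operator I W, weak_limit_W S I W
      & exists Psi : (R -> R[i]) -> (R -> R[i]),
          compact_operator I Psi /\
          forall f, inL2 I f -> L2eq I (W f) (fun t => A * f t + Psi f t)].
Proof.
move=> cA bI; have [cr ci] := cvg_Re_Im _ cA.
(* The quotients are real, hence so is their limit. *)
have A0 : complex.Im A = 0 by apply/esym; apply: (cvg_unique _ (cvg_cst 0) ci).
have -> : A = (complex.Re A)%:C by case: A A0 {cA cr ci} => x y /= ->.
exact: (weak_limit_exists S_nd S_laplace cr bI).
Qed.

End SufficiencyTheorem.

(** * Necessity: testing on plane waves *)

Section Oscillation.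
Context {R : realType}.
Notation mu := (@lebesgue_measure R).
Local Open Scope complex_scope.

(** Compactness yields only subsequences of sequences; this criterion upgrades that to a limit in
    the continuous frequency. *)
Lemma cvg_pinfty_subseq (h : R -> R) (l : R) :
  (forall s : nat -> R, s n @[n --> \oo] --> +oo ->
    exists2 k : nat -> nat, k n @[n --> \oo] --> \oo & h (s (k n)) @[n --> \oo] --> l) ->
  h x @[x --> +oo] --> l.
Proof.
move=> H; apply/cvgrPdist_lt => e e0; apply: contrapT => nH.
have far n : exists x, n%:R <= x /\ e <= `|l - h x|.
  apply: contrapT => nx; apply: nH; exists n%:R; split; first exact: num_real.
  move=> x nltx; rewrite ltNge; apply/negP => ex; apply: nx; exists x; split => //.
  exact: ltW.
have [s sP] := choice far.
have soo : s n @[n --> \oo] --> +oo.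
  apply/cvgryPge => M; near=> n; apply: le_trans (sP n).1.
  by near: n; exact: nbhs_infty_ger.
have [k _ /cvgrPdist_lt/(_ e e0)[N _ NP]] := H s soo.
by have := NP N (leqnn N); rewrite ltNge (sP (k N)).2.
Unshelve. all: by end_near. Qed.

Section OnI.
Variables (I : set R) (L : R).
Hypotheses (mI : measurable I) (IL : forall t, I t -> `|t| <= L) (L0 : 0 <= L).

Lemma trans_cvg0 (g : R -> R) (l : nat -> R) : sq I g -> l n @[n --> \oo] --> +oo ->
  trans cos I g (l n) @[n --> \oo] --> 0 /\ trans sin I g (l n) @[n --> \oo] --> 0.
Proof.
have alg (x y e : R) : 0 < e -> x ^+ 2 + y ^+ 2 < e ^+ 2 -> `|x| < e /\ `|y| < e.
  move=> e0 H; have half z : z ^+ 2 < e ^+ 2 -> `|z| < e.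
    by move=> ?; rewrite -(ltr_pXn2r (n := 2)) ?nnegrE ?(ltW e0)// real_normK ?num_real.
  by have := sqr_ge0 x; have := sqr_ge0 y; split; apply: half; lra.
move=> sg loo; have /cvgrPdist_lt c := riemann_lebesgue mI IL L0 sg loo.
have c' e : 0 < e -> \forall n \near \oo, `|trans cos I g (l n)| < e /\ `|trans sin I g (l n)| < e.
  move=> e0; have /c : 0 < e ^+ 2 by exact: exprn_gt0.
  apply: filterS => n; rewrite sub0r normrN (ger0_norm (spec_ge0 I g (l n))) /spec -!expr2.
  exact: alg.
split; apply/cvgrPdist_lt => e /c'; apply: filterS => n [h1 h2]; by rewrite sub0r normrN.
Qed.

Variable Psi : (R -> R[i]) -> (R -> R[i]).
Hypothesis cPsi : compact_operator I Psi.

Variable k : R -> R.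
Hypotheses (k_max : forall x, `|k x| <= 1) (k_lip : forall x y, `|k x - k y| <= `|x - y|).
Hypothesis k_cvg0 : forall (g : R -> R) (l : nat -> R), sq I g -> l n @[n --> \oo] --> +oo ->
  trans k I g (l n) @[n --> \oo] --> 0.

(** [k] stands for [cos] or [sin], so that one argument serves both families. *)
Definition wave (l : R) : R -> R[i] := fun t => (k (l * t))%:C.

Lemma sq_wave l : sq I (fun t => k (l * t)).
Proof.
apply: (@sq_bounded_by _ _ _ (fun=> 1)) => //; last exact: (L1_cst_on mI IL 1).
  exact: (measurable_ku k_lip).
by move=> t _; rewrite -[_ ^+ 2]real_normK ?num_real// exprn_ile1.
Qed.

Lemma sqC_wave l : sqC I (wave l).
Proof.
split; first exact: sq_wave.
apply: (@sq_bounded_by _ _ _ (fun=> 0)) => //; last exact: (L1_cst_on mI IL 0).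
  exact: measurable_cst.
by move=> t _; rewrite expr0n.
Qed.

Lemma ip_wave_le l : ip I (fun t => k (l * t)) (fun t => k (l * t)) <= fine (mu I).
Proof.
rewrite ip_self -[leRHS]mul1r -(int_cst 1 mI).
apply: int_le => //; [exact: (sq_wave l).2|exact: (L1_cst_on mI IL 1)|].
by move=> t _; rewrite -[_ ^+ 2]real_normK ?num_real// exprn_ile1.
Qed.

(** Square norms of waves are at most the measure of [I]. In [ip_le] the weight [(M + 1) / e] makes
    the wave term at most [e], and the other term is below [e] once the norm of [d n] is small. *)
Lemma ip_cvg0 (d : nat -> R -> R) (l : nat -> R) : (forall n, sq I (d n)) ->
  ip I (d n) (d n) @[n --> \oo] --> 0 ->
  ip I (d n) (fun t => k (l n * t)) @[n --> \oo] --> 0.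
Proof.
have alg (x y z M e r : R) : 0 < e -> 0 <= M -> r = (M + 1) / e -> 2 * x <= r * y + r^-1 * z ->
    z <= M -> y < e ^+ 2 / (M + 1) -> x < e.
  move=> e0 M0 rE; rewrite rE invf_div => H zM ye.
  have M1 : 0 < M + 1 by lra.
  have r1 : (M + 1) / e * y < e.
    apply: (@lt_le_trans _ _ ((M + 1) / e * (e ^+ 2 / (M + 1)))).
      by rewrite ltr_pM2l// divr_gt0.
    by rewrite le_eqVlt; apply/orP; left; apply/eqP; field; rewrite ?gt_eqF.
  have r2 : e / (M + 1) * z <= e.
    apply: (@le_trans _ _ (e / (M + 1) * (M + 1))).
      by rewrite ler_wpM2l ?divr_ge0 ?(ltW e0) ?(ltW M1)//; lra.
    by rewrite mulfVK ?gt_eqF.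
  by lra.
move=> sd d0; apply/cvgrPdist_lt => e e0.
have M0 : 0 <= fine (mu I) by rewrite fine_ge0.
have M1 : 0 < fine (mu I) + 1 by rewrite ltr_wpDl.
have e1 : 0 < e ^+ 2 / (fine (mu I) + 1) by rewrite divr_gt0// exprn_gt0.
move/cvgrPdist_lt : d0 => /(_ _ e1); apply: filterS => n.
rewrite !sub0r !normrN ger0_norm ?ip_ge0// => H.
have r0 : 0 < (fine (mu I) + 1) / e by rewrite divr_gt0.
exact: (alg _ _ _ _ _ _ e0 M0 erefl (ip_le mI (sd n) (sq_wave (l n)) r0) (ip_wave_le (l n)) H).
Qed.

Lemma compact_wave_cvg0 :
  ip I (ref (Psi (wave l))) (fun t => k (l * t)) @[l --> +oo] --> 0 /\
  ip I (imf (Psi (wave l))) (fun t => k (l * t)) @[l --> +oo] --> 0.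
Proof.
have [[Psi1 _ _] Psi2] := cPsi.
have sPsi l : sqC I (Psi (wave l)).
  by apply: (inL2_sqC mI); apply: Psi1; exact: (sqC_inL2 mI (sqC_wave l)).1.
have iw0 l : ip I (imf (wave l)) (imf (wave l)) = 0.
  rewrite (@ip_eq _ _ _ (fun=> 0) _ (fun=> 0))// /ip.
  by rewrite (@eq_int _ _ _ (fun=> 0)) ?int_cst ?mul0r// => x _; rewrite mulr0.
have sub (s : nat -> R) : s n @[n --> \oo] --> +oo -> exists2 kk : nat -> nat, kk n @[n --> \oo] --> \oo &
    ip I (ref (Psi (wave (s (kk n))))) (fun t => k (s (kk n) * t)) @[n --> \oo] --> 0 /\
    ip I (imf (Psi (wave (s (kk n))))) (fun t => k (s (kk n) * t)) @[n --> \oo] --> 0.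
  move=> soo.
  have [|kk [g [kk_lt /(inL2_sqC mI) sg cg]]] := Psi2 (fun n => wave (s n)) (Num.sqrt (fine (mu I))).
    move=> n; have [i1 E] := sqC_inL2 mI (sqC_wave (s n)); split => //.
    by rewrite E lee_fin ler_wsqrtr// /nsqC iw0 addr0; exact: ip_wave_le.
  have kkoo := homo_ltn_cvg kk_lt.
  have soo2 : s (kk n) @[n --> \oo] --> +oo by exact: (cvg_comp _ _ kkoo soo).
  have rB (F G : R -> R[i]) : ref (fun x => F x - G x) = (fun x => ref F x - ref G x).
    by apply/funext => x; rewrite /ref; case: (F x) (G x) => a1 a2 [b1 b2].
  have iB (F G : R -> R[i]) : imf (fun x => F x - G x) = (fun x => imf F x - imf G x).
    by apply/funext => x; rewrite /imf; case: (F x) (G x) => a1 a2 [b1 b2].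
  have sd n : sqC I (fun x => Psi (wave (s (kk n))) x - g x).
    have [p1 p2] := sPsi (s (kk n)); rewrite /sqC rB iB.
    by split; [exact: (sqB mI p1 sg.1)|exact: (sqB mI p2 sg.2)].
  have c0 := (L2norm_cvg0 mI sd).2 cg.
  have sqz (f : nat -> R) : (forall n, 0 <= f n <= nsqC I (fun x => Psi (wave (s (kk n))) x - g x)) ->
      f n @[n --> \oo] --> 0.
    move=> H; apply: (squeeze_cvgr _ (cvg_cst 0) c0); exact: nearW.
  (* Along the subsequence the image is a fixed limit [q] plus an error tending to 0 in norm. The
     error is handled by [ip_cvg0], and the inner product of [q] with a wave is its transform at a
     frequency tending to infinity. *)
  have part (p : nat -> R -> R) (q : R -> R) : (forall n, sq I (p n)) -> sq I q ->
      ip I (fun x => p n x - q x) (fun x => p n x - q x) @[n --> \oo] --> 0 ->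
      ip I (p n) (fun t => k (s (kk n) * t)) @[n --> \oo] --> 0.
    move=> sp sq1 c1.
    have c2 := ip_cvg0 (fun n => s (kk n)) (fun n => sqB mI (sp n) sq1) c1.
    have c3 := k_cvg0 sq1 soo2.
    rewrite (_ : (fun n => _) = (fun n => ip I (fun x => p n x - q x) (fun t => k (s (kk n) * t)) +
      trans k I q (s (kk n)))); first by rewrite -[X in _ --> X](addr0 (0 : R)); exact: cvgD c2 c3.
    apply/funext => n; rewrite (ipBl mI (sp n) sq1 (sq_wave _)).
    by rewrite -[trans _ _ _ _]/(ip I q (fun t => k (s (kk n) * t))) subrK.
  exists kk => //; split.
    apply: (part (fun n => ref (Psi (wave (s (kk n))))) (ref g)) => [n||]; [exact: (sPsi _).1|exact: sg.1|].
    by apply: sqz => n; rewrite ip_ge0 /nsqC rB iB /= lerDl ip_ge0.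
  apply: (part (fun n => imf (Psi (wave (s (kk n))))) (imf g)) => [n||]; [exact: (sPsi _).2|exact: sg.2|].
  by apply: sqz => n; rewrite ip_ge0 /nsqC rB iB /= lerDr ip_ge0.
by split; apply: cvg_pinfty_subseq => s /sub[kk kkoo [h1 h2]]; exists kk.
Qed.

End OnI.
End Oscillation.

(** * Limits of the Abel forms on real test functions *)

Section FormLimit.
Context {R : realType}.
Notation mu := (@lebesgue_measure R).
Local Open Scope complex_scope.
Variable S : R -> R.
Hypothesis S_laplace : forall s : R[i], 1 < complex.Re s ->
  cintegrable `[0, +oo[ (laplace_integrand S s).

Section OnI.
Variables (I : set R) (L : R).
Hypotheses (mI : measurable I) (IL : forall t, I t -> `|t| <= L) (L0 : 0 <= L).

(** On a real test function the regularized forms are real, so the limit splits into a convergence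
    statement for the real part and an equation for the imaginary part. That equation is what later
    excludes a non-real [A]. *)
Lemma form_limit (A : R[i]) W Psi (f : R -> R) : bounded_operator I W -> weak_limit_W S I W ->
  compact_operator I Psi -> (forall F, inL2 I F -> L2eq I (W F) (fun t => A * F t + Psi F t)) ->
  sqC I (fun t => (f t)%:C) ->
  abel_form S I e f f @[e --> 0^'+] -->
    complex.Re A * ip I f f + ip I (ref (Psi (fun t => (f t)%:C))) f /\
  complex.Im A * ip I f f + ip I (imf (Psi (fun t => (f t)%:C))) f = 0.
Proof.
move=> [W1 _ _] W2 [[Psi1 _ _] _] WPsi sF; set F := fun t => (f t)%:C.
have iF := (sqC_inL2 mI sF).1; have sf : sq I f by exact: sF.1.
have s0 : sq I (fun=> 0) by exact: sF.2.
have sW := inL2_sqC mI (W1 F iF); have sP := inL2_sqC mI (Psi1 F iF).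
have ip0 g : ip I g (fun=> 0) = 0.
  by rewrite /ip (@eq_int _ _ _ (fun=> 0)) ?int_cst ?mul0r// => x _; rewrite mulr0.
have ip0f g : ip I (fun=> 0) g = 0 by rewrite ipC ip0.
have spec0 g : spec I (fun=> 0) g = fun=> 0.
  apply/funext => u; rewrite /spec /trans.
  have z (k : R -> R) : \int[mu]_(t in I) (0 * k (u * t)) = 0.
    by rewrite (@eq_int _ _ _ (fun=> 0)) ?int_cst ?mul0r// => x _; rewrite mul0r.
  by rewrite !z !mul0r addr0.
have form0 e g : abel_form S I e (fun=> 0) g = 0.
  rewrite /abel_form spec0 (@eq_int _ _ _ (fun=> 0)) => [|x _]; last by rewrite mulr0.
  by rewrite (int_cst _ (measurable_itv _)) mul0r mulr0.
have form0r e g : abel_form S I e g (fun=> 0) = 0.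
  rewrite /abel_form (_ : spec I g (fun=> 0) = spec I (fun=> 0) g); last first.
    by apply/funext => u; rewrite specC.
  exact: form0.
have [cr ci] := cvg_Re_Im _ (W2 F F iF iF).
have E e : 0 < e -> complex.Re (L2inner I (W_eps S I e F) F) = abel_form S I e f f /\
    complex.Im (L2inner I (W_eps S I e F) F) = 0.
  move=> e0; have [_ ->] := L2inner_W_eps S_laplace mI IL e0 sF sF; split => /=.
    by rewrite -[imf F]/(fun=> 0) form0 addr0.
  by rewrite -[imf F]/(fun=> 0) form0 form0r subr0.
have c0 : (fun=> 0) x @[x --> (0 : R)^'+] --> (0 : R) by exact: cvg_cst.
have {}cr := cvg_at_right_eq (k := fun e => abel_form S I e f f) (fun e e0 => (E e e0).1) cr.
have {}ci := cvg_at_right_eq (k := fun=> 0) (fun e e0 => (E e e0).2) ci.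
have : complex.Im (L2inner I (W F) F) = 0 by apply/esym; exact: (cvg_unique _ c0 ci).
move: cr; rewrite (L2innerE mI sW sF) /= -[imf F]/(fun=> 0) -[ref F]/f !ip0 addr0 subr0.
have ER : ip I (ref (W F)) f = complex.Re A * ip I f f + ip I (ref (Psi F)) f.
  rewrite -(ipZl _ mI sf sf) -(ipDl mI (sqZ (complex.Re A) mI sf) sP.1 sf).
  apply: (int_ae mI (L1_meas (sqM mI sW.1 sf))
    (L1_meas (sqM mI (sqD mI (sqZ (complex.Re A) mI sf) sP.1) sf))).
  have [N [mN N0 NP]] := WPsi F iF; exists N; split => //.
  apply: subset_trans NP => t /= H Ht; apply: H => It; rewrite /ref (Ht It) /F.
  by case: (A) (Psi _ t) => x y [z w] /=; rewrite mulr0 subr0.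
have EI : ip I (imf (W F)) f = complex.Im A * ip I f f + ip I (imf (Psi F)) f.
  rewrite -(ipZl _ mI sf sf) -(ipDl mI (sqZ (complex.Im A) mI sf) sP.2 sf).
  apply: (int_ae mI (L1_meas (sqM mI sW.2 sf))
    (L1_meas (sqM mI (sqD mI (sqZ (complex.Im A) mI sf) sP.2) sf))).
  have [N [mN N0 NP]] := WPsi F iF; exists N; split => //.
  apply: subset_trans NP => t /= H Ht; apply: H => It; rewrite /imf (Ht It) /F.
  by case: (A) (Psi _ t) => x y [z w] /=; rewrite mulr0 add0r.
by rewrite ER EI.
Qed.

End OnI.
End FormLimit.

(** * The Tauberian step *)

Section TauberianCore.
Context {R : realType}.

(** From [exp(-2d) >= 1 - 2d], and [1 / (1 - 2d) <= 1 + 4d] when [d <= 1/4]. *)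
Lemma expR_sub1_le (d : R) : 0 <= d -> 4 * d <= 1 -> expR (2 * d) - 1 <= 4 * d.
Proof.
move=> d0 d1; have H : 1 - 2 * d <= expR (- (2 * d)) by have := expR_ge1Dx (- (2 * d)); lra.
have : expR (2 * d) * expR (- (2 * d)) = 1 by rewrite expRN mulfV// gt_eqF// expR_gt0.
have := expR_gt0 (2 * d); move: (expR _) (expR _) H => x y; nra.
Qed.

Variables (r : R -> R) (l K L1 : R).
Hypothesis r_ge0 : forall u, 0 <= u -> 0 <= r u.
Hypothesis r_nd : forall u v, u <= v -> expR u * r u <= expR v * r v.
Hypothesis K0 : 0 <= K.
Hypothesis averages : forall L, L1 <= L -> 0 < L -> exists2 m : R -> R, m x @[x --> +oo] --> l &
  forall d x, 0 < d -> d < x ->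
    expR (- (2 * d)) * r (x - d) * (1 - K / (L * d)) <= m x /\
    forall B, (forall u, 0 <= u -> r u <= B) -> m x <= expR (2 * d) * r (x + d) + B * (K / (L * d)).

(** The upper estimate presupposes a bound, so only the lower one is used, with [d = 1] and
    [L >= 2 * K + 1]: at least half of the main term survives, and [r u] is at most [2 * expR 2]
    times an average that is eventually below [l + 1]. On the initial segment the monotone
    [expR u * r u] gives the bound. *)
Lemma averaged_bounded : exists2 B, 0 <= B & forall u, 0 <= u -> r u <= B.
Proof.
pose L := Num.max L1 (2 * K + 1).
have LL1 : L1 <= L by rewrite le_max lexx.
have LK : 2 * K + 1 <= L by rewrite le_max lexx orbT.
have L0 : 0 < L by have := K0; lra.
have [m mc mP] := averages LL1 L0.
have eta : K / (L * 1) <= 1 / 2 by rewrite mulr1 ler_pdivrMr//; lra.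
move/cvgrPdist_le : mc => /(_ 1 ltr01)[N [_ NP]].
pose N1 := Num.max 1 (N + 1); have N11 : 1 <= N1 by rewrite le_max lexx.
have N1N : N < N1 by rewrite lt_max; apply/orP; right; lra.
pose B1 := expR N1 * r N1; pose B2 := 2 * expR 2 * (l + 1).
exists (Num.max 0 (Num.max B1 B2)) => [|u u0]; first by rewrite le_max lexx.
have [uN|Nu] := leP u N1.
  rewrite !le_max; apply/orP; right; apply/orP; left; apply: le_trans (r_nd uN).
  by rewrite ler_peMl ?r_ge0// -(@expR0 R) ler_expR.
rewrite !le_max; apply/orP; right; apply/orP; right.
have /mP : (0 : R) < 1 by [].
move=> /(_ (u + 1)); rewrite addrK mulr1 => H.
have {H}[|H _] := H; first lra.
have /NP : N < u + 1 by lra.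
rewrite ler_norml => /andP[h1 h2].
have eq1 : expR 2 * expR (- 2) = 1 :> R by rewrite expRN mulfV// gt_eqF// expR_gt0.
have := expR_gt0 (- 2 : R); have := expR_gt0 (2 : R); have := r_ge0 u0.
move: H; rewrite /B2; move: (r u) (expR 2) (expR (-2)) (m (u + 1)) (K / (L * 1)) eq1 eta h1 h2.
move=> x E E' y k eq1 eta h1 h2 H x0 E0 E'0.
have h3 : E' * x * (1 / 2) <= y by apply: le_trans H; rewrite ler_wpM2l ?mulr_ge0 ?(ltW E'0)//; lra.
have h4 : E' * x <= 2 * (l + 1) by lra.
have : E * (E' * x) <= E * (2 * (l + 1)) by rewrite ler_wpM2l// ltW.
by rewrite mulrA eq1; lra.
Qed.

(** The averages centred at [x + d] and [x - d] bound [r x] from above and from below. Monotonicity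
    across a window of length [2 * d] costs at most [B * (4 * d)], and the mass outside it
    [B * (K / (L * d))]. *)
Lemma averaged_cvg : r x @[x --> +oo] --> l.
Proof.
have [B B0 BP] := averaged_bounded.
apply/cvgrPdist_le => e e0.
(* The second term makes the window cost at most [e / 4]; the cap [1/4] is what [expR_sub1_le]
   needs. *)
pose d := Num.min 4^-1 (e / (16 * (B + 1))).
have B1 : 0 < B + 1 by lra.
have d0 : 0 < d by rewrite lt_min !divr_gt0 ?mulr_gt0// invr_gt0 ltr0n.
have d1 : 4 * d <= 1.
  have : d <= 4^-1 by rewrite ge_min lexx.
  lra.
have dB : B * (4 * d) <= e / 4.
  have : d <= e / (16 * (B + 1)) by rewrite ge_min lexx orbT.
  rewrite ler_pdivlMr ?mulr_gt0//; nra.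
(* Chosen after [d], so that the outside mass also costs at most [e / 4]. *)
pose L := Num.max L1 (4 * K * (B + 1) / (e * d) + 1).
have LL1 : L1 <= L by rewrite le_max lexx.
have LK : 4 * K * (B + 1) / (e * d) + 1 <= L by rewrite le_max lexx orbT.
have L0 : 0 < L.
  apply: lt_le_trans LK; rewrite ltr_wpDl// divr_ge0 ?mulr_ge0 ?(ltW B1) ?(ltW e0) ?(ltW d0)//.
have etaB : B * (K / (L * d)) <= e / 4.
  rewrite mulrA ler_pdivrMr ?mulr_gt0//.
  have : 4 * K * (B + 1) / (e * d) <= L by lra.
  rewrite ler_pdivrMr ?mulr_gt0// => H.
  have := K0; nra.
have eta0 : 0 <= K / (L * d) by rewrite divr_ge0 ?mulr_ge0 ?(ltW L0) ?(ltW d0).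
have [m mc mP] := averages LL1 L0.
have e4 : 0 < e / 4 by rewrite divr_gt0.
move/cvgrPdist_le : mc => /(_ _ e4)[N [_ NP]].
exists (Num.max (2 * d) (N + d)); split; first exact: num_real.
move=> x; rewrite gt_max => /andP[xd xN].
have up : r x <= m (x + d) + (B * (4 * d) + B * (K / (L * d))).
  have [|+ _] := mP d (x + d) d0; first lra.
  rewrite addrK; have := r_ge0 (u := x); have := BP x.
  have : 0 <= x by lra.
  move=> x0 /(_ x0) rB /(_ x0) r0 H.
  have E1 : 1 - 2 * d <= expR (- (2 * d)) by have := expR_ge1Dx (- (2 * d)); lra.
  have E2 : expR (- (2 * d)) <= 1 by rewrite expR_le1; lra.
  move: (expR _) (K / (L * d)) (m _) (r x) E1 E2 eta0 r0 rB H => E k y z E1 E2 k0 z0 zB H.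
  have : z - E * z * (1 - k) <= B * (4 * d) + B * k; last lra.
  have E0 : 0 <= E by lra.
  have h1 : z * (1 - E) <= B * (2 * d) by apply: ler_pM => //; lra.
  have h2 : E * z * k <= B * k by rewrite ler_wpM2r//; nra.
  have h3 : 0 <= B * d by rewrite mulr_ge0// ltW.
  lra.
have down : m (x - d) <= r x + (B * (4 * d) + B * (K / (L * d))).
  have [|_ /(_ B BP)] := mP d (x - d) d0; first lra.
  rewrite subrK => H.
  have x0 : 0 <= x by lra.
  have r0 := r_ge0 x0; have rB := BP x x0.
  have E1 := expR_sub1_le (ltW d0) d1.
  move: (expR _) (K / (L * d)) (m _) (r x) E1 eta0 r0 rB H => E k y z E1 k0 z0 zB H.
  have : (E - 1) * z <= B * (4 * d); last lra.
  have [E2|E2] := leP 0 (E - 1); last first.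
    apply: (@le_trans _ _ 0); first by rewrite mulr_le0_ge0// ltW.
    by rewrite !mulr_ge0// ltW.
  by rewrite mulrC; apply: ler_pM.
have h1 := NP (x - d); have h2 := NP (x + d); rewrite !ler_norml in h1 h2.
have /andP[h11 h12] : - (e / 4) <= l - m (x - d) <= e / 4 by apply: h1; lra.
have /andP[h21 h22] : - (e / 4) <= l - m (x + d) <= e / 4 by apply: h2; lra.
by rewrite ler_norml; apply/andP; split; lra.
Qed.

End TauberianCore.

(** * Energy spectra of truncated plane waves *)

Section WaveEnergy.
Context {R : realType}.
Notation mu := (@lebesgue_measure R).
Local Notation P := (`[0%R, +oo[%classic : set R).

Lemma poisson_ray d l : 0 < d ->
  L1 P (fun u => poisson d (l - u)) /\ \int[mu]_(u in P) poisson d (l - u) <= pi.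
Proof.
move=> d0.
have [||||i1 E] := @FTC2_ray R (fun u => poisson d (l - u)) (fun u => atan ((u - l) * d^-1)) 0 (pi / 2).
- by move=> u _; exact: is_derive_poisson.
- move=> u _; apply: continuous_comp; last exact: continuous_poisson.
  by apply: cvgB; [exact: cvg_cst|exact: cvg_id].
- by move=> u _; exact: poisson_ge0.
- apply: (@cvg_comp _ _ _ (fun u => (u - l) * d^-1) _ _ (pinfty_nbhs R)); last exact: cvgy_atan.
  apply/cvgryPge => M; near=> u; rewrite ler_pdivlMr// lerBrDr; near: u.
  exact: (nbhs_pinfty_ge (num_real (M * d + l))).
split => //; rewrite E; have := atan_gtNpi2 ((0 - l) * d^-1); rewrite [X in _ -> _ <= X]splitr.
by move: (atan _) => x; lra.
Unshelve. all: by end_near. Qed.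

Section Segment.
Variable L : R.
Hypothesis L0 : 0 < L.
Local Notation I := (`[- L, L]%classic : set R).

Let mI : measurable I. Proof. exact: measurable_itv. Qed.
Let IL t : I t -> `|t| <= L. Proof. by rewrite ler_norml /= in_itv. Qed.
Let L_ge0 : 0 <= L. Proof. exact: ltW. Qed.
Let mP : measurable P. Proof. exact: measurable_itv. Qed.

(** In the sum, the interference between the frequencies [l] and [-l] cancels, and
    [cos^2 + sin^2 = 1] makes the total mass independent of [l]. *)
Definition energy l u :=
  spec I (fun t => cos (l * t)) (fun t => cos (l * t)) u +
  spec I (fun t => sin (l * t)) (fun t => sin (l * t)) u.

(** Cosine or sine part of the transform of the indicator of [I]. For the cosine and [x] nonzero it
    is the Dirichlet-type kernel [2 sin(L x) / x], whose square is of Fejer type. *)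
Definition diric k x := \int[mu]_(t in I) k (x * t).

Lemma diric_L1 (k : R -> R) x : (forall x, `|k x| <= 1) ->
  (forall x y, `|k x - k y| <= `|x - y|) -> L1 I (fun t => k (x * t)).
Proof.
move=> k1 kl; apply: (L1_bounded_on mI IL (M := 1)) => [|t _]; last exact: k1.
exact: (measurable_ku kl).
Qed.

(* The four products of waves collapse, by the addition formulas, to translates of the
   energy of the transform of the indicator of [I]. *)
Lemma energyE l u : energy l u =
  ((diric cos (u - l) ^+ 2 + diric sin (u - l) ^+ 2) +
   (diric cos (u + l) ^+ 2 + diric sin (u + l) ^+ 2)) / 2.
Proof.
have c x := diric_L1 x (@cos_max R) cos_lip; have s x := diric_L1 x (@sin_max R) sin_lip.
have iC f g : L1 I f -> L1 I g -> \int[mu]_(t in I) (2^-1 * (f t + g t)) =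
    2^-1 * (\int[mu]_(t in I) f t + \int[mu]_(t in I) g t).
  by move=> i1 i2; rewrite (intZl _ mI (L1D mI i1 i2)) (intD mI i1 i2).
have iB f g : L1 I f -> L1 I g -> \int[mu]_(t in I) (2^-1 * (f t - g t)) =
    2^-1 * (\int[mu]_(t in I) f t - \int[mu]_(t in I) g t).
  by move=> i1 i2; rewrite (intZl _ mI (L1B mI i1 i2)) (intB mI i1 i2).
have E1 : trans cos I (fun t => cos (l * t)) u = 2^-1 * (diric cos (u + l) + diric cos (u - l)).
  rewrite /diric -(iC _ _ (c _) (c _)); apply: eq_int => t _.
  by rewrite !mulrDl mulNr !cosD cosN sinN; field.
have E2 : trans sin I (fun t => cos (l * t)) u = 2^-1 * (diric sin (u + l) + diric sin (u - l)).
  rewrite /diric -(iC _ _ (s _) (s _)); apply: eq_int => t _.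
  by rewrite !mulrDl mulNr !sinD cosN sinN; field.
have E3 : trans cos I (fun t => sin (l * t)) u = 2^-1 * (diric sin (u + l) - diric sin (u - l)).
  rewrite /diric -(iB _ _ (s _) (s _)); apply: eq_int => t _.
  by rewrite !mulrDl mulNr !sinD cosN sinN; field.
have E4 : trans sin I (fun t => sin (l * t)) u = 2^-1 * (diric cos (u - l) - diric cos (u + l)).
  rewrite /diric -(iB _ _ (c _) (c _)); apply: eq_int => t _.
  by rewrite !mulrDl mulNr !cosD cosN sinN; field.
rewrite /energy /spec E1 E2 E3 E4.
by move: (diric _ _) (diric _ _) (diric _ _) (diric _ _) => x y z w; field.
Qed.

(** The integrand times [x] has the primitive [K (t * x)], so the product is a difference of two
    values of modulus at most 1. *)
Lemma diric_decay (k K : R -> R) (x : R) : (forall x, `|K x| <= 1) ->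
  (forall t : R, is_derive t 1 (fun u : R => K (u * x)) (x * k (t * x))) ->
  (forall t : R, {for t, continuous (fun u : R => k (u * x))}) ->
  (diric k x * x) ^+ 2 <= 4.
Proof.
move=> K1 dK ck; have LL : - L <= L by rewrite ge0_cp.
have [t _|i1 E] := @FTC2_seg R (fun t => x * k (t * x)) (fun t => K (t * x)) (- L) L LL (fun t _ => dK t).
  by apply: cvgM; [exact: cvg_cst|exact: ck].
have -> : diric k x * x = K (L * x) - K (- L * x).
  rewrite -E; have [->|x0] := eqVneq x 0.
    by rewrite mulr0 (@eq_int _ _ _ (fun=> 0)) ?int_cst ?mul0r// => t _; rewrite mul0r.
  have i2 : L1 I (fun t => k (t * x)).
    by apply: L1_eq (L1Zl x^-1 mI i1) => // t _; rewrite mulrA mulVf ?mul1r.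
  rewrite (intZl _ mI i2) mulrC; congr (_ * _); apply: eq_int => t _.
  by rewrite mulrC.
have := K1 (L * x); have := K1 (- L * x); rewrite !ler_norml.
move: (K _) (K _) => y z /andP[? ?] /andP[? ?].
by nra.
Qed.

Lemma diric_sq_decay x : (diric cos x ^+ 2 + diric sin x ^+ 2) * x ^+ 2 <= 8.
Proof.
have c1 : (diric cos x * x) ^+ 2 <= 4.
  apply: (diric_decay (@sin_max R)); first by move=> t; exact: is_derive_sinM.
  by move=> t; apply: (der_cont (is_derive_cosM x t)).
have c2 : (diric sin x * x) ^+ 2 <= 4.
  apply: (diric_decay (K := fun x => - cos x)) => [y|t|t]; first by rewrite normrN cos_max.
    have := derZ (-1) (is_derive_cosM x t); rewrite mulN1r opprK.
    by under eq_fun do rewrite mulN1r.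
  by apply: (der_cont (is_derive_sinM x t)).
by rewrite mulrDl -!exprMn; lra.
Qed.

Lemma energy_ge0 l u : 0 <= energy l u.
Proof. by rewrite addr_ge0// spec_ge0. Qed.

(** The bump reflected at [-l] does no harm: for [u, l >= 0] the distance [u + l] is at least
    [|u - l|]. *)
Lemma energy_decay l u : 0 <= u -> 0 <= l -> energy l u * (u - l) ^+ 2 <= 8.
Proof.
have alg (x y z w : R) : 0 <= x -> z <= w -> x * w <= 8 -> y * z <= 8 -> (y + x) / 2 * z <= 8.
  by move=> x0 zw; have := ler_wpM2l x0 zw; lra.
move=> u0 l0; rewrite energyE; apply: alg (diric_sq_decay (u + l)) (diric_sq_decay (u - l)).
  by rewrite addr_ge0 ?sqr_ge0.
by have := mulr_ge0 u0 l0; lra.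
Qed.

(** When [d^2 <= (u - l)^2], [8 / (u - l)^2 <= 16 / (d^2 + (u - l)^2)]. The majorant is a Poisson
    kernel because the mass of that kernel is already known. *)
Lemma energy_tail d l u : 0 < d -> 0 <= u -> 0 <= l -> d <= `|u - l| ->
  energy l u <= 16 / d * poisson d (l - u).
Proof.
move=> d0 u0 l0 du; have H := energy_decay u0 l0.
have E0 := energy_ge0 l u.
have d2 : d ^+ 2 <= (u - l) ^+ 2.
  by rewrite -[(u - l) ^+ 2]real_normK ?num_real// lerXn2r ?nnegrE// ltW.
have d20 : 0 < d ^+ 2 by rewrite exprn_gt0.
rewrite /poisson mulrA mulfVK ?gt_eqF// -[l - u]opprB sqrrN.
rewrite ler_pdivlMr ?ltr_wpDr ?sqr_ge0//.
move: (energy l u) (d ^+ 2) (_ ^+ 2) H E0 d2 d20 => *; nra.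
Qed.

Lemma sq_cosw l : sq I (fun t => cos (l * t)).
Proof. exact: (sq_wave mI IL (@cos_max R) cos_lip). Qed.

Lemma sq_sinw l : sq I (fun t => sin (l * t)).
Proof. exact: (sq_wave mI IL (@sin_max R) sin_lip). Qed.

Lemma ip_waves l : ip I (fun t => cos (l * t)) (fun t => cos (l * t)) +
  ip I (fun t => sin (l * t)) (fun t => sin (l * t)) = 2 * L.
Proof.
rewrite !ip_self -(intD mI (sq_cosw l).2 (sq_sinw l).2).
rewrite (@eq_int _ _ _ (fun=> 1)) => [|t _]; last by rewrite cos2Dsin2.
rewrite (int_cst _ mI) mul1r lebesgue_measure_itv/= lte_fin.
have -> : - L < L by rewrite gtrN.
by rewrite /= opprK mulr2n mulrDl mul1r.
Qed.

Lemma energy_int l : L1 P (energy l) /\ \int[mu]_(u in P) energy l u = pi * (2 * L).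
Proof.
have [i1 e1] := plancherel mI IL L_ge0 (sq_cosw l) (sq_cosw l).
have [i2 e2] := plancherel mI IL L_ge0 (sq_sinw l) (sq_sinw l).
by split; [exact: L1D|rewrite (intD mP i1 i2) e1 e2 -mulrDr ip_waves].
Qed.

Section Average.
Variable r : R -> R.
Hypothesis r_ge0 : forall u, 0 <= u -> 0 <= r u.
Hypothesis r_nd : forall u v, u <= v -> expR u * r u <= expR v * r v.
Variables d l : R.
Hypotheses (d0 : 0 < d) (dl : d < l) (iE : L1 P (fun u => r u * energy l u)).

Let l0 : 0 <= l. Proof. by apply: ltW; exact: lt_trans dl. Qed.
(* Majorizes the energy at distance at least [d] from [l], see [energy_tail]. *)
Let q u := 16 / d * poisson d (l - u).

Let q_ge0 u : 0 <= q u.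
Proof. by rewrite mulr_ge0 ?poisson_ge0// divr_ge0 ?(ltW d0). Qed.

Let iq : L1 P q. Proof. by apply: L1Zl => //; exact: (poisson_ray l d0).1. Qed.

(** The bound [16 pi / d] is written relative to the total energy [2 * L * pi]: the share outside
    the window is [8 / (L * d)], whence the constant 8 in the Tauberian step. *)
Let int_q : \int[mu]_(u in P) q u <= 2 * L * pi * (8 / (L * d)).
Proof.
have [i1 h] := poisson_ray l d0; rewrite (intZl _ mP i1).
rewrite (_ : 2 * L * pi * (8 / (L * d)) = 16 / d * pi); last by field; rewrite !gt_eqF.
by rewrite ler_wpM2l// divr_ge0 ?(ltW d0).
Qed.

Lemma growth_le u v : u <= v -> r u <= expR (v - u) * r v.
Proof.
move=> /r_nd H; rewrite expRD expRN mulrAC -[X in X <= _]mulr1.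
rewrite -ler_pdivrMr ?invr_gt0 ?expR_gt0// invrK mulr1 mulrC.
exact: H.
Qed.

(** Within distance [d] of [l], growth gives [r u >= k]; outside, [energy <= q] makes
    [k * (energy - q)] nonpositive. So [k * (energy - q)] is a minorant everywhere. *)
Lemma average_ge : expR (- (2 * d)) * r (l - d) * (1 - 8 / (L * d)) * (2 * L * pi) <=
  \int[mu]_(u in P) (r u * energy l u).
Proof.
set k := expR _ * r _; have rd : 0 <= r (l - d) by apply: r_ge0; rewrite subr_ge0 ltW.
have k0 : 0 <= k by rewrite mulr_ge0// ltW// expR_gt0.
have [i1 e1] := energy_int l.
apply: (@le_trans _ _ (\int[mu]_(u in P) (k * energy l u - k * q u))).
  rewrite (intB mP (L1Zl k mP i1) (L1Zl k mP iq)) (intZl k mP i1) (intZl k mP iq) e1.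
  move: int_q; move: (\int[mu]_(u in P) q u) (8 / _) => x y H.
  have : k * x <= k * (2 * L * pi * y) by rewrite ler_wpM2l.
  by move: (pi) => p; lra.
apply: int_le => //; first exact: (L1B mP (L1Zl k mP i1) (L1Zl k mP iq)).
move=> u; rewrite /= in_itv/= andbT => u0; have E0 := energy_ge0 l u.
have [far|near] := leP d `|u - l|.
  apply: (@le_trans _ _ 0); last by rewrite mulr_ge0// r_ge0.
  by rewrite -mulrBr mulr_ge0_le0// subr_le0; exact: energy_tail.
rewrite ltr_norml in near; case/andP: near => n1 n2.
apply: (@le_trans _ _ (k * energy l u)); first by rewrite gerBl mulr_ge0.
rewrite ler_wpM2r//; have /growth_le H : l - d <= u by lra.
have : k <= expR (- (2 * d)) * (expR (u - (l - d)) * r u).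
  by rewrite ler_wpM2l// ltW// expR_gt0.
move=> /le_trans; apply; rewrite mulrA -expRD ler_piMl ?r_ge0// expR_le1; lra.
Qed.

(** Within distance [d] of [l], growth gives [r u <= k]; outside, [r <= B] and [energy <= q]. So
    [k * energy + B * q] is a majorant everywhere. *)
Lemma average_le B : (forall u, 0 <= u -> r u <= B) ->
  \int[mu]_(u in P) (r u * energy l u) <=
  (expR (2 * d) * r (l + d) + B * (8 / (L * d))) * (2 * L * pi).
Proof.
move=> rB; set k := expR _ * r _.
have rd : 0 <= r (l + d) by apply: r_ge0; rewrite addr_ge0// ltW.
have k0 : 0 <= k by rewrite mulr_ge0// ltW// expR_gt0.
have B0 : 0 <= B by apply: le_trans (rB 0 _) => //; exact: r_ge0.
have [i1 e1] := energy_int l.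
apply: (@le_trans _ _ (\int[mu]_(u in P) (k * energy l u + B * q u))); last first.
  rewrite (intD mP (L1Zl k mP i1) (L1Zl B mP iq)) (intZl k mP i1) (intZl B mP iq) e1.
  move: int_q; move: (\int[mu]_(u in P) q u) (8 / _) => x y H.
  have : B * x <= B * (2 * L * pi * y) by rewrite ler_wpM2l.
  by move: (pi) => p; lra.
apply: int_le => //; first exact: (L1D mP (L1Zl k mP i1) (L1Zl B mP iq)).
move=> u; rewrite /= in_itv/= andbT => u0; have E0 := energy_ge0 l u.
have [far|near] := leP d `|u - l|.
  apply: (@le_trans _ _ (B * q u)); last by rewrite lerDr mulr_ge0.
  apply: ler_pM => //; [exact: r_ge0|exact: rB|exact: energy_tail].
rewrite ltr_norml in near; case/andP: near => n1 n2.
apply: (@le_trans _ _ (k * energy l u)); last by rewrite lerDl mulr_ge0.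
rewrite ler_wpM2r//; have /growth_le H : u <= l + d by lra.
by apply: (le_trans H); rewrite ler_wpM2r// ler_expR; lra.
Qed.

End Average.
End Segment.
End WaveEnergy.

(** * Removal of the Abel factor *)

Section Necessity.
Context {R : realType}.
Notation mu := (@lebesgue_measure R).
Local Open Scope complex_scope.
Local Notation P := (`[0%R, +oo[%classic : set R).

Let mP : measurable P. Proof. exact: measurable_itv. Qed.

Lemma symmetric_segment (L : R) : 0 < L ->
  bounded_symmetric_interval (`[- L, L]%classic : set R) /\ mu `[- L, L] = (2 * L)%:E.
Proof.
move=> L0; split; last first.
  rewrite lebesgue_measure_itv/= lte_fin; have -> : - L < L by rewrite gtrN.
  by rewrite /= -EFinD opprK mulr2n mulrDl mul1r.
split; first exact: interval_is_interval.
- exists L; split; first exact: num_real.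
  move=> y Ly x /=; rewrite in_itv/= -ler_norml => xL.
  by apply: (le_trans xL); exact: ltW.
by move=> x; rewrite /= !in_itv/= => /andP[h1 h2]; apply/andP; split; lra.
Qed.

Variable S : R -> R.
Hypothesis S_nd : {in `[0, +oo[ &, {homo S : x y / x <= y}}.
Hypothesis S_laplace : forall s : R[i], 1 < complex.Re s ->
  cintegrable `[0, +oo[ (laplace_integrand S s).

(* Unlike [density_ratio S], [excess] is nonnegative on [u >= 0], as Fatou's lemma requires. *)
Definition excess u := (S (expR u) - S 1) / expR u.

Lemma excess_ge0 u : 0 <= u -> 0 <= excess u.
Proof.
move=> u0; rewrite divr_ge0 ?expR_ge0// subr_ge0 -(@expR0 R).
exact: (S_expR_le S_nd).
Qed.

Lemma excess_nd u v : u <= v -> expR u * excess u <= expR v * excess v.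
Proof.
move=> uv; rewrite /excess ![expR _ * _]mulrC !mulfVK ?gt_eqF ?expR_gt0//.
by rewrite lerD2r; exact: (S_expR_le S_nd).
Qed.

Lemma ratio_excess u : density_ratio S u = excess u + S 1 * expR (- (u * 1)).
Proof. by rewrite /density_ratio /excess mulr1 expRN; ring. Qed.

Section Segment.
Variable L : R.
Hypothesis L0 : 0 < L.
Local Notation I := (`[- L, L]%classic : set R).

Let mI : measurable I. Proof. exact: measurable_itv. Qed.
Let IL t : I t -> `|t| <= L. Proof. by rewrite ler_norml /= in_itv. Qed.
Let L_ge0 : 0 <= L. Proof. exact: ltW. Qed.

Lemma L1_mul_energy w l : L1 P w -> L1 P (fun u => w u * energy L l u).
Proof.
move=> iw.
have ic := sq_L1_bounded mI IL (sq_cosw L l); have is_ := sq_L1_bounded mI IL (sq_sinw L l).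
apply: L1_eq (L1D mP (L1_mul_spec mI IL mP iw ic ic) (L1_mul_spec mI IL mP iw is_ is_)) => // u _.
by rewrite -mulrDr.
Qed.

(** [average_le] is applied to [exp(-u)], for which [e^u r(u)] is constant. The window [d = l / 2]
    makes the central term [exp(-l / 2)] and the outside share [16 / (L l)], and both vanish. *)
Lemma decay_energy_cvg0 :
  \int[mu]_(u in P) (expR (- (u * 1)) * energy L l u) @[l --> +oo] --> 0.
Proof.
have le1 (l : R) : 0 < l ->
    0 <= \int[mu]_(u in P) (expR (- (u * 1)) * energy L l u) <=
    (expR (- (l * 2^-1)) + 16 / L * l^-1) * (2 * L * pi).
  move=> l0; apply/andP; split.
    by apply: Rintegral_ge0 => u _; rewrite mulr_ge0 ?energy_ge0 ?expR_ge0.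
  have d0 : 0 < l / 2 by rewrite divr_gt0.
  have dl : l / 2 < l by lra.
  have nd (u v : R) : u <= v -> expR u * expR (- (u * 1)) <= expR v * expR (- (v * 1)).
    by rewrite !mulr1 !expRN !mulfV ?gt_eqF ?expR_gt0.
  have H := average_le L0 (fun u _ => expR_ge0 _) nd d0 dl (L1_mul_energy l (L1_decay ltr01)).
  have e1 (u : R) : 0 <= u -> expR (- (u * 1)) <= 1 by move=> u0; rewrite expR_le1 mulr1 oppr_le0.
  apply: (le_trans (H 1 e1)).
  rewrite -expRD mul1r le_eqVlt; apply/orP; left; apply/eqP.
  congr ((_ + _) * _); last by field; rewrite !gt_eqF.
  by congr expR; field.
have c1 : (expR (- (l * 2^-1)) + 16 / L * l^-1) * (2 * L * pi) @[l --> +oo] --> (0 : R).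
  rewrite -[X in _ --> X](mul0r (2 * L * pi)); apply: cvgM; last exact: cvg_cst.
  rewrite -[X in _ --> X](addr0 (0 : R)); apply: cvgD.
    by apply: cvg_expR_decay; rewrite invr_gt0.
  rewrite -[X in _ --> X](mulr0 (16 / L)); apply: cvgM; first exact: cvg_cst.
  apply: (@gtr0_cvgV0 _ _ (pinfty_nbhs R) _ idfun _).2 => //.
  exact: (nbhs_pinfty_gt (num_real 0)).
apply: (squeeze_cvgr _ (cvg_cst 0) c1); near=> l; apply: le1.
by near: l; exact: (nbhs_pinfty_gt (num_real 0)).
Unshelve. all: by end_near. Qed.

(** The Abel means converge although [density_ratio S] times the energy is not known to be
    integrable. Subtracting the integrable [S(1) exp(-u)] leaves a nonnegative function, which Fatou
    shows to be integrable; [cvg_abel] then identifies its integral. *)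
Lemma excess_energy_int l (c : R) :
  \int[mu]_(u in P) (abel_weight S e u * energy L l u) @[e --> 0^'+] --> c ->
  L1 P (fun u => excess u * energy L l u) /\
  \int[mu]_(u in P) (excess u * energy L l u) =
    c - S 1 * \int[mu]_(u in P) (expR (- (u * 1)) * energy L l u).
Proof.
move=> cc; have iD := L1_mul_energy l (L1_decay (ltr01 : (0:R) < 1)).
set J := \int[mu]_(u in P) (expR (- (u * 1)) * energy L l u).
have iDe e : 0 < e -> L1 P (fun u => expR (- (u * e)) * (expR (- (u * 1)) * energy L l u)).
  move=> e0; apply: L1_eq (L1_mul_energy l (L1_decay (addr_gt0 e0 ltr01))) => // u _.
  by rewrite mulrA -expRD -opprD -(mulrDr u).
have iW e : 0 < e -> L1 P (fun u => abel_weight S e u * energy L l u).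
  by move=> e0; apply: L1_mul_energy; exact: L1_abel_weight.
have E e u : expR (- (u * e)) * (excess u * energy L l u) = abel_weight S e u * energy L l u -
    S 1 * (expR (- (u * e)) * (expR (- (u * 1)) * energy L l u)).
  by rewrite /abel_weight ratio_excess; ring.
have iX e : 0 < e -> L1 P (fun u => expR (- (u * e)) * (excess u * energy L l u)).
  move=> e0.
  exact: (L1_eq mP (fun u _ => esym (E e u)) (L1B mP (iW e e0) (L1Zl (S 1) mP (iDe e e0)))).
have EX e : 0 < e -> \int[mu]_(u in P) (expR (- (u * e)) * (excess u * energy L l u)) =
    \int[mu]_(u in P) (abel_weight S e u * energy L l u) -
    S 1 * \int[mu]_(u in P) (expR (- (u * e)) * (expR (- (u * 1)) * energy L l u)).
  move=> e0; rewrite -(intZl (S 1) mP (iDe e e0)) -(intB mP (iW e e0) (L1Zl (S 1) mP (iDe e e0))).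
  by apply: eq_int => u _; exact: E.
have cX : \int[mu]_(u in P) (expR (- (u * e)) * (excess u * energy L l u)) @[e --> 0^'+] -->
    c - S 1 * J.
  have c1 : S 1 * \int[mu]_(u in P) (expR (- (u * e)) * (expR (- (u * 1)) * energy L l u))
    @[e --> 0^'+] --> S 1 * J by apply: cvgM; [exact: cvg_cst|exact: cvg_abel].
  apply: cvg_at_right_eq (cvgB cc c1) => e e0.
  exact: esym (EX e e0).
have iS : L1 P (fun u => excess u * energy L l u).
  have [d d0 dP] : exists2 d, 0 < d & forall e, 0 < e -> e < d ->
      \int[mu]_(u in P) (expR (- (u * e)) * (excess u * energy L l u)) <= c - S 1 * J + 1.
    move/cvgrPdist_le : (cX) => /(_ 1 ltr01) [d /= d0 dP]; exists d => // e e0 ed.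
    have : `|(c - S 1 * J) - \int[mu]_(u in P) (expR (- (u * e)) * (excess u * energy L l u))| <= 1.
      by apply: dP => //=; rewrite sub0r normrN gtr0_norm.
    rewrite ler_norml => /andP[+ _].
    by move: (Rintegral _ _ _) => x; lra.
  (* The parameters [d / (2 (n + 1))] tend to 0 and stay below [d], where the Abel means exceed
     their limit by at most 1: the uniform bound needed by Fatou. *)
  have e_gt0 n : 0 < d / 2 * n.+1%:R^-1 by rewrite !mulr_gt0.
  have e_lt n : d / 2 * n.+1%:R^-1 < d.
    have n1 : n.+1%:R^-1 <= 1 :> R by rewrite invf_le1 ?ler1n.
    have d2 : 0 <= d / 2 by lra.
    by apply: (le_lt_trans (ler_wpM2l d2 n1)); rewrite mulr1; lra.
  apply: (@fatou_int _ _ (fun n u => expR (- (u * (d / 2 * n.+1%:R^-1))) * (excess u * energy L l u)) _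
    (c - S 1 * J + 1) mP _ _ _ _ _).1.
  - by move=> n; exact: iX.
  - have m1 : measurable_fun P (fun u => expR (u * 1) : R).
      apply: measurable_funTS; apply: (measurableT_comp (@measurable_expR R)).
      exact: measurable_funM.
    apply: eq_measurable_fun (measurable_funM m1 (L1_meas (iX 1 ltr01))) => u _ /=.
    by rewrite mulrA -expRD subrr expR0 mul1r.
  - move=> n u; rewrite /= in_itv/= andbT => u0.
    by rewrite mulr_ge0 ?expR_ge0// mulr_ge0 ?energy_ge0// excess_ge0.
  - move=> u _; rewrite -[X in _ --> X]mul1r; apply: cvgM; last exact: cvg_cst.
    apply: cvg_decay1; rewrite -[X in _ --> X](mulr0 (d / 2)); apply: cvgM; first exact: cvg_cst.
    exact: cvg_harmonic.
  - by move=> n; exact: dP.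
split => //; exact: (cvg_unique _ (cvg_abel iS) cX).
Qed.

End Segment.
End Necessity.

(** * Averages of the excess on symmetric segments *)

Section NecessityTheorem.
Context {R : realType}.
Notation mu := (@lebesgue_measure R).
Local Open Scope complex_scope.
Local Notation P := (`[0%R, +oo[%classic : set R).

Let mP : measurable P. Proof. exact: measurable_itv. Qed.

Variable S : R -> R.
Hypothesis S_nd : {in `[0, +oo[ &, {homo S : x y / x <= y}}.
Hypothesis S_laplace : forall s : R[i], 1 < complex.Re s ->
  cintegrable `[0, +oo[ (laplace_integrand S s).

Section Segment.
Variable L : R.
Hypothesis L0 : 0 < L.
Local Notation I := (`[- L, L]%classic : set R).

Let mI : measurable I. Proof. exact: measurable_itv. Qed.
Let IL t : I t -> `|t| <= L. Proof. by rewrite ler_norml /= in_itv. Qed.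
Let L_ge0 : 0 <= L. Proof. exact: ltW. Qed.

Variables (A : R[i]) (W Psi : (R -> R[i]) -> (R -> R[i])).
Hypotheses (bW : bounded_operator I W) (wW : weak_limit_W S I W) (cPsi : compact_operator I Psi).
Hypothesis WPsi : forall f, inL2 I f -> L2eq I (W f) (fun t => A * f t + Psi f t).

Let cwave := compact_wave_cvg0 mI IL cPsi (@cos_max R) cos_lip
  (fun g l sg loo => (trans_cvg0 mI IL L_ge0 sg loo).1).
Let swave := compact_wave_cvg0 mI IL cPsi (@sin_max R) sin_lip
  (fun g l sg loo => (trans_cvg0 mI IL L_ge0 sg loo).2).

Let cform l := form_limit S_laplace mI IL bW wW cPsi WPsi
  (sqC_wave mI IL (@cos_max R) cos_lip l).
Let sform l := form_limit S_laplace mI IL bW wW cPsi WPsi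
  (sqC_wave mI IL (@sin_max R) sin_lip l).

(** Adding the imaginary equations for cosine and sine waves gives the same constant
    [- (Im A * 2 L)] at every frequency, while compactness sends the left side to 0. *)
Lemma limit_operator_real : complex.Im A = 0.
Proof.
have alg (x y z p q : R) : x * y + p = 0 -> x * z + q = 0 -> p + q = - (x * (y + z)).
  by move=> *; lra.
pose h l := ip I (imf (Psi (wave cos l))) (fun t => cos (l * t)) +
  ip I (imf (Psi (wave sin l))) (fun t => sin (l * t)).
have hE l : h l = - (complex.Im A * (2 * L)).
  by rewrite -(ip_waves L0 l); exact: alg (cform l).2 (sform l).2.
have c0 : h l @[l --> +oo] --> 0.
  by rewrite -[X in _ --> X](addr0 (0 : R)); exact: cvgD cwave.2 swave.2.
have c1 : h l @[l --> +oo] --> - (complex.Im A * (2 * L)).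
  by rewrite (_ : h = fun=> - (complex.Im A * (2 * L))); [exact: cvg_cst|apply/funext].
have /eqP : 0 = - (complex.Im A * (2 * L)) by exact: (cvg_unique _ c0 c1).
by rewrite eq_sym oppr_eq0 !mulf_eq0 (gt_eqF L0) pnatr_eq0 !orbF => /eqP.
Qed.

Let c l := pi * (complex.Re A * (2 * L) + (ip I (ref (Psi (wave cos l))) (fun t => cos (l * t)) +
  ip I (ref (Psi (wave sin l))) (fun t => sin (l * t)))).

Let energy_limit l :
  \int[mu]_(u in P) (abel_weight S e u * energy L l u) @[e --> 0^'+] --> c l.
Proof.
have alg (x y z p q : R) : (x * y + p) + (x * z + q) = x * (y + z) + (p + q) by ring.
have ic := sq_L1_bounded mI IL (sq_cosw L l); have is_ := sq_L1_bounded mI IL (sq_sinw L l).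
have H : pi * (abel_form S I e (fun t => cos (l * t)) (fun t => cos (l * t)) +
    abel_form S I e (fun t => sin (l * t)) (fun t => sin (l * t))) @[e --> 0^'+] --> c l.
  apply: cvgM; first exact: cvg_cst.
  by rewrite -(ip_waves L0 l) -alg; exact: cvgD (cform l).1 (sform l).1.
apply: cvg_at_right_eq H => e e0; have iw := L1_abel_weight S_laplace e0.
rewrite /abel_form -mulrDr mulrA mulfV ?gt_eqF ?pi_gt0// mul1r.
rewrite -(intD mP (L1_mul_spec mI IL mP iw ic ic) (L1_mul_spec mI IL mP iw is_ is_)).
by apply: eq_int => u _; rewrite -mulrDr.
Qed.

Lemma segment_averages : exists2 m : R -> R, m x @[x --> +oo] --> complex.Re A &
  forall d x, 0 < d -> d < x ->
    expR (- (2 * d)) * excess S (x - d) * (1 - 8 / (L * d)) <= m x /\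
    forall B, (forall u, 0 <= u -> excess S u <= B) ->
      m x <= expR (2 * d) * excess S (x + d) + B * (8 / (L * d)).
Proof.
have p0 := pi_gt0 R; have Lp0 : 0 < 2 * L * pi by rewrite !mulr_gt0.
(* Division by the total energy turns the kernel into a probability density. *)
exists (fun l => (\int[mu]_(u in P) (excess S u * energy L l u)) / (2 * L * pi)); last first.
  move=> d x d0 dx; have [iE _] := excess_energy_int S_nd S_laplace (@energy_limit x).
  rewrite ler_pdivlMr//; split.
    exact: (average_ge L0 (excess_ge0 S_nd) (excess_nd S_nd) d0 dx iE).
  move=> B BP; rewrite ler_pdivrMr//.
  exact: (average_le L0 (excess_ge0 S_nd) (excess_nd S_nd) d0 dx iE BP).
have -> : (fun l => (\int[mu]_(u in P) (excess S u * energy L l u)) / (2 * L * pi)) =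
    fun l => (c l - S 1 * \int[mu]_(u in P) (expR (- (u * 1)) * energy L l u)) / (2 * L * pi).
  by apply/funext => l; rewrite (excess_energy_int S_nd S_laplace (@energy_limit l)).2.
have cc : c l @[l --> +oo] --> pi * (complex.Re A * (2 * L)).
  apply: cvgM; first exact: cvg_cst.
  rewrite -[X in _ --> X]addr0; apply: cvgD; first exact: cvg_cst.
  by rewrite -[X in _ --> X](addr0 (0 : R)); exact: cvgD cwave.1 swave.1.
have cJ : S 1 * \int[mu]_(u in P) (expR (- (u * 1)) * energy L l u) @[l --> +oo] --> S 1 * 0.
  by apply: cvgM; [exact: cvg_cst|exact: decay_energy_cvg0].
have -> : complex.Re A = (pi * (complex.Re A * (2 * L)) - S 1 * 0) / (2 * L * pi).
  by rewrite mulr0 subr0 mulrCA [pi * _]mulrC mulfK// gt_eqF.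
by apply: cvgM; [exact: cvgB cc cJ|exact: cvg_cst].
Qed.

End Segment.

Lemma necessity (A : R[i]) (L1 : R) : 0 < L1 ->
  (forall I : set R, bounded_symmetric_interval I -> (L1%:E <= mu I)%E ->
    exists W : (R -> R[i]) -> (R -> R[i]),
      [/\ bounded_operator I W, weak_limit_W S I W
        & exists Psi : (R -> R[i]) -> (R -> R[i]),
            compact_operator I Psi /\
            forall f, inL2 I f -> L2eq I (W f) (fun t => A * f t + Psi f t)]) ->
  (S (expR u) / expR u)%:C @[u --> +oo%R] --> (A : R[i]^o).
Proof.
move=> L1_gt0 H.
have seg L : L1 <= L -> 0 < L -> complex.Im A = 0 /\
  exists2 m : R -> R, m x @[x --> +oo] --> complex.Re A &
  forall d x, 0 < d -> d < x ->
    expR (- (2 * d)) * excess S (x - d) * (1 - 8 / (L * d)) <= m x /\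
    forall B, (forall u, 0 <= u -> excess S u <= B) ->
      m x <= expR (2 * d) * excess S (x + d) + B * (8 / (L * d)).
  move=> L1L L0; have [bI mI] := symmetric_segment L0.
  have [|W [bW wW [Psi [cPsi WPsi]]]] := H _ bI; first by rewrite mI lee_fin; lra.
  split; first exact: (limit_operator_real L0 bW wW cPsi WPsi).
  exact: (segment_averages L0 bW wW cPsi WPsi).
have [ImA _] := seg _ (lexx L1) L1_gt0.
have cr : excess S x @[x --> +oo] --> complex.Re A.
  apply: (@averaged_cvg _ _ _ 8 L1 (excess_ge0 S_nd) (excess_nd S_nd)) => // L L1L L0.
  exact: (seg L L1L L0).2.
(* The ratio differs from the excess by [S 1 * expR (- u)], which tends to 0. *)
have ca : density_ratio S u @[u --> +oo] --> complex.Re A.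
  rewrite (_ : density_ratio S = fun u => excess S u + S 1 * expR (- (u * 1))); last first.
    by apply/funext => u; exact: ratio_excess.
  rewrite -[X in _ --> X]addr0 -[X in _ + X](mulr0 (S 1)).
  by apply: cvgD => //; apply: cvgM; [exact: cvg_cst|exact: cvg_expR_decay].
have -> : A = complex.Re A +i* 0 by case: (A) ImA => x y /= ->.
by apply: cvg_complex => /=; [exact: ca|exact: cvg_cst].
Qed.

End NecessityTheorem.

Local Open Scope complex_scope.

Theorem theorem1p2 (R : realType) (S : R -> R)
  (S_nd : {in `[0, +oo[ &, {homo S : x y / x <= y}})
  (S_laplace : forall s : R[i], 1 < complex.Re s ->
     cintegrable `[0, +oo[ (laplace_integrand S s))
  (A : R[i]) :
  (exists L0 : R, 0 < L0 /\
    forall I : set R, bounded_symmetric_interval I ->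
      (L0%:E <= lebesgue_measure I)%E ->
      exists W : (R -> R[i]) -> (R -> R[i]),
        [/\ bounded_operator I W, weak_limit_W S I W
          & exists Psi : (R -> R[i]) -> (R -> R[i]),
              compact_operator I Psi /\
              forall f, inL2 I f ->
                L2eq I (W f) (fun t => A * f t + Psi f t)])
  <->
  ((S (expR u) / expR u)%:C @[u --> +oo%R] --> (A : R[i]^o)).
Proof.
split=> [[L0 [L0_gt0 H]]|cA]; first exact: (necessity S_nd S_laplace L0_gt0 H).
(* This direction holds on every bounded symmetric interval, so any positive threshold would do. *)
by exists 1; split => // I bI _; exact: (sufficiency S_nd S_laplace cA bI).
Qed.
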